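(* Let $\mu$ be a finite positive Borel measure on $\overline{\mathbb D}$ and $\Psi_1,\Psi_2$ Orlicz functions. 1) If the identity maps $H^{\Psi_1}$ continuously into $L^{\Psi_2}(\mu)$, then there is $A>0$ with $\rho_\mu(h)\le\dfrac{1}{\Psi_2(A\Psi_1^{-1}(1/h))}$ for every $h\in(0,1]$. 2) If there is $A>0$ with $K_\mu(h)\le\dfrac{1/h}{\Psi_2(A\Psi_1^{-1}(1/h))}$ for every $h\in(0,1]$, then the identity maps $H^{\Psi_1}$ continuously into $L^{\Psi_2}(\mu)$.
   Context: An Orlicz function is a continuous, strictly convex, increasing $\Psi\colon[0,\infty)\to[0,\infty)$ with $\Psi(0)=0$ and $\Psi(x)/x\to\infty$. For a finite measure $\nu$, $L^\Psi(\nu)$ is the space of measurable $f$ with finite Luxemburg norm $\|f\|_{L^\Psi(\nu)}=\inf\{C>0:\int\Psi(|f|/C)\,d\nu\le1\}$. $H^\Psi$ = analytic $f$ on $\mathbb D$ with $\sup_{r<1}\|f(re^{i\cdot})\|_{L^\Psi(m)}<\infty$ ($m$ normalized measure on $\mathbb T$), with boundary function $f^*$; an $f\in H^\Psi$ is regarded as a function on $\overline{\mathbb D}$ equal to $f$ on $\mathbb D$ and $f^*$ on $\mathbb T$. Carleson window: $W(\xi,h)=\{z\in\overline{\mathbb D}:1-h<|z|\le1,\ |\arg(z\bar\xi)|<h\}$ for $\xi\in\mathbb T$, $h\in(0,1]$. $\rho_\mu(h)=\sup_{\xi\in\mathbb T}\mu(W(\xi,h))$ and $K_\mu(h)=\sup_{0<t\le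 h}\rho_\mu(t)/t$. *)

(* Defs.v *)
From mathcomp Require Import all_boot all_order all_algebra.
From mathcomp Require Import all_classical all_reals all_analysis.
From mathcomp.real_closed Require Import complex.
Set Implicit Arguments. Unset Strict Implicit. Unset Printing Implicit Defensive.
Import Order.TTheory GRing.Theory Num.Theory.
Import numFieldNormedType.Exports.
Local Open Scope classical_set_scope.
Local Open Scope ring_scope.

Section Defs.
Variable R : realType.

Definition cmod (z : R[i]) : R := Normc.normc z.

Definition expi (t : R) : R[i] := (cos t +i* sin t)%C.

(* points of the plane R x R (with its Borel = product sigma-algebra) seen as complex numbers *)
Definition toC (p : R * R) : R[i] := (p.1 +i* p.2)%C.

Definition cdisc : set (R * R) := [set p | cmod (toC p) <= 1].

Definition orlicz (Psi : R -> R) : Prop :=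
  [/\ Psi 0 = 0,
      {within `[0, +oo[, continuous Psi},
      (forall x y, 0 <= x -> x < y -> Psi x < Psi y),
      (forall x y t, 0 <= x -> 0 <= y -> x != y -> 0 < t < 1 ->
         Psi (t * x + (1 - t) * y) < t * Psi x + (1 - t) * Psi y)
    & (Psi x / x @[x --> +oo] --> +oo)].

Definition orlicz_inv (Psi : R -> R) (y : R) : R :=
  match pselect (exists x, 0 <= x /\ Psi x = y) with
  | left P => projT1 (cid P)
  | right _ => 0
  end.

Definition luxemburg d (T : measurableType d) (nu : {measure set T -> \bar R})
    (D : set T) (Psi : R -> R) (g : T -> R) : \bar R :=
  ereal_inf [set C%:E | C in [set C : R | 0 < C /\
     (\int[nu]_(x in D) (Psi (`|g x| / C))%:E <= 1)%E]].

Definition luxemburg_circle (Psi : R -> R) (g : R -> R) : \bar R :=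
  ereal_inf [set C%:E | C in [set C : R | 0 < C /\
     (((2 * pi)^-1)%:E *
       \int[lebesgue_measure]_(t in `[0%R, (2 * pi)%R]) (Psi (`|g t| / C))%:E <= 1)%E]].

Definition analytic_disc (f : R[i] -> R[i]) : Prop :=
  forall z, cmod z < 1 -> exists l : R[i], forall e : R, 0 < e ->
    exists2 del : R, 0 < del & forall w, cmod w < 1 -> 0 < cmod (w - z) < del ->
      cmod ((f w - f z) / (w - z) - l) < e.

Definition hardy_norm (Psi : R -> R) (f : R[i] -> R[i]) : \bar R :=
  ereal_sup [set luxemburg_circle Psi (fun t => cmod (f (r%:C * expi t)%C))
            | r in [set r : R | 0 <= r < 1]].

Definition in_hardy (Psi : R -> R) (f : R[i] -> R[i]) : Prop :=
  analytic_disc f /\ (hardy_norm Psi f < +oo)%E.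

Definition radial_limit (f : R[i] -> R[i]) (xi l : R[i]) : Prop :=
  forall e : R, 0 < e -> exists2 del : R, 0 < del &
    forall r : R, 0 <= r -> 1 - del < r < 1 -> cmod (f (r%:C * xi)%C - l) < e.

Definition boundary (f : R[i] -> R[i]) (xi : R[i]) : R[i] :=
  match pselect (exists l, radial_limit f xi l) with
  | left P => projT1 (cid P)
  | right _ => 0
  end.

Definition fext (f : R[i] -> R[i]) (z : R[i]) : R[i] :=
  if cmod z < 1 then f z else boundary f z.

Definition hardy_embeds (mu : {finite_measure set (R * R)%type -> \bar R})
    (Psi1 Psi2 : R -> R) : Prop :=
  exists2 K : R, 0 <= K & forall f, in_hardy Psi1 f ->
    [/\ measurable_fun cdisc (fun p => complex.Re (fext f (toC p))),
        measurable_fun cdisc (fun p => complex.Im (fext f (toC p)))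
      & (luxemburg mu cdisc Psi2 (fun p => cmod (fext f (toC p)))
           <= K%:E * hardy_norm Psi1 f)%E].

(* Carleson window W(xi,h); |arg(z conj xi)| < h written out (h <= 1 < pi) *)
Definition window (xi : R[i]) (h : R) : set (R * R) :=
  [set p | 1 - h < cmod (toC p) <= 1 /\
     exists t : R, - h < t < h /\ (toC p * conjc xi = (cmod (toC p))%:C * expi t)%C].

Definition rho_mu (mu : {finite_measure set (R * R)%type -> \bar R}) (h : R) : \bar R :=
  ereal_sup [set mu (window xi h) | xi in [set xi : R[i] | cmod xi = 1]].

Definition K_mu (mu : {finite_measure set (R * R)%type -> \bar R}) (h : R) : \bar R :=
  ereal_sup [set (rho_mu mu t * (t^-1)%:E)%E | t in [set t : R | 0 < t <= h]].

End Defs.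
Arguments cdisc {R}.

(* Main.v *)
(** Necessity: the squares of h / (1 - (1 - h) conj(xi) z) have modulus at least 1/16 on the window
    W(xi, h), modulus at most 1 on the disc and circle means at most h by the Poisson integral, so
    that their norm in H^Psi1 is at most 1 / Psi1^-1(1/h).

    Sufficiency: |f|^(1/2) lies below its Poisson integral: max modulus and AM-GM applied to the
    product of the rotates of f give this at the centre, a Moebius change of variable elsewhere.
    Hence, if |f(z)|^(1/2) > s, then the average of the excess (|f|^(1/2) - s/2)^+ over some arc of
    half-length at least 1 - |z| around z/|z| is at least a constant times s. A Vitali covering by
    such arcs gives
      mu (|f|^(1/2) > s) <= C K_mu(H) s^-1 (integral of the excess)
    as soon as the excess is small enough for these arcs to be shorter than H, which holds for
    1/H = Psi1(c s^2) when the mean of Psi1(|f|) is at most 1. The hypothesis on K_mu then turns the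
    layer-cake sum over s = s0 2^j into a bound for the integral of Psi2(|f|/B). Dilations and
    Fatou's lemma pass from functions analytic across the circle to the whole space. *)
Require Import Defs.
From mathcomp Require Import all_boot all_order all_algebra.
From mathcomp Require Import all_classical all_reals all_analysis.
From mathcomp Require Import measurable_realfun ring lra.
From mathcomp.real_closed Require Import complex.
Set Implicit Arguments. Unset Strict Implicit. Unset Printing Implicit Defensive.
Import Order.TTheory GRing.Theory Num.Theory.
Import numFieldNormedType.Exports.
Local Open Scope classical_set_scope.
Local Open Scope ring_scope.

(** * Integrals over segments *)

Section SegmentIntegral.
Variable R : realType.
Implicit Types (a b c k M : R) (u v : R -> R).
Local Notation mu := (@lebesgue_measure R).

(** The exponent 1/2 is what lets bare convexity suffice. With weak-type bounds for |f| itself,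
    convexity would bound each level s below |f| by a fixed multiple of Psi1(|f|), with no decay
    over the levels. For u = |f|^(1/2) the level s stands for the value s^2, and Psi1(s^2/(4C)) u /
    s is at most s Psi1(u^2) / (4C u): the bounds grow geometrically in s, and the last ones, with s
    close to 2u, dominate the sum. The truncation at s/2 serves twice. It restricts the level s to
    the part of the circle where u > s/2, and it makes the integral of the excess small enough,
    again by convexity, for the selected windows to stay below H = 1/Psi1(s^2/(4C)). At h = H the
    inverse Psi1^-1(1/h) is s^2/(4C), so that the denominator Psi2(A s^2/(4C)) in the hypothesis on
    K_mu cancels the weight Psi2(4 s^2/B) of the layer, up to a constant. The constants form a
    chain: K >= 512 comes from the decay of the Poisson kernel, 24 K from the covering, and C >= 96
    K absorbs 24 K pi. *)

Definition cont_seg a b u := forall x, a <= x <= b -> {for x, continuous u}.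

Definition sint a b u : R := (\int[mu]_(x in `[a, b]) u x)%R.

Lemma cont_seg_sub a b c d u : a <= c -> d <= b -> cont_seg a b u -> cont_seg c d u.
Proof. by move=> ac db h x /andP[cx xd]; apply: h; lra. Qed.

Lemma cont_seg_int a b u : cont_seg a b u -> mu.-integrable `[a, b] (EFin \o u).
Proof.
move=> h; apply: continuous_compact_integrable; first exact: segment_compact.
by apply: continuous_in_subspaceT => x /set_mem /=; rewrite in_itv /= => /h.
Qed.

Lemma sint_split a b c u : a <= c <= b -> cont_seg a b u ->
  sint a b u = sint a c u + sint c b u.
Proof.
move=> /andP[ac cb] h.
have h2 : mu.-integrable `[c, b] (EFin \o u).
  by apply: cont_seg_int; exact: cont_seg_sub h.
have h3 : mu.-integrable `]c, b] (EFin \o u).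
  by apply: integrableS h2 => //; apply: subset_itvr; rewrite bnd_simp.
rewrite /sint -(@Rintegral_itv_obnd_cbnd _ c) //.
have := @Rintegral_itvB _ u (BLeft a) (BRight b) c (cont_seg_int h).
by rewrite !bnd_simp => /(_ ac cb) <-; rewrite addrC subrK.
Qed.

Lemma sint_add a b u v : cont_seg a b u -> cont_seg a b v ->
  sint a b (fun x => u x + v x) = sint a b u + sint a b v.
Proof. by move=> hu hv; apply: RintegralD => //; apply: cont_seg_int. Qed.

Lemma sint_sub a b u v : cont_seg a b u -> cont_seg a b v ->
  sint a b (fun x => u x - v x) = sint a b u - sint a b v.
Proof. by move=> hu hv; apply: RintegralB => //; apply: cont_seg_int. Qed.

Lemma sint_scale a b k u : cont_seg a b u ->
  sint a b (fun x => k * u x) = k * sint a b u.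
Proof. by move=> hu; apply: RintegralZl => //; apply: cont_seg_int. Qed.

Lemma sint_cst a b k : a <= b -> sint a b (fun=> k) = k * (b - a).
Proof.
move=> ab; rewrite /sint Rintegral_cst //= lebesgue_measure_itv /= lte_fin.
case: ifP => [//|/negbT]; rewrite -leNgt => ba.
have -> : b = a by apply/eqP; rewrite eq_le ab ba.
by rewrite subrr.
Qed.

Lemma eq_sint a b u v : (forall x, a <= x <= b -> u x = v x) -> sint a b u = sint a b v.
Proof.
by move=> h; apply: eq_Rintegral => x /set_mem /=; rewrite in_itv /=; exact: h.
Qed.

Lemma le_sint a b u v : cont_seg a b u -> cont_seg a b v ->
  (forall x, a <= x <= b -> u x <= v x) -> sint a b u <= sint a b v.
Proof.
by move=> hu hv h; apply: le_Rintegral => //; exact: cont_seg_int.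
Qed.

Lemma cont_seg_cst a b k : cont_seg a b (fun=> k).
Proof. by move=> x _; exact: cvg_cst. Qed.

Lemma norm_sint_le a b M u : a <= b -> cont_seg a b u ->
  (forall x, a <= x <= b -> `|u x| <= M) -> `|sint a b u| <= M * (b - a).
Proof.
move=> ab hu h; rewrite ler_norml -mulNr -!sint_cst //.
apply/andP; split; apply: le_sint => //; try exact: cont_seg_cst.
- by move=> x /h; rewrite ler_norml => /andP[].
- by move=> x /h; rewrite ler_norml => /andP[].
Qed.

Lemma sint_ge0 a b u : (forall x, a <= x <= b -> 0 <= u x) -> 0 <= sint a b u.
Proof. by move=> h; apply: Rintegral_ge0 => x /=; rewrite in_itv /=; exact: h. Qed.

Lemma cont_seg_add a b u v : cont_seg a b u -> cont_seg a b v ->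
  cont_seg a b (fun x => u x + v x).
Proof. by move=> hu hv x xab; apply: cvgD; [exact: hu|exact: hv]. Qed.

Lemma cont_seg_subr a b u v : cont_seg a b u -> cont_seg a b v ->
  cont_seg a b (fun x => u x - v x).
Proof. by move=> hu hv x xab; apply: cvgB; [exact: hu|exact: hv]. Qed.

Lemma sint_shift a b p u : a <= b -> (forall x, {for x, continuous u}) ->
  sint (a + p) (b + p) u = sint a b (fun x => u (x + p)).
Proof.
move=> ab cu; rewrite /sint /Rintegral; congr fine.
have dF x : derivable (fun x => x + p) x 1 by apply: derivableD.
have dF1 : derive1 (fun x : R => x + p) = fun=> 1.
  by apply/funext => x; rewrite derive1E deriveD // derive_id derive_cst addr0.
rewrite (@integration_by_substitution_increasing _ (fun x => x + p) u a b) //=.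
- by apply: eq_integral => x _ /=; rewrite dF1 mulr1.
- by move=> x y _ _; rewrite ltrD2r.
- by rewrite dF1 => x _; exact: cvg_cst.
- by rewrite dF1; exact: is_cvg_cst.
- by rewrite dF1; exact: is_cvg_cst.
- split.
  + by move=> x _; exact: dF.
  + apply: cvg_at_right_filter; apply: cvgD; [exact: cvg_id|exact: cvg_cst].
  + apply: cvg_at_left_filter; apply: cvgD; [exact: cvg_id|exact: cvg_cst].
- by apply: continuous_subspaceT.
Qed.

(** For a >= 0 the segment from 0 to a + p is split at a and at p; the pieces from 0 to a and from p
    to a + p are translates by one period and cancel. For a < 0 the same is done from a to p, split
    at 0 and at a + p. *)
Lemma sint_period a p u : 0 <= p -> (forall x, {for x, continuous u}) ->
  (forall x, u (x + p) = u x) -> sint a (a + p) u = sint 0 p u.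
Proof.
move=> p0 cu per.
have h x y : x <= y -> sint (x + p) (y + p) u = sint x y u.
  by move=> xy; rewrite sint_shift //; apply: eq_sint => z _.
have [a0|a0] := leP 0 a.
- have E : sint 0 (a + p) u = sint 0 a u + sint a (a + p) u.
    by rewrite -sint_split //; first lra.
  have E2 : sint 0 (a + p) u = sint 0 p u + sint p (a + p) u.
    by rewrite -sint_split //; first lra.
  have := h _ _ a0; rewrite add0r => E3; lra.
- have E : sint a p u = sint a 0 u + sint 0 p u.
    by rewrite -sint_split //; first lra.
  have E2 : sint a p u = sint a (a + p) u + sint (a + p) p u.
    by rewrite -sint_split //; first lra.
  have := h _ _ (ltW a0); rewrite add0r => E3; lra.
Qed.

End SegmentIntegral.

(** * Goursat's theorem for rectangles *)

Section Rectangle.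
Variable R : realType.
Implicit Types (x t w h : R).
Variables U V : R -> R -> R.

(** The imaginary part of the counterclockwise contour integral of U + iV around the rectangle with
    lower left corner (x, t) and sides w, h. *)
Definition circulation x t w h : R :=
  sint t (t + h) (fun s => U (x + w) s - U x s) -
  sint x (x + w) (fun y => V y (t + h) - V y t).

Variables x0 t0 w0 h0 : R.
Hypothesis w0_gt0 : 0 < w0.
Hypothesis h0_gt0 : 0 < h0.
Let inQ x t := (x0 <= x <= x0 + w0) && (t0 <= t <= t0 + h0).
Hypothesis contU : forall x t, inQ x t -> {for t, continuous (U x)}.
Hypothesis contV : forall x t, inQ x t -> {for x, continuous (V ^~ t)}.

(* The shared coefficient a encodes the Cauchy-Riemann equation dU/dx = dV/dt. *)
Hypothesis diffUV : forall x t, inQ x t -> exists a b c : R,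
  forall e : R, 0 < e -> exists2 d : R, 0 < d & forall x' t', inQ x' t' ->
    `|x' - x| < d -> `|t' - t| < d ->
    `|U x' t' - U x t - a * (x' - x) - b * (t' - t)| <= e * (`|x' - x| + `|t' - t|) /\
    `|V x' t' - V x t - c * (x' - x) - a * (t' - t)| <= e * (`|x' - x| + `|t' - t|).

Let subQ x t w h := [&& x0 <= x, x + w <= x0 + w0, t0 <= t, t + h <= t0 + h0,
  0 <= w & 0 <= h].

Let cU x t h : x0 <= x <= x0 + w0 -> t0 <= t -> t + h <= t0 + h0 ->
  cont_seg t (t + h) (U x).
Proof.
by move=> hx ht hh s /andP[ts sh]; apply: contU; rewrite /inQ hx /=; apply/andP; split; lra.
Qed.

Let cV x t w : t0 <= t <= t0 + h0 -> x0 <= x -> x + w <= x0 + w0 ->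
  cont_seg x (x + w) (V ^~ t).
Proof.
by move=> ht hx hw y /andP[xy yw]; apply: contV; rewrite /inQ ht andbT; apply/andP; split; lra.
Qed.

(** Each inner edge is traversed twice, in opposite directions. *)
Let circulation_split x t w h : subQ x t (w + w) (h + h) ->
  circulation x t (w + w) (h + h) =
  circulation x t w h + circulation (x + w) t w h +
  circulation x (t + h) w h + circulation (x + w) (t + h) w h.
Proof.
case/and5P=> A B C D /andP[E F]; rewrite /circulation.
have ex : x <= x + w <= x + (w + w) by apply/andP; split; lra.
have et : t <= t + h <= t + (h + h) by apply/andP; split; lra.
have cu y : x0 <= y <= x0 + w0 -> cont_seg t (t + (h + h)) (U y).
  by move=> hy; apply: cU.
have cv y : t0 <= y <= t0 + h0 -> cont_seg x (x + (w + w)) (V ^~ y).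
  by move=> hy; apply: cV.
have [X0 X1 X2] : [/\ x0 <= x <= x0 + w0, x0 <= x + w <= x0 + w0 &
   x0 <= x + (w + w) <= x0 + w0] by split; apply/andP; split; lra.
have [T0 T1 T2] : [/\ t0 <= t <= t0 + h0, t0 <= t + h <= t0 + h0 &
   t0 <= t + (h + h) <= t0 + h0] by split; apply/andP; split; lra.
have su y z : x0 <= y <= x0 + w0 -> x0 <= z <= x0 + w0 ->
  [/\ sint t (t + (h + h)) (fun s => U y s - U z s) =
      sint t (t + (h + h)) (U y) - sint t (t + (h + h)) (U z),
      sint t (t + h) (fun s => U y s - U z s) =
      sint t (t + h) (U y) - sint t (t + h) (U z) &
      sint (t + h) (t + (h + h)) (fun s => U y s - U z s) =
      sint (t + h) (t + (h + h)) (U y) - sint (t + h) (t + (h + h)) (U z)].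
  by move=> hy hz; split; apply: sint_sub; apply: cont_seg_sub (cu _ _) => //; lra.
have sv y z : t0 <= y <= t0 + h0 -> t0 <= z <= t0 + h0 ->
  [/\ sint x (x + (w + w)) (fun s => V s y - V s z) =
      sint x (x + (w + w)) (V ^~ y) - sint x (x + (w + w)) (V ^~ z),
      sint x (x + w) (fun s => V s y - V s z) =
      sint x (x + w) (V ^~ y) - sint x (x + w) (V ^~ z) &
      sint (x + w) (x + (w + w)) (fun s => V s y - V s z) =
      sint (x + w) (x + (w + w)) (V ^~ y) - sint (x + w) (x + (w + w)) (V ^~ z)].
  by move=> hy hz; split; apply: sint_sub; apply: cont_seg_sub (cv _ _) => //; lra.
rewrite -!addrA.
have [-> _ _] := su _ _ X2 X0; have [_ -> _] := su _ _ X1 X0.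
have [_ -> ->] := su _ _ X2 X1; have [_ _ ->] := su _ _ X1 X0.
have [-> _ _] := sv _ _ T2 T0; have [_ -> _] := sv _ _ T1 T0.
have [_ -> ->] := sv _ _ T2 T1; have [_ _ ->] := sv _ _ T1 T0.
rewrite (sint_split et (cu _ X2)) (sint_split et (cu _ X0)).
rewrite (sint_split ex (cv _ T2)) (sint_split ex (cv _ T0)).
lra.
Qed.

(** The affine parts of U and V cancel: the shared coefficient a contributes a w h to both
    integrals, and the other terms drop out of the differences. What remains is at most 2 e on each
    pair of opposite sides. *)
Let circulation_small x t w h a b c e : subQ x t w h ->
  forall y s, x <= y <= x + w -> t <= s <= t + h -> 0 <= e ->
  (forall x' t', x <= x' <= x + w -> t <= t' <= t + h ->
    `|U x' t' - U y s - a * (x' - y) - b * (t' - s)| <= e /\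
    `|V x' t' - V y s - c * (x' - y) - a * (t' - s)| <= e) ->
  `|circulation x t w h| <= 2 * e * (w + h).
Proof.
case/and5P=> A B C D /andP[E F] y s hy hs e0 H.
have X0 : x <= x <= x + w by apply/andP; split; lra.
have X1 : x <= x + w <= x + w by apply/andP; split; lra.
have T0 : t <= t <= t + h by apply/andP; split; lra.
have T1 : t <= t + h <= t + h by apply/andP; split; lra.
have cu z : x <= z <= x + w -> cont_seg t (t + h) (U z).
  by move=> hz; apply: cU => //; lra.
have cv z : t <= z <= t + h -> cont_seg x (x + w) (V ^~ z).
  by move=> hz; apply: cV => //; lra.
have tt : t <= t + h by lra.
have xx : x <= x + w by lra.
have e1 : `|sint t (t + h) (fun s => U (x + w) s - U x s - a * w)| <= (2 * e) * (t + h - t).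
  apply: norm_sint_le => //.
    by apply: cont_seg_subr; [apply: cont_seg_subr; exact: cu|exact: cont_seg_cst].
  move=> r hr; have [+ _] := H _ _ X1 hr; have [+ _] := H _ _ X0 hr.
  rewrite !ler_norml => /andP[? ?] /andP[? ?]; apply/andP; split; lra.
have e2 : `|sint x (x + w) (fun s => V s (t + h) - V s t - a * h)| <= (2 * e) * (x + w - x).
  apply: norm_sint_le => //.
    by apply: cont_seg_subr; [apply: cont_seg_subr; exact: cv|exact: cont_seg_cst].
  move=> r hr; have [_ +] := H _ _ hr T1; have [_ +] := H _ _ hr T0.
  rewrite !ler_norml => /andP[? ?] /andP[? ?]; apply/andP; split; lra.
move: e1 e2; rewrite sint_sub; first last.
- exact: cont_seg_cst.
- by apply: cont_seg_subr; exact: cu.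
rewrite sint_cst // (@sint_sub _ _ _ (fun s => V s (t + h) - V s t)); first last.
- exact: cont_seg_cst.
- by apply: cont_seg_subr; exact: cv.
rewrite sint_cst // /circulation.
rewrite !ler_norml => /andP[? ?] /andP[? ?]; apply/andP; split; lra.
Qed.

Let quarter x t w h : subQ x t (w + w) (h + h) -> exists p : R * R,
  [/\ x <= p.1 <= x + w, t <= p.2 <= t + h &
   `|circulation x t (w + w) (h + h)| <= 4 * `|circulation p.1 p.2 w h|].
Proof.
move=> Q; have E := circulation_split Q; move: Q => /and5P[A B C D /andP[F G]].
have [X0 X1] : x <= x <= x + w /\ x <= x + w <= x + w.
  by split; apply/andP; split; lra.
have [T0 T1] : t <= t <= t + h /\ t <= t + h <= t + h.
  by split; apply/andP; split; lra.
apply: contrapT => /forallNP H.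
have H1 p : x <= p.1 <= x + w -> t <= p.2 <= t + h ->
    4 * `|circulation p.1 p.2 w h| < `|circulation x t (w + w) (h + h)|.
  by move=> h1 h2; rewrite ltNge; apply/negP => h3; apply: (H p).
have := H1 (x, t) X0 T0; have := H1 (x + w, t) X1 T0.
have := H1 (x, t + h) X0 T1; have := H1 (x + w, t + h) X1 T1 => /=.
have := ler_normD (circulation x t w h + circulation (x + w) t w h +
  circulation x (t + h) w h) (circulation (x + w) (t + h) w h).
have := ler_normD (circulation x t w h + circulation (x + w) t w h)
  (circulation x (t + h) w h).
have := ler_normD (circulation x t w h) (circulation (x + w) t w h).
rewrite E; lra.
Qed.

Let wn n := w0 / 2 ^+ n.
Let hn n := h0 / 2 ^+ n.

Let half (r : R) n : r / 2 ^+ n = r / 2 ^+ n.+1 + r / 2 ^+ n.+1.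
Proof.
have n0 : (2 : R) ^+ n != 0 by rewrite expf_neq0 // pnatr_eq0.
by rewrite exprS; field.
Qed.

Let pow_ge (r : R) n : 0 < r -> 0 < r / 2 ^+ n.
Proof. by move=> r0; rewrite divr_gt0 // exprn_gt0. Qed.

Let corners : exists p : nat -> R * R,
  [/\ p 0%N = (x0, t0),
     forall n, (p n).1 <= (p n.+1).1 /\ (p n.+1).1 + wn n.+1 <= (p n).1 + wn n,
     forall n, (p n).2 <= (p n.+1).2 /\ (p n.+1).2 + hn n.+1 <= (p n).2 + hn n &
     forall n, `|circulation x0 t0 w0 h0| <= 4 ^+ n * `|circulation (p n).1 (p n).2 (wn n) (hn n)|].
Proof.
(* The condition [subQ] stands under the existential, so that the step is total and [choice]
   applies; it is recovered for the constructed sequence in [S]. *)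
have step (n : nat) (q : R * R) : exists q' : R * R, subQ q.1 q.2 (wn n) (hn n) ->
   [/\ q.1 <= q'.1 <= q.1 + wn n.+1, q.2 <= q'.2 <= q.2 + hn n.+1 &
    `|circulation q.1 q.2 (wn n) (hn n)| <= 4 * `|circulation q'.1 q'.2 (wn n.+1) (hn n.+1)|].
  have [Q|nQ] := boolP (subQ q.1 q.2 (wn n) (hn n)); last by exists q.
  move: Q; rewrite /wn /hn (half w0) (half h0) => /quarter[q' H]; by exists q'.
have [g Hg] := choice (fun nq : nat * (R * R) => step nq.1 nq.2).
pose p := fix p n := if n is m.+1 then g (m, p m) else (x0, t0).
have S n : subQ (p n).1 (p n).2 (wn n) (hn n).
  elim: n => [|n IH].
    by rewrite /subQ /wn /hn /= expr0 !divr1 !lexx !ltW.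
  have [/andP[a b] /andP[c d] _] := Hg (n, p n) IH.
  rewrite -/(p n.+1) /= in a b c d; move: IH => /and5P[A B C D /andP[E F]].
  have := half w0 n; have := half h0 n; have := pow_ge n.+1 w0_gt0.
  have := pow_ge n.+1 h0_gt0; rewrite -/(wn n) -/(hn n) -/(wn n.+1) -/(hn n.+1) => *.
  rewrite /subQ /=; apply/and5P; split; try lra; apply/andP; split; lra.
exists p; split=> // n.
- have [/andP[a b] _ _] := Hg (n, p n) (S n); rewrite /= in a b *.
  have := half w0 n; rewrite -/(wn n) -/(wn n.+1); lra.
- have [_ /andP[a b] _] := Hg (n, p n) (S n); rewrite /= in a b *.
  have := half h0 n; rewrite -/(hn n) -/(hn n.+1); lra.
- elim: n => [|n IH]; first by rewrite /= /wn /hn expr0 !divr1 mul1r.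
  have [_ _ /= c] := Hg (n, p n) (S n); apply: le_trans IH _.
  by rewrite exprSr -mulrA ler_pM2l ?exprn_gt0.
Qed.

Let nested (a : nat -> R) (w : R) : 0 < w ->
  (forall n, a n <= a n.+1 /\ a n.+1 + w / 2 ^+ n.+1 <= a n + w / 2 ^+ n) ->
  exists c, forall n, a n <= c <= a n + w / 2 ^+ n.
Proof.
move=> w_gt0 H.
have up m n : (m <= n)%N -> a m <= a n.
  move=> /subnK <-; elim: (n - m)%N => [//|k IH]; rewrite addSn.
  by apply: le_trans IH _; have [] := H (k + m)%N.
have dn m n : (m <= n)%N -> a n + w / 2 ^+ n <= a m + w / 2 ^+ m.
  move=> /subnK <-; elim: (n - m)%N => [//|k IH]; rewrite addSn.
  by apply: le_trans _ IH; have [] := H (k + m)%N.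
have ub n m : a m <= a n + w / 2 ^+ n.
  have [mn|nm] := leP m n.
    by apply: le_trans (up _ _ mn) _; rewrite lerDl ltW // pow_ge.
  by apply: le_trans (dn _ _ (ltnW nm)); rewrite lerDl ltW // pow_ge.
exists (sup (range a)) => n; apply/andP; split.
- apply: ub_le_sup; last by exists n.
  by exists (a 0%N + w / 2 ^+ 0) => _ [m _ <-].
- apply: sup_le_ub; first by exists (a 0%N), 0%N.
  by move=> _ [m _ <-].
Qed.

(* Goursat's bisection: only differentiability, not C^1, is required. *)
Lemma circulation_eq0 : circulation x0 t0 w0 h0 = 0.
Proof.
apply/eqP/negP => /negP J0; have {}J0 : 0 < `|circulation x0 t0 w0 h0| by rewrite normr_gt0.
have [p [p0 p1 p2 pJ]] := corners.
have [cx Hx] := nested w0_gt0 p1; have [ct Ht] := nested h0_gt0 p2.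
have Qc : inQ cx ct.
  have := Hx 0%N; have := Ht 0%N; rewrite p0 /= expr0 !divr1 /inQ => -> ->; by [].
have inP n x t : (p n).1 <= x <= (p n).1 + wn n -> (p n).2 <= t <= (p n).2 + hn n -> inQ x t.
  elim: n x t => [|n IH] x t; first by rewrite p0 /= /wn /hn expr0 !divr1 /inQ => -> ->.
  have [q1 q2] := p1 n; have [q3 q4] := p2 n.
  by move=> /andP[? ?] /andP[? ?]; apply: IH; apply/andP; split; lra.
have [a [b [c Hd]]] := diffUV Qc.
set J := `|circulation x0 t0 w0 h0| in J0 pJ.
(* With this value, 4^n times the bound 2 e (wn + hn)^2 is J / 2, below the lower bound J given by
   [pJ]. *)
pose e := J / (4 * (w0 + h0) ^+ 2).
have wh0 : 0 < (w0 + h0) ^+ 2 by rewrite exprn_gt0 // addr_gt0.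
have e0 : 0 < e by rewrite divr_gt0 // mulr_gt0.
have [d d0 {}Hd] := Hd e e0.
have [n Hn] : exists n, (w0 + h0) / 2 ^+ n < d.
  have hh := @cvg_geometric R (w0 + h0) (1/2).
  have lt1 : `|1 / 2 : R| < 1 by rewrite ger0_norm; lra.
  move: (hh lt1) => /cvgrPdist_lt /(_ d d0)[N _ HN]; exists N.
  have := HN N (leqnn N); rewrite /= /geometric /= sub0r normrN ger0_norm.
    by rewrite expr_div_n expr1n mulrA mulr1.
  by rewrite mulr_ge0 ?exprn_ge0 ?divr_ge0 // addr_ge0 // ltW.
have w_gt := pow_ge n w0_gt0; have h_gt := pow_ge n h0_gt0.
have E2 : (w0 + h0) / 2 ^+ n = wn n + hn n by rewrite mulrDl.
have [hx1 ht1] := (Hx n, Ht n); rewrite -/(wn n) in w_gt hx1; rewrite -/(hn n) in h_gt ht1.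
have sQ : subQ (p n).1 (p n).2 (wn n) (hn n).
  have xx : (p n).1 <= (p n).1 <= (p n).1 + wn n by apply/andP; split; lra.
  have xx1 : (p n).1 <= (p n).1 + wn n <= (p n).1 + wn n by apply/andP; split; lra.
  have tt : (p n).2 <= (p n).2 <= (p n).2 + hn n by apply/andP; split; lra.
  have tt1 : (p n).2 <= (p n).2 + hn n <= (p n).2 + hn n by apply/andP; split; lra.
  have /andP[/andP[? ?] /andP[? ?]] := inP _ _ _ xx tt.
  have /andP[/andP[? ?] /andP[? ?]] := inP _ _ _ xx1 tt1.
  by apply/and5P; split; try lra; apply/andP; split; lra.
have ee : 0 <= e * (wn n + hn n) by rewrite mulr_ge0 //; lra.
have : ~~ (`|circulation (p n).1 (p n).2 (wn n) (hn n)| <=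
    2 * (e * (wn n + hn n)) * (wn n + hn n)).
  rewrite -ltNge.
  have H4 : (4 : R) ^+ n = 2 ^+ n * 2 ^+ n by rewrite -exprMn; congr (_ ^+ _); lra.
  have n0 : (2 : R) ^+ n != 0 by rewrite expf_neq0 // pnatr_eq0.
  have p4 : 0 < (4 : R) ^+ n by rewrite exprn_gt0.
  rewrite -(ltr_pM2l p4); apply: lt_le_trans (pJ n).
  rewrite -E2.
  have -> : 4 ^+ n * (2 * (e * ((w0 + h0) / 2 ^+ n)) * ((w0 + h0) / 2 ^+ n)) = J / 2.
    by rewrite /e H4; field; rewrite n0 /= gt_eqF // addr_gt0.
  lra.
move/negP; apply; apply: (@circulation_small _ _ _ _ a b c _ sQ cx ct hx1 ht1 ee).
move=> x' t' hx' ht'.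
  have [||A B] := Hd x' t' (inP _ _ _ hx' ht').
  - by move: hx1 hx' => /andP[? ?] /andP[? ?]; rewrite ltr_norml; apply/andP; split; lra.
  - by move: ht1 ht' => /andP[? ?] /andP[? ?]; rewrite ltr_norml; apply/andP; split; lra.
  have L : e * (`|x' - cx| + `|t' - ct|) <= e * (wn n + hn n).
    rewrite ler_pM2l //; apply: lerD.
      by move: hx1 hx' => /andP[? ?] /andP[? ?]; rewrite ler_norml; apply/andP; split; lra.
    by move: ht1 ht' => /andP[? ?] /andP[? ?]; rewrite ler_norml; apply/andP; split; lra.
  by split; [exact: le_trans A L|exact: le_trans B L].
Qed.

End Rectangle.

(** * Complex differentiability *)

Section ComplexBasics.
Variable R : realType.
Implicit Types (z w : R[i]) (r t : R).

Lemma cmodE z : (cmod z)%:C%C = `|z|.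
Proof. by case: z. Qed.

Lemma cmodM z w : cmod (z * w) = cmod z * cmod w.
Proof. exact: ComplexField.Normc.normcM. Qed.

Lemma cmodV z : cmod z^-1 = (cmod z)^-1.
Proof. exact: ComplexField.Normc.normcV. Qed.

Lemma cmod0 : cmod (0 : R[i]) = 0.
Proof. exact: ComplexField.Normc.normc0. Qed.

Lemma cmod1 : cmod (1 : R[i]) = 1.
Proof. exact: ComplexField.Normc.normc1. Qed.

Lemma cmod_ge0 z : 0 <= cmod z.
Proof. by case: z => a b; rewrite sqrtr_ge0. Qed.

Lemma cmod_eq0 z : (cmod z == 0) = (z == 0).
Proof.
apply/eqP/eqP => [|->]; [exact: ComplexField.Normc.eq0_normc|exact: cmod0].
Qed.

Lemma cmod_gt0 z : (0 < cmod z) = (z != 0).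
Proof. by rewrite lt_def cmod_ge0 andbT cmod_eq0. Qed.

Lemma cmodD z w : cmod (z + w) <= cmod z + cmod w.
Proof. by rewrite -lecR rmorphD !cmodE; exact: ler_normD. Qed.

Lemma cmodN z : cmod (- z) = cmod z.
Proof. by apply: complexI; rewrite !cmodE normrN. Qed.

Lemma cmodBC z w : cmod (z - w) = cmod (w - z).
Proof. by rewrite -cmodN opprB. Qed.

Lemma cmodB z w : cmod (z - w) <= cmod z + cmod w.
Proof. by rewrite -(cmodN w); exact: cmodD. Qed.

Lemma cmod_lerB z w : cmod z - cmod w <= cmod (z - w).
Proof. by rewrite lerBlDr -{1}(subrK w z); exact: cmodD. Qed.

Lemma cmodr r : cmod (r%:C)%C = `|r|.
Proof. by rewrite /cmod /= expr0n /= addr0 sqrtr_sqr. Qed.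

Lemma sqr_cmod z : cmod z ^+ 2 = complex.Re z ^+ 2 + complex.Im z ^+ 2.
Proof. by case: z => a b; rewrite /cmod /= sqr_sqrtr // addr_ge0 ?sqr_ge0. Qed.

Lemma Re_le_cmod z : `|complex.Re z| <= cmod z.
Proof.
by rewrite -ler_sqr ?nnegrE ?cmod_ge0 // sqr_cmod real_normK ?num_real // lerDl sqr_ge0.
Qed.

Lemma Im_le_cmod z : `|complex.Im z| <= cmod z.
Proof.
by rewrite -ler_sqr ?nnegrE ?cmod_ge0 // sqr_cmod real_normK ?num_real // lerDr sqr_ge0.
Qed.

Lemma cmod_le z : cmod z <= `|complex.Re z| + `|complex.Im z|.
Proof.
rewrite -ler_sqr ?nnegrE ?cmod_ge0 ?addr_ge0 // sqr_cmod sqrrD !real_normK ?num_real //.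
by rewrite addrAC lerDl mulrn_wge0 // mulr_ge0.
Qed.

Lemma cReD z w : complex.Re (z + w) = complex.Re z + complex.Re w.
Proof. by case: z => ? ?; case: w. Qed.
Lemma cImD z w : complex.Im (z + w) = complex.Im z + complex.Im w.
Proof. by case: z => ? ?; case: w. Qed.
Lemma cReN z : complex.Re (- z) = - complex.Re z.
Proof. by case: z. Qed.
Lemma cImN z : complex.Im (- z) = - complex.Im z.
Proof. by case: z. Qed.
Lemma cReM z w : complex.Re (z * w) = complex.Re z * complex.Re w - complex.Im z * complex.Im w.
Proof. by case: z => ? ?; case: w. Qed.
Lemma cImM z w : complex.Im (z * w) = complex.Re z * complex.Im w + complex.Im z * complex.Re w.
Proof. by case: z => ? ?; case: w. Qed.

Lemma cRe1 : complex.Re (1 : R[i]) = 1. Proof. by []. Qed.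
Lemma cIm1 : complex.Im (1 : R[i]) = 0. Proof. by []. Qed.
Lemma cRer r : complex.Re (r%:C)%C = r. Proof. by []. Qed.
Lemma cImr r : complex.Im (r%:C)%C = 0. Proof. by []. Qed.
Lemma cRe_expi t : complex.Re (expi t) = cos t. Proof. by []. Qed.
Lemma cIm_expi t : complex.Im (expi t) = sin t. Proof. by []. Qed.
Lemma cRe_conj z : complex.Re (conjc z) = complex.Re z. Proof. by case: z. Qed.
Lemma cIm_conj z : complex.Im (conjc z) = - complex.Im z. Proof. by case: z. Qed.
Definition cE := (cReD, cImD, cReN, cImN, cReM, cImM, cRe1, cIm1, cRer, cImr,
  cRe_expi, cIm_expi, cRe_conj, cIm_conj).

Lemma complex_ext z w : complex.Re z = complex.Re w -> complex.Im z = complex.Im w -> z = w.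
Proof. by case: z => ? ?; case: w => ? ? /= -> ->. Qed.

Lemma cmod_expi t : cmod (expi t) = 1.
Proof. by rewrite /cmod /= cos2Dsin2 sqrtr1. Qed.

Lemma expiD s t : expi (s + t) = expi s * expi t.
Proof. by apply: complex_ext; rewrite ?cReM ?cImM /= ?cosD ?sinD // addrC. Qed.

Lemma expi_2pi t : expi (t + 2 * pi) = expi t.
Proof.
have e : (2 * pi : R) = pi *+ 2 by rewrite mulr_natl.
by rewrite /expi e -[_ *+ 2]addr0 -mulr_natl; rewrite addr0 mulr_natl cosD2pi sinD2pi.
Qed.

Lemma mul_conj z : z * conjc z = ((cmod z ^+ 2)%:C)%C.
Proof. by apply: complex_ext; rewrite ?cReM ?cImM sqr_cmod; case: z => a b /=; ring. Qed.

Lemma cmod_conj z : cmod (conjc z) = cmod z.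
Proof. by case: z => a b; rewrite /cmod /= sqrrN. Qed.

End ComplexBasics.

Section ComplexDiff.
Variable R : realType.
Implicit Types (z w l : R[i]) (e d : R) (f g : R[i] -> R[i]).

(** The increment w ranges over a full neighbourhood of z. On the unit circle this includes points
    outside the disc, so that [cdiff] on the closed disc expresses analyticity up to and across the
    boundary, as dilations of disc functions have it. *)
Definition cdiff g z := exists l, forall e, 0 < e -> exists2 d, 0 < d &
  forall w, cmod (w - z) < d -> cmod (g w - g z - l * (w - z)) <= e * cmod (w - z).

Definition ccont g z := forall e, 0 < e -> exists2 d, 0 < d &
  forall w, cmod (w - z) < d -> cmod (g w - g z) < e.

Lemma cdiff_lip g z : cdiff g z -> exists2 M, 0 < M & exists2 d, 0 < d &
  forall w, cmod (w - z) < d -> cmod (g w - g z) <= M * cmod (w - z).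
Proof.
move=> [l H]; have [d d0 Hd] := H 1 ltr01.
exists (1 + cmod l); first by have := cmod_ge0 l; lra.
exists d => // w /Hd Hw; rewrite -(subrK (l * (w - z)) (g w - g z)).
by apply: le_trans (cmodD _ _) _; rewrite cmodM mulrDl lerD.
Qed.

Lemma cdiff_cont g z : cdiff g z -> ccont g z.
Proof.
move=> /cdiff_lip[M M0 [d d0 H]] e e0.
exists (Num.min d (e / M)); first by rewrite lt_min d0 divr_gt0.
move=> w; rewrite lt_min => /andP[/H h1 h2]; apply: le_lt_trans h1 _.
by rewrite mulrC -ltr_pdivlMr.
Qed.

Lemma cdiff_cst c z : cdiff (fun=> c) z.
Proof.
exists 0 => e e0; exists 1 => // w _; rewrite subrr mul0r subr0 cmod0.
by rewrite mulr_ge0 ?cmod_ge0 // ltW.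
Qed.

Lemma cdiff_id z : cdiff id z.
Proof.
exists 1 => e e0; exists 1 => // w _; rewrite mul1r subrr cmod0.
by rewrite mulr_ge0 ?cmod_ge0 // ltW.
Qed.

Lemma cdiff_add f g z : cdiff f z -> cdiff g z -> cdiff (fun w => f w + g w) z.
Proof.
move=> [l Hl] [m Hm]; exists (l + m) => e e0.
have e2 : 0 < e / 2 by lra.
have [d d0 Hd] := Hl _ e2; have [d' d'0 Hd'] := Hm _ e2.
exists (Num.min d d'); first by rewrite lt_min d0.
move=> w; rewrite lt_min => /andP[/Hd h1 /Hd' h2].
have -> : f w + g w - (f z + g z) - (l + m) * (w - z) =
  (f w - f z - l * (w - z)) + (g w - g z - m * (w - z)) by ring.
by apply: le_trans (cmodD _ _) _; lra.
Qed.

Lemma cdiff_mul f g z : cdiff f z -> cdiff g z -> cdiff (fun w => f w * g w) z.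
Proof.
move=> df dg; have [M M0 [d1 d10 H1]] := cdiff_lip dg.
case: df => l Hl; case: (dg) => m Hm.
exists (l * g z + f z * m) => e e0.
(* [K] adds up the coefficients of e' in the three error terms below, with |g w| bounded by |g z| +
   1. *)
pose K := cmod (g z) + 1 + cmod l + cmod (f z).
have K0 : 0 < K by rewrite /K; have := cmod_ge0 (g z); have := cmod_ge0 l;
  have := cmod_ge0 (f z); lra.
pose e' := e / K; have e'0 : 0 < e' by rewrite divr_gt0.
have [d2 d20 H2] := Hl _ e'0; have [d3 d30 H3] := Hm _ e'0.
have [d4 d40 H4] := cdiff_cont dg e'0; have [d5 d50 H5] := cdiff_cont dg ltr01.
exists (Num.min (Num.min d2 d3) (Num.min d4 d5)); first by rewrite !lt_min d20 d30 d40.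
move=> w; rewrite !lt_min => /andP[/andP[/H2 h2 /H3 h3] /andP[/H4 h4 /H5 h5]].
have -> : f w * g w - f z * g z - (l * g z + f z * m) * (w - z) =
  (f w - f z - l * (w - z)) * g w + l * (w - z) * (g w - g z)
  + f z * (g w - g z - m * (w - z)) by ring.
have -> : e * cmod (w - z) = e' * cmod (w - z) * (cmod (g z) + 1) +
   cmod l * cmod (w - z) * e' + cmod (f z) * (e' * cmod (w - z)).
  by rewrite /e' /K; field; rewrite gt_eqF.
apply: le_trans (cmodD _ _) _; apply: lerD.
  apply: le_trans (cmodD _ _) _; apply: lerD; rewrite !cmodM.
    apply: ler_pM => //; rewrite ?cmod_ge0 //.
    by have := cmod_lerB (g w) (g z); lra.
  by apply: ler_pM; rewrite ?mulr_ge0 ?cmod_ge0 // ltW.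
by rewrite cmodM; apply: ler_pM; rewrite ?cmod_ge0.
Qed.

Lemma cdiff_comp f g z : cdiff g z -> cdiff f (g z) -> cdiff (fun w => f (g w)) z.
Proof.
move=> dg [k Hk]; have [M M0 [d1 d10 H1]] := cdiff_lip dg.
case: (dg) => m Hm.
exists (k * m) => e e0.
pose K := M + cmod k + 1.
have K0 : 0 < K by rewrite /K; have := cmod_ge0 k; lra.
pose e' := e / K; have e'0 : 0 < e' by rewrite divr_gt0.
have [d2 d20 H2] := Hk _ e'0; have [d3 d30 H3] := Hm _ e'0.
have [d4 d40 H4] := cdiff_cont dg d20.
exists (Num.min (Num.min d1 d3) d4); first by rewrite !lt_min d10 d30.
move=> w; rewrite !lt_min => /andP[/andP[/H1 h1 /H3 h3] /H4 /H2 h4].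
have -> : f (g w) - f (g z) - k * m * (w - z) =
  (f (g w) - f (g z) - k * (g w - g z)) + k * (g w - g z - m * (w - z)) by ring.
have E : e * cmod (w - z) = e' * (M * cmod (w - z)) + cmod k * (e' * cmod (w - z)) +
   e' * cmod (w - z).
  by rewrite /e' /K; field; rewrite gt_eqF.
apply: le_trans (cmodD _ _) _; rewrite E -[X in X <= _]addr0; apply: lerD; last first.
  by rewrite mulr_ge0 ?cmod_ge0 // ltW.
apply: lerD.
  by apply: le_trans h4 _; rewrite ler_pM2l.
by rewrite cmodM; apply: ler_pM; rewrite ?cmod_ge0.
Qed.

Lemma cdiff_inv z : z != 0 -> cdiff (fun w => w^-1) z.
Proof.
move=> z0; have cz : 0 < cmod z by rewrite cmod_gt0.
exists (- (z ^- 2)) => e e0.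
exists (Num.min (cmod z / 2) (e * cmod z ^+ 3 / 2)).
  by rewrite lt_min !divr_gt0 // mulr_gt0 // exprn_gt0.
move=> w; rewrite lt_min => /andP[h1 h2].
have cw : cmod z / 2 <= cmod w by have := cmod_lerB z (z - w); rewrite subKr cmodBC; lra.
have w0 : w != 0 by rewrite -cmod_gt0; lra.
have -> : w^-1 - z^-1 - - z ^- 2 * (w - z) = (w - z) * (w - z) / (w * (z * z)).
  by field; rewrite w0 z0.
rewrite !cmodM cmodV !cmodM -mulrA mulrC; apply: ler_pM; rewrite ?cmod_ge0 //.
  by rewrite mulr_ge0 ?invr_ge0 ?mulr_ge0 ?cmod_ge0.
have cw0 : 0 < cmod w by lra.
rewrite ler_pdivrMr ?mulr_gt0 //; apply: le_trans (ltW h2) _.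
have -> : e * cmod z ^+ 3 / 2 = e * ((cmod z / 2) * (cmod z * cmod z)).
  by rewrite !exprS expr0; field.
by rewrite ler_pM2l // ler_pM2r ?mulr_gt0.
Qed.

Lemma cdiff_div f g z : cdiff f z -> cdiff g z -> g z != 0 ->
  cdiff (fun w => f w / g w) z.
Proof.
move=> df dg gz; apply: cdiff_mul => //.
by apply: (cdiff_comp dg); exact: cdiff_inv.
Qed.

Lemma cdiff_prod n (F : nat -> R[i] -> R[i]) z : (forall k, cdiff (F k) z) ->
  cdiff (fun w => \prod_(k < n) F k w) z.
Proof.
move=> H; elim: n => [|n IH].
  have -> : (fun w => \prod_(k < 0) F k w) = fun=> 1.
    by apply/funext => w; rewrite big_ord0.
  exact: cdiff_cst.
have -> : (fun w => \prod_(k < n.+1) F k w) = fun w => \prod_(k < n) F k w * F n w.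
  by apply/funext => w; rewrite big_ord_recr.
exact: cdiff_mul.
Qed.

Lemma analytic_cdiff f z : analytic_disc f -> cmod z < 1 -> cdiff f z.
Proof.
move=> fa z1; have [l Hl] := fa z z1; exists l => e e0.
have [d d0 Hd] := Hl e e0.
exists (Num.min d (1 - cmod z)); first by rewrite lt_min d0 /=; lra.
move=> w; rewrite lt_min => /andP[h1 h2].
have [->|wz] := eqVneq w z; first by rewrite !subrr mulr0 subrr cmod0 mulr0.
have wz0 : w - z != 0 by rewrite subr_eq0.
have cw : 0 < cmod (w - z) by rewrite cmod_gt0.
have w1 : cmod w < 1 by have := cmod_lerB w (w - z); rewrite subKr; have := cmodD (w - z) z; rewrite subrK; lra.
have := Hd w w1; rewrite cw h1 => /(_ isT) H.
have -> : f w - f z - l * (w - z) = ((f w - f z) / (w - z) - l) * (w - z) by field.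
by rewrite cmodM ler_pM2r // ltW.
Qed.

End ComplexDiff.

(** * The complex exponential *)

Section ComplexExponential.
Variable R : realType.
Implicit Types (z w l : R[i]) (e d r t x : R) (g : R[i] -> R[i]).

Lemma is_derive_approx (f : R -> R) (x df : R) : is_derive x 1 f df ->
  forall e, 0 < e -> exists2 d, 0 < d & forall h : R, `|h| < d ->
    `|f (x + h) - f x - df * h| <= e * `|h|.
Proof.
move=> fd e e0; have dfx : derivable f x 1 by [].
have vf : 'D_1 f x = df by apply: derive_val.
move: dfx; rewrite /derivable => /cvg_ex[l Hl].
have ll : l = df by rewrite -vf /derive; exact/esym/cvg_lim.
move: Hl; rewrite ll => /cvgrPdist_le /(_ e e0).
rewrite /dnbhs => -[d /= d0 Hd]; exists d => // h hd.
have [->|h0] := eqVneq h 0; first by rewrite addr0 subrr mulr0 subrr normr0 mulr0.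
have := Hd h; rewrite /= sub0r normrN => /(_ hd h0).
have -> : f (x + h) - f x - df * h = - ((df - h^-1 *: (f (h *: 1 + x) - f x)) * h).
  by rewrite /GRing.scale /= mulr1 (addrC h) mulrBl mulrAC mulVf // mul1r; ring.
by rewrite normrN normrM => H; rewrite ler_wpM2r.
Qed.

Definition cexp z : R[i] := (expR (complex.Re z))%:C%C * expi (complex.Im z).

Lemma cexpD z w : cexp (z + w) = cexp z * cexp w.
Proof. by rewrite /cexp cReD cImD expRD expiD rmorphM /= -!mulrA; congr (_ * _); rewrite mulrCA. Qed.

Lemma cmod_cexp z : cmod (cexp z) = expR (complex.Re z).
Proof. by rewrite /cexp cmodM cmodr cmod_expi mulr1 ger0_norm ?expR_ge0. Qed.

(** The functional equation moves the question to 0, where the first-order expansions of [expR],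
    [cos] and [sin] bound the real part of the error by 3 e' |dw| and the imaginary part by 4 e'
    |dw|. Their sum is the 7 in the choice of e'. *)
Lemma cdiff_cexp z : cdiff cexp z.
Proof.
exists (cexp z) => e e0.
pose M := expR (complex.Re z); have M0 : 0 < M by exact: expR_gt0.
pose e' := Num.min 1 (e / (7 * M)).
have e'0 : 0 < e' by rewrite lt_min ltr01 divr_gt0 // mulr_gt0.
have e'1 : e' <= 1 by rewrite ge_min lexx.
have e'2 : e' * (7 * M) <= e by rewrite -ler_pdivlMr ?mulr_gt0 // ge_min lexx orbT.
clearbody e'.
have [d1 d10 H1] := is_derive_approx (is_derive_expR 0) e'0.
have [d2 d20 H2] := is_derive_approx (is_derive_cos 0) e'0.
have [d3 d30 H3] := is_derive_approx (is_derive_sin 0) e'0.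
exists (Num.min (Num.min d1 d2) (Num.min d3 e')); first by rewrite !lt_min d10 d20 d30 e'0.
move=> w; set dw := w - z; rewrite !lt_min => /andP[/andP[h1 h2] /andP[h3 h4]].
have -> : cexp w - cexp z - cexp z * dw = cexp z * (cexp dw - 1 - dw).
  have {1}-> : w = z + dw by rewrite /dw addrC subrK.
  by rewrite cexpD; ring.
clearbody dw.
have rx := Re_le_cmod dw; have ry := Im_le_cmod dw.
set X := complex.Re dw in rx *; set Y := complex.Im dw in ry *.
have := H1 X (le_lt_trans rx h1); rewrite add0r expR0 mul1r => k1.
have := H2 Y (le_lt_trans ry h2); rewrite add0r cos0 sin0 oppr0 mul0r subr0 => k2.
have := H3 Y (le_lt_trans ry h3); rewrite add0r sin0 cos0 mul1r subr0 => k3.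
rewrite cmodM cmod_cexp -/M.
set c := cmod dw in rx ry h1 h2 h3 h4 *.
have c0 : 0 <= c by exact: cmod_ge0.
have e'X : e' * `|X| <= e' * c by rewrite ler_pM2l.
have e'Y : e' * `|Y| <= e' * c by rewrite ler_pM2l.
have cosle : `|cos Y| <= 1 by rewrite ler_norml cos_geN1 cos_le1.
have sinle : `|sin Y| <= 1 by rewrite ler_norml sin_geN1 sin_le1.
have A : `|complex.Re (cexp dw - 1 - dw)| <= 3 * e' * c.
  have -> : complex.Re (cexp dw - 1 - dw) =
    (expR X - 1 - X) * cos Y + (X * (cos Y - 1) + (cos Y - 1)).
    by rewrite /cexp !cE -/X -/Y; ring.
  have t1 : `|(expR X - 1 - X) * cos Y| <= e' * c.
    by rewrite normrM -[leRHS]mulr1; apply: ler_pM => //; exact: le_trans k1 e'X.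
  have t2 : `|X * (cos Y - 1)| <= e' * c.
    rewrite normrM mulrC; apply: ler_pM => //.
    by apply: le_trans k2 _; apply: le_trans e'Y _; rewrite ler_piMr //; lra.
  have := ler_normD ((expR X - 1 - X) * cos Y) (X * (cos Y - 1) + (cos Y - 1)).
  have := ler_normD (X * (cos Y - 1)) (cos Y - 1); lra.
have B : `|complex.Im (cexp dw - 1 - dw)| <= 4 * e' * c.
  have -> : complex.Im (cexp dw - 1 - dw) =
    (expR X - 1 - X) * sin Y + (X * sin Y + (sin Y - Y)).
    by rewrite /cexp !cE -/X -/Y; ring.
  have t1 : `|(expR X - 1 - X) * sin Y| <= e' * c.
    by rewrite normrM -[leRHS]mulr1; apply: ler_pM => //; exact: le_trans k1 e'X.
  have sY : `|sin Y| <= 2 * c.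
    have := ler_normD (sin Y - Y) Y; rewrite subrK.
    have : e' * c <= c by rewrite ler_piMl.
    by lra.
  have t2 : `|X * sin Y| <= 2 * (e' * c).
    have -> : 2 * (e' * c) = e' * (2 * c) by ring.
    by rewrite normrM; apply: ler_pM => //; lra.
  have := ler_normD ((expR X - 1 - X) * sin Y) (X * sin Y + (sin Y - Y)).
  have := ler_normD (X * sin Y) (sin Y - Y).
  lra.
have := cmod_le (cexp dw - 1 - dw).
have N0 := cmod_ge0 (cexp dw - 1 - dw).
move=> L.
have {}L : cmod (cexp dw - 1 - dw) <= 7 * (e' * c) by lra.
apply: le_trans (_ : M * (7 * (e' * c)) <= _); first by rewrite ler_pM2l.
have -> : M * (7 * (e' * c)) = e' * (7 * M) * c by ring.
by rewrite ler_wpM2r.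
Qed.
End ComplexExponential.

(** * Mean values and subharmonicity *)

Section MeanValue.
Variable R : realType.
Implicit Types (z w l : R[i]) (e d r t x : R) (g : R[i] -> R[i]).

Lemma continuous_eps (u : R -> R) t :
  (forall e, 0 < e -> exists2 d, 0 < d & forall s, `|s - t| < d -> `|u s - u t| < e) ->
  {for t, continuous u}.
Proof.
move=> H; apply/cvgrPdist_lt => e e0; have [d d0 Hd] := H e e0.
exists d => // s /= hs; rewrite distrC; apply: Hd; by rewrite distrC.
Qed.

Lemma cmod_line_le x t x' t' :
  cmod ((x' +i* t')%C - (x +i* t)%C) <= `|x' - x| + `|t' - t|.
Proof. exact: cmod_le. Qed.

Lemma ccont_line_vert (F : R[i] -> R[i]) x t : ccont F (x +i* t)%C ->
  {for t, continuous (fun s => complex.Re (F (x +i* s)%C))} /\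
  {for x, continuous (fun y => complex.Im (F (y +i* t)%C))}.
Proof.
move=> H; split; apply: continuous_eps => e e0; have [d d0 Hd] := H e e0;
  exists d => // s hs.
- rewrite -cReN -cReD; apply: le_lt_trans (Re_le_cmod _) _; apply: Hd.
  by apply: le_lt_trans (cmod_line_le _ _ _ _) _; rewrite subrr normr0 add0r.
- rewrite -cImN -cImD; apply: le_lt_trans (Im_le_cmod _) _; apply: Hd.
  by apply: le_lt_trans (cmod_line_le _ _ _ _) _; rewrite subrr normr0 addr0.
Qed.

Lemma cexp_line0 t : cexp (0 +i* t)%C = expi t.
Proof. by rewrite /cexp /= expR0 mul1r. Qed.

Lemma expi_continuous t e : 0 < e ->
  exists2 d, 0 < d & forall s, `|s - t| < d -> cmod (expi s - expi t) < e.
Proof.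
move=> e0; have [d d0 Hd] := cdiff_cont (cdiff_cexp (0 +i* t)%C) e0.
exists d => // s hs; rewrite -!cexp_line0; apply: Hd.
by apply: le_lt_trans (cmod_line_le _ _ _ _) _; rewrite subrr normr0 add0r.
Qed.

Definition rcont (h : R[i] -> R) z := forall e, 0 < e -> exists2 d, 0 < d &
  forall w, cmod (w - z) < d -> `|h w - h z| < e.

Lemma rcont_circle (h : R[i] -> R) c t : rcont h (c * expi t) ->
  {for t, continuous (fun s => h (c * expi s))}.
Proof.
move=> H; apply: continuous_eps => e e0; have [d d0 Hd] := H e e0.
have c1 : 0 < cmod c + 1 by have := cmod_ge0 c; lra.
have [d' d'0 Hd'] := expi_continuous t (divr_gt0 d0 c1).
exists d' => // s /Hd'; rewrite ltr_pdivlMr // => hs; apply: Hd.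
rewrite -mulrBr cmodM; apply: le_lt_trans hs.
by rewrite mulrC ler_wpM2l ?cmod_ge0 //; lra.
Qed.

Lemma ccont_Re F z : ccont F z -> rcont (fun w => complex.Re (F w)) z.
Proof.
move=> H e /H[d d0 Hd]; exists d => // w /Hd; apply: le_lt_trans.
by rewrite -cReN -cReD Re_le_cmod.
Qed.

Lemma ccont_cmod F z : ccont F z -> rcont (fun w => cmod (F w)) z.
Proof.
move=> H e /H[d d0 Hd]; exists d => // w /Hd; apply: le_lt_trans.
rewrite ler_norml cmod_lerB andbT lerNl opprB cmodBC; exact: cmod_lerB.
Qed.

Lemma cexp_line_2pi x : cexp (x +i* (0 + 2 * pi))%C = cexp (x +i* 0)%C.
Proof. by rewrite /cexp /= expi_2pi. Qed.

Lemma pi2_gt0 : 0 < 2 * pi :> R.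
Proof. by rewrite mulr_gt0 // pi_gt0. Qed.

(* In the coordinate w = log z the circle means become integrals over vertical sides of a
   rectangle whose horizontal sides cancel by periodicity. *)
Lemma mean_value g : (forall z, cmod z <= 1 -> cdiff g z) ->
  sint 0 (2 * pi) (fun t => complex.Re (g (expi t))) = 2 * pi * complex.Re (g 0).
Proof.
move=> dg; pose F w := g (cexp w).
have dF w : complex.Re w <= 0 -> cdiff F w.
  move=> w0; apply: (cdiff_comp (cdiff_cexp w)); apply: dg.
  by rewrite cmod_cexp -expR0 ler_expR.
pose U x t := complex.Re (F (x +i* t)%C); pose V x t := complex.Im (F (x +i* t)%C).
have cont x t : x <= 0 -> {for t, continuous (U x)} /\ {for x, continuous (V ^~ t)}.
  by move=> x0; apply: ccont_line_vert; apply/cdiff_cont/dF.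
have shift N : 0 < N -> sint 0 (2 * pi) (U 0) = sint 0 (2 * pi) (U (- N)).
  move=> N0.
  have : circulation U V (- N) 0 N (2 * pi) = 0.
    apply: (circulation_eq0 N0 pi2_gt0); rewrite addNr !add0r.
    - by move=> x t /andP[/andP[_ h] _]; have [] := cont x t h.
    - by move=> x t /andP[/andP[_ h] _]; have [] := cont x t h.
    - move=> x t /andP[/andP[_ h] _].
      have [L HL] := dF (x +i* t)%C h.
      (* The Cauchy-Riemann equations: dU/dx = dV/dt = Re L, dU/dt = - Im L and dV/dx = Im L. *)
      exists (complex.Re L), (- complex.Im L), (complex.Im L) => e e0.
      have [d d0 Hd] := HL e e0; exists (d / 2); first by rewrite divr_gt0.
      move=> x' t' _ hx ht.
      have dist := cmod_line_le x t x' t'.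
      have /Hd B : cmod ((x' +i* t')%C - (x +i* t)%C) < d.
        by apply: le_lt_trans dist _; lra.
      have {}B : cmod (F (x' +i* t')%C - F (x +i* t)%C - L * ((x' +i* t')%C - (x +i* t)%C))
        <= e * (`|x' - x| + `|t' - t|).
        by apply: le_trans B _; rewrite ler_pM2l.
      have := le_trans (Re_le_cmod _) B; have := le_trans (Im_le_cmod _) B.
      rewrite !cE /= -/(V x' t') -/(V x t) -/(U x' t') -/(U x t) => B1 B2.
      split; [apply: le_trans B2|apply: le_trans B1]; rewrite le_eqVlt; apply/orP; left;
        apply/eqP; congr `|_|; ring.
  rewrite /circulation addNr !add0r => /eqP; rewrite subr_eq0 => /eqP E.
  have : sint (- N) 0 (fun y => V y (2 * pi) - V y 0) = 0.
    rewrite (@eq_sint _ _ _ _ (fun=> 0)) ?sint_cst ?mul0r //; first by rewrite oppr_le0 ltW.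
    by move=> x _; rewrite /V /F -[2 * pi]add0r cexp_line_2pi subrr.
  rewrite -E sint_sub; first by move/eqP; rewrite subr_eq0 => /eqP.
  - by move=> t _; have [] := cont 0 t (lexx 0).
  - by move=> t _; have [] := cont (- N) t; first by rewrite oppr_le0 ltW.
have -> : sint 0 (2 * pi) (fun t => complex.Re (g (expi t))) = sint 0 (2 * pi) (U 0).
  by apply: eq_sint => t _; rewrite /U /F cexp_line0.
apply/eqP; rewrite -subr_eq0 -normr_eq0 eq_le normr_ge0 andbT.
apply/ler_addgt0Pr => e e0; rewrite add0r.
have z1 : cmod (0 : R[i]) <= 1 by rewrite cmod0.
have [d d0 Hd] := cdiff_cont (dg 0 z1) (divr_gt0 e0 pi2_gt0).
(* The side at - N is mapped to the circle of radius e^(-N); once it lies in the d-neighbourhood of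
   0, its mean is within the tolerance of Re (g 0). *)
have [N N0 HN] : exists2 N, 0 < N & expR (- N) < d.
  exists (1 + d^-1); first by rewrite addr_gt0 // invr_gt0.
  rewrite expRN -[d]invrK ltf_pV2 ?posrE ?expR_gt0 ?invr_gt0 //.
  by apply: lt_le_trans (expR_ge1Dx _); rewrite invrK addrA ltrDr.
have NN : - N <= 0 by rewrite oppr_le0 ltW.
rewrite (shift N N0).
have -> : 2 * pi * complex.Re (g 0) = sint 0 (2 * pi) (fun=> complex.Re (g 0)).
  by rewrite sint_cst ?subr0; [rewrite mulrC|exact/ltW/pi2_gt0].
rewrite -sint_sub; first last.
- exact: cont_seg_cst.
- by move=> t _; have [] := cont (- N) t NN.
have -> : e = (e / (2 * pi)) * (2 * pi - 0) by rewrite subr0 divfK // gt_eqF // pi2_gt0.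
apply: norm_sint_le; first by rewrite ltW // pi2_gt0.
  by apply: cont_seg_subr; [move=> t _; have [] := cont (- N) t NN|exact: cont_seg_cst].
move=> t _; rewrite /U -cReN -cReD; apply: le_trans (Re_le_cmod _) _; apply/ltW/Hd.
by rewrite subr0 cmod_cexp.
Qed.

(** Multiplication by the conjugate of g 0 makes the central value the real number |g 0|^2, and the
    mean value property for real parts bounds it by |g 0| M. *)
Lemma max_modulus0 g M : (forall z, cmod z <= 1 -> cdiff g z) ->
  (forall t, 0 <= t <= 2 * pi -> cmod (g (expi t)) <= M) -> cmod (g 0) <= M.
Proof.
move=> dg gM.
have dcg z : cmod z <= 1 -> cdiff (fun w => conjc (g 0) * g w) z.
  by move=> z1; apply: cdiff_mul; [exact: cdiff_cst|exact: dg].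
have cont t : {for t, continuous (fun s => complex.Re (conjc (g 0) * g (expi s)))}.
  have -> : (fun s => complex.Re (conjc (g 0) * g (expi s))) =
            (fun s => complex.Re (conjc (g 0) * g (1 * expi s))).
    by apply/funext => s; rewrite mul1r.
  apply: (@rcont_circle (fun w => complex.Re (conjc (g 0) * g w))).
  by apply: ccont_Re; apply/cdiff_cont/dcg; rewrite mul1r cmod_expi.
have := mean_value dcg; rewrite (mulrC (conjc _) (g 0)) mul_conj cRer (mulrC (2 * pi)) => E.
have [->|g0] := eqVneq (g 0) 0.
  by rewrite cmod0; apply: le_trans (cmod_ge0 _) (gM 0 _); rewrite lexx ltW ?pi2_gt0.
have cg0 : 0 < cmod (g 0) by rewrite cmod_gt0.
rewrite -(ler_pM2l cg0) -expr2 -(ler_pM2r pi2_gt0) -E.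
have <- : sint 0 (2 * pi) (fun=> cmod (g 0) * M) = cmod (g 0) * M * (2 * pi).
  by rewrite sint_cst ?subr0 // ltW // pi2_gt0.
apply: le_sint => [t _|t _|t tp]; [exact: cont|exact: cvg_cst|].
apply: le_trans (ler_norm _) _; apply: le_trans (Re_le_cmod _) _.
by rewrite cmodM cmod_conj ler_pM2l ?gM.
Qed.

End MeanValue.

Section SubMean.
Variable R : realType.
Implicit Types (z w l : R[i]) (e d r t x : R) (f g : R[i] -> R[i]).

(** Heine-Cantor: compactness is used in its near-covering form, with the filter of small positive d
    as parameter, so that one d serves all x. *)
Lemma cont_seg_unif a b (u : R -> R) : cont_seg a b u -> forall e, 0 < e ->
  exists2 d, 0 < d & forall x y, a <= x <= b -> a <= y <= b -> `|x - y| < d ->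
    `|u x - u y| < e.
Proof.
move=> cu e e0.
have /compact_near_coveringP/near_covering_withinP K := @segment_compact R a b.
have := K R (0^'+) (fun d x => forall y, a <= y <= b -> `|x - y| < d -> `|u x - u y| < e) _.
case.
  move=> x; rewrite /= in_itv /= => /cu /cvgrPdist_lt /(_ (e / 2)).
  have e2 : 0 < e / 2 by lra.
  move=> /(_ e2)[d /= d0 Hd].
  exists ([set x' | `|x - x'| < d / 2], [set r | r < d / 2]).
    split; first by exists (d / 2) => //=; lra.
    by apply: nbhs_right_lt; lra.
  move=> [x' r] [/= hx hr] _ y _ hy.
  have h1 : `|u x - u x'| < e / 2 by apply: Hd => /=; lra.
  have h2 : `|u x - u y| < e / 2.
    apply: Hd => /=; have := ler_normD (x - x') (x' - y).
    have -> : x - x' + (x' - y) = x - y by ring.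
    lra.
  have := ler_normD (u x' - u x) (u x - u y).
  have -> : u x' - u x + (u x - u y) = u x' - u y by ring.
  by rewrite (distrC (u x') (u x)); lra.
move=> d0 /= d00 H; exists (d0 / 2); first by rewrite divr_gt0.
move=> x y hx hy hxy; apply: (H (d0 / 2)) => //=.
- by rewrite sub0r normrN ger0_norm; lra.
- by rewrite divr_gt0.
Qed.

Lemma riemann_sum_le (u : R -> R) a d e n : 0 <= d ->
  cont_seg a (a + n%:R * d) u ->
  (forall x y, a <= x <= a + n%:R * d -> a <= y <= a + n%:R * d -> `|x - y| <= d ->
     `|u x - u y| <= e) ->
  \sum_(k < n) (u (a + k%:R * d) - e) * d <= sint a (a + n%:R * d) u.
Proof.
move=> d0; elim: n => [|n IH] cu H.
  by rewrite big_ord0 mul0r addr0 /sint set_itv1 Rintegral_set1.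
have ln : a + n%:R * d <= a + n.+1%:R * d by rewrite lerD2l ler_wpM2r // ler_nat.
have an : a <= a + n%:R * d by rewrite lerDl mulr_ge0.
have En : a + n.+1%:R * d - (a + n%:R * d) = d by rewrite -natr1; ring.
have mid : a <= a + n%:R * d <= a + n.+1%:R * d by rewrite an.
rewrite big_ord_recr /= (sint_split mid cu); apply: lerD.
  apply: IH; first exact: cont_seg_sub cu.
  by move=> x y /andP[? ?] /andP[? ?]; apply: H; apply/andP; split => //; lra.
rewrite -[X in _ * X]En -sint_cst //; apply: le_sint.
- exact: cont_seg_cst.
- exact: cont_seg_sub cu.
move=> x /andP[x1 x2].
have : `|u (a + n%:R * d) - u x| <= e.
  apply: H; [by apply/andP; split|by apply/andP; split => //; lra|].
  by rewrite distrC ger0_norm; lra.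
by rewrite ler_norml => /andP[? ?]; lra.
Qed.

(* |f|^(1/2) is controlled without logarithms: the product of the rotates of f by the N-th
   roots of unity is analytic, so max modulus, AM-GM and a Riemann sum suffice. *)
Lemma sub_mean0 f : (forall z, cmod z <= 1 -> cdiff f z) ->
  2 * pi * Num.sqrt (cmod (f 0)) <= sint 0 (2 * pi) (fun t => Num.sqrt (cmod (f (expi t)))).
Proof.
move=> df; pose u t := Num.sqrt (cmod (f (expi t))).
have u0 t : 0 <= u t by exact: sqrtr_ge0.
have cu t : {for t, continuous u}.
  have -> : u = fun s => Num.sqrt (cmod (f (1 * expi s))).
    by apply/funext => s; rewrite mul1r.
  apply: (@continuous_comp _ _ _ (fun s => cmod (f (1 * expi s))) Num.sqrt).
    apply: (@rcont_circle _ (fun w => cmod (f w))); apply: ccont_cmod.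
    by apply/cdiff_cont/df; rewrite mul1r cmod_expi.
  exact: sqrt_continuous.
have per t : u (t + 2 * pi) = u t by rewrite /u expi_2pi.
set I := sint _ _ _; have p0 := pi2_gt0 R.
have I0 : 0 <= I by apply: sint_ge0.
rewrite mulrC -ler_pdivlMr //; apply/ler_addgt0Pr => e e0.
(* Sums start at any t up to 2 pi and run over one period, hence two periods of uniform
   continuity. *)
have cu4 : cont_seg 0 (2 * pi + 2 * pi) u by move=> t _; exact: cu.
have [d d0 Hd] := cont_seg_unif cu4 e0.
have [N N0 HN] : exists2 N : nat, (0 < N)%N & 2 * pi / N%:R < d.
  exists (Num.truncn (2 * pi / d)).+1 => //.
  rewrite ltr_pdivrMr ?ltr0n // (mulrC d) -ltr_pdivrMr //; exact: truncnS_gt.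
have NR : 0 < N%:R :> R by rewrite ltr0n.
pose s : R := 2 * pi / N%:R; have s0 : 0 < s by rewrite divr_gt0.
have Ns : N%:R * s = 2 * pi by rewrite /s mulrC divfK // gt_eqF.
(* Means over N equally spaced points are within e of the circle mean, uniformly in the starting
   point t. This uniformity bounds the product [G] on the whole circle. *)
have avg t : 0 <= t <= 2 * pi -> (\sum_(k < N) u (t + k%:R * s)) / N%:R <= I / (2 * pi) + e.
  move=> /andP[t0 t2].
  have := @riemann_sum_le u t s e N (ltW s0); rewrite Ns.
  have -> : sint t (t + 2 * pi) u = I by apply: sint_period => //; exact: ltW.
  have -> : \sum_(k < N) (u (t + k%:R * s) - e) * s =
     ((\sum_(k < N) u (t + k%:R * s)) / N%:R - e) * (2 * pi).
    rewrite -mulr_suml sumrB sumr_const card_ord /s -[e *+ _]mulr_natr.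
    by field; rewrite gt_eqF.
  rewrite -ler_pdivlMr // => H; rewrite -lerBlDr; apply: H.
    by move=> x _; exact: cu.
  move=> x y /andP[x1 x2] /andP[y1 y2] xy; apply/ltW/Hd.
  - by apply/andP; split; lra.
  - by apply/andP; split; lra.
  - exact: le_lt_trans xy _.
pose G w := \prod_(k < N) f (expi (k%:R * s) * w).
have dG z : cmod z <= 1 -> cdiff G z.
  move=> z1; apply: (@cdiff_prod _ N (fun k w => f (expi (k%:R * s) * w))) => k.
  apply: (@cdiff_comp _ f (fun w => expi (k%:R * s) * w)).
    by apply: cdiff_mul; [exact: cdiff_cst|exact: cdiff_id].
  by apply: df; rewrite cmodM cmod_expi mul1r.
have cmod_prod (F : 'I_N -> R[i]) : cmod (\prod_k F k) = \prod_k cmod (F k).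
  exact: (big_morph _ (@cmodM R) (@cmod1 R)).
have Ie : 0 <= I / (2 * pi) + e by rewrite addr_ge0 ?divr_ge0 // ltW.
have GM t : 0 <= t <= 2 * pi -> cmod (G (expi t)) <= ((I / (2 * pi) + e) ^+ 2) ^+ N.
  move=> ht; rewrite /G cmod_prod.
  have -> : \prod_(k < N) cmod (f (expi (k%:R * s) * expi t)) =
    (\prod_(k < N) u (t + k%:R * s)) ^+ 2.
    rewrite -prodrXl; apply: eq_bigr => k _.
    by rewrite /u sqr_sqrtr ?cmod_ge0 // -expiD addrC.
  rewrite exprAC ler_sqr ?nnegrE ?exprn_ge0 ?prodr_ge0 //.
  apply: le_trans (_ : ((\sum_(k < N) u (t + k%:R * s)) / N%:R) ^+ N <= _); last first.
    by rewrite lerXn2r ?nnegrE ?avg // divr_ge0 ?sumr_ge0 ?ltW.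
  have [] := @leif_AGM _ 'I_N xpredT (fun k : 'I_N => u (t + k%:R * s)).
    by move=> k _; exact: u0.
  by rewrite card_ord.
have := max_modulus0 dG GM.
have -> : cmod (G 0) = cmod (f 0) ^+ N.
  by rewrite /G cmod_prod; under eq_bigr do rewrite mulr0; rewrite prodr_const card_ord.
rewrite ler_pXn2r ?nnegrE ?cmod_ge0 ?exprn_ge0 // => h.
by rewrite -(ger0_norm Ie) -sqrtr_sqr ler_sqrt // exprn_ge0.
Qed.

End SubMean.

(** * The Poisson kernel *)

Section Poisson.
Variable R : realType.
Implicit Types (z w l : R[i]) (e d r t x a : R) (f g : R[i] -> R[i]).

(** The Poisson kernel of the point r, without the factor 1/(2 pi): its integral over a period is 2
    pi. *)
Definition pker r t := (1 - r ^+ 2) / (1 - 2 * r * cos t + r ^+ 2).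

(* The argument of (e^{it} - r) / (1 - r e^{it}). *)
Definition mobius_arg r t := t + 2 * atan (r * sin t / (1 - r * cos t)).

Lemma pker_den_gt0 r t : 0 <= r < 1 -> 0 < 1 - 2 * r * cos t + r ^+ 2.
Proof.
move=> /andP[r0 r1]; have := cos_le1 t => c1.
have : 0 <= 2 * r * (1 - cos t) by rewrite !mulr_ge0 //; lra.
have : 0 < (1 - r) ^+ 2 by rewrite exprn_gt0; lra.
by nra.
Qed.

Lemma mobius_den_gt0 r t : 0 <= r < 1 -> 0 < 1 - r * cos t.
Proof. by move=> /andP[r0 r1]; have := cos_le1 t; have := cos_geN1 t; nra. Qed.

Lemma pker_gt0 r t : 0 <= r < 1 -> 0 < pker r t.
Proof.
move=> h; rewrite divr_gt0 ?pker_den_gt0 //; move: h => /andP[? ?]; nra.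
Qed.

(** The Poisson kernel is the angular speed of the Moebius map on the circle; this turns a mean of a
    function composed with a Moebius map into its Poisson integral. *)
Lemma is_derive_mobius_arg r t : 0 <= r < 1 -> is_derive t 1 (mobius_arg r) (pker r t).
Proof.
move=> h; have D0 := mobius_den_gt0 t h; have P0 := pker_den_gt0 t h.
pose q s := r * sin s / (1 - r * cos s).
have d1 : is_derive t 1 (fun s => r * sin s) (r * cos t).
  exact: (@is_deriveZ R R^o R^o (@sin R) r t 1 (cos t) _).
have d2 : is_derive t 1 (fun s => 1 - r * cos s) (r * sin t).
  have H : is_derive t 1 (fun s => r * cos s) (r * - sin t).
    exact: (@is_deriveZ R R^o R^o (@cos R) r t 1 (- sin t) _).
  have H2 : is_derive t 1 (fun s => 1 - r * cos s) (0 - r * - sin t).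
    exact: (@is_deriveB R R^o R^o (cst 1) (fun s => r * cos s) t 1 0 (r * - sin t) _ H).
  by rewrite mulrN opprK add0r in H2.
have d3 : is_derive t 1 (fun s => (1 - r * cos s)^-1) (- (1 - r * cos t) ^- 2 *: (r * sin t)).
  by apply: is_deriveV; rewrite // gt_eqF.
have d4 : is_derive t 1 q ((r * cos t - r ^+ 2) / (1 - r * cos t) ^+ 2).
  have H : is_derive t 1 q (r * sin t * (- (1 - r * cos t) ^- 2 * (r * sin t)) +
      (1 - r * cos t)^-1 * (r * cos t)).
    exact: (@is_deriveM R R^o (fun s => r * sin s) (fun s => (1 - r * cos s)^-1) t 1 _ _ d1 d3).
  move: H; congr is_derive.
  have -> : r ^+ 2 = r ^+ 2 * cos t ^+ 2 + r ^+ 2 * sin t ^+ 2.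
    by rewrite -mulrDr cos2Dsin2 mulr1.
  by field; rewrite gt_eqF.
have d5 : is_derive t 1 (fun s => atan (q s))
    ((1 + q t ^+ 2)^-1 * ((r * cos t - r ^+ 2) / (1 - r * cos t) ^+ 2)).
  exact: (@is_derive1_comp _ (@atan R) q t _ _ (is_derive1_atan (q t)) d4).
have d6 : is_derive t 1 (fun s => 2 * atan (q s))
    (2 * ((1 + q t ^+ 2)^-1 * ((r * cos t - r ^+ 2) / (1 - r * cos t) ^+ 2))).
  exact: (@is_deriveZ R R^o R^o (fun s => atan (q s)) 2 t 1 _ d5).
have d7 : is_derive t 1 (mobius_arg r)
    (1 + 2 * ((1 + q t ^+ 2)^-1 * ((r * cos t - r ^+ 2) / (1 - r * cos t) ^+ 2))).
  exact: (@is_deriveD R R^o R^o id (fun s => 2 * atan (q s)) t 1 1 _ _ d6).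
move: d7; congr is_derive; rewrite /pker /q.
have E : 1 - 2 * r * cos t + r ^+ 2 = (1 - r * cos t) ^+ 2 + (r * sin t) ^+ 2.
  have -> : r ^+ 2 = r ^+ 2 * cos t ^+ 2 + r ^+ 2 * sin t ^+ 2.
    by rewrite -mulrDr cos2Dsin2 mulr1.
  by ring.
have -> : 1 + (r * sin t / (1 - r * cos t)) ^+ 2 =
  (1 - 2 * r * cos t + r ^+ 2) / (1 - r * cos t) ^+ 2.
  by rewrite E; field; rewrite gt_eqF.
by field; rewrite !gt_eqF.
Qed.

Lemma expi_2atan q : expi (2 * atan q) * (1 -i* q)%C = (1 +i* q)%C :> R[i].
Proof.
have -> : 2 * atan q = atan q + atan q by ring.
have cn0 : 0 < cos (atan q).
  by apply: cos_gt0_pihalf; rewrite atan_gtNpi2 atan_ltpi2.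
have sE : sin (atan q) = q * cos (atan q).
  by rewrite -{2}(atanK q) /tan divfK // gt_eqF.
have cE2 : cos (atan q) ^+ 2 * (1 + q ^+ 2) = 1.
  have := cos2_tan2 (lt0r_neq0 cn0); rewrite atanK => <-.
  by rewrite mulfV // expf_neq0 // gt_eqF.
rewrite expiD; apply: complex_ext; rewrite !cE /= sE.
- by transitivity (cos (atan q) ^+ 2 * (1 + q ^+ 2)); [ring|].
- by transitivity (q * (cos (atan q) ^+ 2 * (1 + q ^+ 2))); [ring|rewrite cE2 mulr1].
Qed.

(** The number e^{it} - r is e^{it} times the conjugate of 1 - r e^{it}, and 1 - r e^{it} is a
    positive multiple of 1 - iq with q = r sin t / (1 - r cos t). The quotient thus has argument t +
    2 atan q. *)
Lemma expi_mobius_arg r t : 0 <= r < 1 ->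
  expi (mobius_arg r t) * (1 - r%:C%C * expi t) = expi t - r%:C%C.
Proof.
move=> h; have D0 := mobius_den_gt0 t h.
pose q := r * sin t / (1 - r * cos t).
have E1 : 1 - r%:C%C * expi t = (1 - r * cos t)%:C%C * (1 -i* q)%C.
  apply: complex_ext; rewrite !cE /= /q; [ring|field]; by rewrite gt_eqF.
have E2 : expi t - r%:C%C = (1 - r * cos t)%:C%C * (1 +i* q)%C * expi t.
  have e1 : r = r * cos t ^+ 2 + r * sin t ^+ 2 by rewrite -mulrDr cos2Dsin2 mulr1.
  apply: complex_ext; rewrite !cE /= /q.
  - rewrite [X in _ - X = _]e1; field; by rewrite gt_eqF.
  - field; by rewrite gt_eqF.
by rewrite E1 E2 /mobius_arg expiD -expi_2atan; ring.
Qed.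

Lemma pker_continuous r t : 0 <= r < 1 -> {for t, continuous (pker r)}.
Proof.
move=> h; have P0 := pker_den_gt0 t h.
apply: cvgM; first exact: cvg_cst.
apply: cvgV; first by rewrite gt_eqF.
apply: cvgD; last exact: cvg_cst.
apply: cvgB; first exact: cvg_cst.
apply: cvgM; [exact: cvg_cst|exact: continuous_cos].
Qed.

(** Substitution along [mobius_arg r], which fixes 0 and 2 pi and increases because its derivative
    [pker r] is positive. *)
Lemma sint_mobius r (v : R -> R) : 0 <= r < 1 -> (forall t, {for t, continuous v}) ->
  sint 0 (2 * pi) v = sint 0 (2 * pi) (fun t => v (mobius_arg r t) * pker r t).
Proof.
move=> h cv; have dF t := is_derive_mobius_arg t h.
have F0 : mobius_arg r 0 = 0 by rewrite /mobius_arg sin0 mulr0 mul0r atan0 mulr0 addr0.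
have F2 : mobius_arg r (2 * pi) = 2 * pi.
  have -> : 2 * pi = 0 + pi *+ 2 :> R by rewrite add0r mulr_natl.
  by rewrite /mobius_arg sinD2pi sin0 mulr0 mul0r atan0 mulr0 addr0.
have eF t : derivable (mobius_arg r) t 1 by case: (dF t).
have F' : derive1 (mobius_arg r) = pker r.
  by apply/funext => t; rewrite derive1E; have [_ ->] := dF t.
have cF t : {for t, continuous (mobius_arg r)}.
  by apply/differentiable_continuous/derivable1_diffP; have [] := dF t.
rewrite /sint /Rintegral; congr fine.
rewrite -{1}F0 -{1}F2 integration_by_substitution_increasing.
- by apply: eq_integral => t _ /=; rewrite F'.
- exact/ltW/pi2_gt0.
- move=> x y /[!in_itv]/= /andP[x0 _] /andP[_ y2] xy.
  apply: (@gtr0_derive1_incr _ _ 0 (2 * pi) (fun s _ => eF s)) => //.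
    by move=> s _; rewrite F' pker_gt0.
  by apply: continuous_subspaceT => s; exact: cF.
- by move=> s _; rewrite F'; exact: pker_continuous.
- rewrite F'; apply/cvg_ex; exists (pker r 0); apply: cvg_at_right_filter; exact: pker_continuous.
- rewrite F'; apply/cvg_ex; exists (pker r (2 * pi)); apply: cvg_at_left_filter; exact: pker_continuous.
- split; [by move=> s _; exact: eF| |].
  + apply: cvg_at_right_filter; exact: cF.
  + apply: cvg_at_left_filter; exact: cF.
- by apply: continuous_subspaceT => s; exact: cv.
Qed.

Lemma sint_pker r : 0 <= r < 1 -> sint 0 (2 * pi) (pker r) = 2 * pi.
Proof.
move=> h; have := @sint_mobius r (fun=> 1) h (fun t => @cvg_cst _ _ _ _ _).
rewrite sint_cst ?ltW ?pi2_gt0 // mul1r subr0 => E; rewrite [RHS]E.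
by apply: eq_sint => t _; rewrite mul1r.
Qed.

(** Both claims are elementary: |rw| <= r < 1, and |1 + rw|^2 - |w + r|^2 = (1 - r^2)(1 - |w|^2). *)
Lemma cmod_mobius r w : 0 <= r < 1 -> cmod w <= 1 ->
  1 + r%:C%C * w != 0 /\ cmod ((w + r%:C%C) / (1 + r%:C%C * w)) <= 1.
Proof.
move=> /andP[r0 r1] w1.
have d0 : 1 + r%:C%C * w != 0.
  rewrite -cmod_gt0; have := cmod_lerB 1 (- (r%:C%C * w)).
  rewrite opprK cmod1 cmodN cmodM cmodr ger0_norm //.
  have : r * cmod w <= r by rewrite ler_piMr.
  lra.
split => //; rewrite cmodM cmodV ler_pdivrMr ?cmod_gt0 // mul1r.
rewrite -ler_sqr ?nnegrE ?cmod_ge0 // !sqr_cmod !cE -subr_ge0.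
have : complex.Re w ^+ 2 + complex.Im w ^+ 2 <= 1.
  by rewrite -sqr_cmod -[X in _ <= X](expr1n _ 2) ler_sqr ?nnegrE ?cmod_ge0.
move: (complex.Re w) (complex.Im w) => x y xy.
have -> : (1 + (r * x - 0 * y)) ^+ 2 + (0 + (r * y + 0 * x)) ^+ 2 -
   ((x + r) ^+ 2 + (y + 0) ^+ 2) = (1 - r ^+ 2) * (1 - (x ^+ 2 + y ^+ 2)) by ring.
by apply: mulr_ge0; [nra|lra].
Qed.

Lemma sub_mean f r a : (forall z, cmod z <= 1 -> cdiff f z) -> 0 <= r < 1 ->
  2 * pi * Num.sqrt (cmod (f (r%:C%C * expi a))) <=
  sint 0 (2 * pi) (fun t => pker r t * Num.sqrt (cmod (f (expi (a + t))))).
Proof.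
move=> df h.
pose F w := f (expi a * ((w + r%:C%C) / (1 + r%:C%C * w))).
have dF z : cmod z <= 1 -> cdiff F z.
  move=> z1; have [d0 m1] := cmod_mobius h z1.
  apply: (@cdiff_comp _ f (fun w => expi a * ((w + r%:C%C) / (1 + r%:C%C * w)))).
    apply: cdiff_mul; first exact: cdiff_cst.
    apply: cdiff_div => //; apply: cdiff_add; try exact: cdiff_cst.
      exact: cdiff_id.
    by apply: cdiff_mul; [exact: cdiff_cst|exact: cdiff_id].
  by apply: df; rewrite cmodM cmod_expi mul1r.
have F0 : F 0 = f (r%:C%C * expi a) by rewrite /F mulr0 addr0 add0r divr1 mulrC.
have cF t : {for t, continuous (fun s => Num.sqrt (cmod (F (expi s))))}.
  have -> : (fun s => Num.sqrt (cmod (F (expi s)))) = fun s => Num.sqrt (cmod (F (1 * expi s))).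
    by apply/funext => s; rewrite mul1r.
  apply: (@continuous_comp _ _ _ (fun s => cmod (F (1 * expi s))) Num.sqrt).
    apply: (@rcont_circle _ (fun w => cmod (F w))); apply: ccont_cmod.
    by apply/cdiff_cont/dF; rewrite mul1r cmod_expi.
  exact: sqrt_continuous.
have := sub_mean0 dF; rewrite F0 => H; apply: le_trans H _.
rewrite (sint_mobius h cF) le_eqVlt; apply/orP; left; apply/eqP.
apply: eq_sint => t _; rewrite mulrC; congr (_ * Num.sqrt (cmod _)).
rewrite /F expiD; congr (f (_ * _)).
(* The map w -> (w + r) / (1 + rw) inverts e^{it} -> (e^{it} - r) / (1 - r e^{it}), so that it sends
   [W] back to e^{it}. *)
have E := expi_mobius_arg t h; set W := expi (mobius_arg r t) in E *.
have W1 : cmod W <= 1 by rewrite cmod_expi.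
have [d0 _] := cmod_mobius h W1.
apply: (mulIf d0); rewrite divfK //.
transitivity (W * (1 - r%:C%C * expi t) + r%:C%C + W * (r%:C%C * expi t)); [|rewrite E]; ring.
Qed.

End Poisson.

(** * The closed disc and Carleson windows *)

Arguments cmod : simpl never.
Arguments toC : simpl never.

Section Plane.
Variable R : realType.
Implicit Types (z w l : R[i]) (e d r t x a h : R) (f g : R[i] -> R[i]).

Lemma polar z : exists2 t, - pi <= t <= pi & z = (cmod z)%:C%C * expi t.
Proof.
have [->|z0] := eqVneq z 0.
  exists 0; last by rewrite cmod0 mul0r.
  by rewrite oppr_le0 pi_ge0.
have c0 : 0 < cmod z by rewrite cmod_gt0.
pose q := complex.Re z / cmod z.
have q1 : -1 <= q <= 1.
  rewrite -ler_norml normrM normfV (ger0_norm (ltW c0)) ler_pdivrMr // mul1r.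
  exact: Re_le_cmod.
have [a0 api] := (acos_ge0 q1, acos_lepi q1).
have ca : cos (acos q) = q by rewrite acosK // in_itv.
have sE : sin (acos q) ^+ 2 = (complex.Im z / cmod z) ^+ 2.
  rewrite sin2cos2 ca /q !expr_div_n.
  have -> : 1 = cmod z ^+ 2 / cmod z ^+ 2 by rewrite divff // expf_neq0 // gt_eqF.
  by rewrite -mulrBl sqr_cmod; congr (_ / _); ring.
have s0 : 0 <= sin (acos q) by rewrite sin_ge0_pi // a0 api.
have {sE} sE : sin (acos q) = `|complex.Im z| / cmod z.
  apply/eqP; rewrite -(@eqrXn2 _ 2) //; last by rewrite divr_ge0 // ltW.
  by rewrite sE !expr_div_n real_normK ?num_real.
have [y0|y0] := leP 0 (complex.Im z).
- exists (acos q); first by rewrite api andbT (le_trans _ a0) // oppr_le0 pi_ge0.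
  apply: complex_ext; rewrite !cE ?ca ?sE /q ger0_norm //; field; by rewrite gt_eqF.
- exists (- acos q); first by rewrite lerN2 api (le_trans _ (pi_ge0 R)) // oppr_le0.
  apply: complex_ext; rewrite !cE ?cosN ?sinN ?ca ?sE /q ltr0_norm //; field; by rewrite gt_eqF.
Qed.

Lemma polar_pos z : exists2 t, 0 <= t <= 2 * pi & z = (cmod z)%:C%C * expi t.
Proof.
have [t /andP[t1 t2] E] := polar z; have p0 := pi_gt0 R.
have [t0|t0] := leP 0 t; first by exists t => //; apply/andP; split; lra.
exists (t + 2 * pi); first by apply/andP; split; lra.
by rewrite expi_2pi.
Qed.

(** The set is the union of the boxes with rational centre and rational half-side that it contains;
    the other indices contribute the empty set. A half-side between d/8 and d/4 and a centre within
    d/8 of the point keep the box inside its d-neighbourhood. *)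
Lemma open_plane_measurable (U : set (R * R)%type) :
  (forall p, U p -> exists2 d, 0 < d & forall p' : R * R,
     `|p'.1 - p.1| < d -> `|p'.2 - p.2| < d -> U p') ->
  measurable U.
Proof.
move=> oU.
pose ivl (x d : R) : set R := `]x - d, x + d[%classic.
pose box (i : rat * rat * rat) : set (R * R)%type :=
  ivl (ratr i.1.1) (ratr i.2) `*` ivl (ratr i.1.2) (ratr i.2).
have -> : U = \bigcup_i (if `[< box i `<=` U >] then box i else set0).
  apply/seteqP; split => [[x y] Uxy|p [i _]]; last by case: asboolP => // iU; exact: iU.
  have [d d0 Hd] := oU _ Uxy.
  have [q] := @rat_in_itvoo R (d / 8) (d / 4) ltac:(lra).
  have [qx] := @rat_in_itvoo R (x - d / 8) (x + d / 8) ltac:(lra).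
  have [qy] := @rat_in_itvoo R (y - d / 8) (y + d / 8) ltac:(lra).
  rewrite !in_itv /= => /andP[y1 y2] /andP[x1 x2] /andP[q1 q2].
  exists (qx, qy, q) => //; case: asboolP => [_|[]].
    by split; rewrite /= /ivl /= in_itv /=; apply/andP; split; lra.
  move=> [x' y'] [] /=; rewrite /ivl /= !in_itv /= => /andP[? ?] /andP[? ?].
  by apply: Hd => /=; rewrite ltr_norml; apply/andP; split; lra.
apply: countable_bigcupT_measurable => // i.
by case: asboolP => // _; apply: measurableX; exact: measurable_itv.
Qed.

Definition pcont (D : set (R * R)%type) (u : R * R -> R) := forall p, D p ->
  forall e, 0 < e -> exists2 d, 0 < d & forall p' : R * R,
    `|p'.1 - p.1| < d -> `|p'.2 - p.2| < d -> `|u p' - u p| < e.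

Lemma pcont_measurable D u : measurable D -> pcont D u -> measurable_fun D u.
Proof.
move=> mD cu _; apply: (measurability _ (measurable_realfun.RGenOInfty.measurableE R)) => //.
move=> /= _ [_ [y ->] <-]; rewrite preimage_itvoy.
pose U : set (R * R)%type := [set p | exists2 d, 0 < d & forall p' : R * R,
    `|p'.1 - p.1| < d -> `|p'.2 - p.2| < d -> y < u p'].
rewrite (_ : D `&` _ = D `&` U).
  apply: measurableI => //; apply: open_plane_measurable => p [d d0 Hd].
  exists (d / 2); first by lra.
  move=> p' h1 h2; exists (d / 2); first by lra.
  move=> q h3 h4; apply: Hd.
    by have := ler_normD (q.1 - p'.1) (p'.1 - p.1); rewrite addrA subrK; lra.
  by have := ler_normD (q.2 - p'.2) (p'.2 - p.2); rewrite addrA subrK; lra.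
apply/seteqP; split => p [Dp]; rewrite /U /= => H; split => //.
- have [d d0 Hd] := cu _ Dp (u p - y) ltac:(lra).
  exists d => // p' h1 h2; have := Hd _ h1 h2; rewrite ltr_norml => /andP[]; lra.
- by case: H => d d0; apply; rewrite subrr normr0.
Qed.

Lemma rcont_pcont (D : set (R * R)%type) (u : R[i] -> R) :
  (forall p, D p -> rcont u (toC p)) -> pcont D (fun p => u (toC p)).
Proof.
move=> cu p Dp e e0; have [d d0 Hd] := cu p Dp e e0.
exists (d / 2) => [|p' h1 h2]; first by lra.
by apply: Hd; apply: le_lt_trans (cmod_line_le _ _ _ _) _; lra.
Qed.

Lemma rcont_cmod z : rcont (@cmod R) z.
Proof. by apply: (@ccont_cmod _ id); apply/cdiff_cont/cdiff_id. Qed.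

Lemma measurable_cmod : measurable_fun setT (fun p : R * R => cmod (toC p)).
Proof.
by apply: pcont_measurable => //; apply: (@rcont_pcont _ (@cmod R)) => p _; exact: rcont_cmod.
Qed.

Lemma measurable_gt (u : R * R -> R) y : measurable_fun setT u -> measurable [set p | y < u p].
Proof.
by move=> mu; rewrite -preimage_itvoy -[X in measurable X]setTI; apply: mu => //.
Qed.

Lemma measurable_cdisc : measurable (@cdisc R).
Proof.
rewrite (_ : cdisc = ~` [set p | 1 < cmod (toC p)]).
  by apply: measurableC; apply: measurable_gt; exact: measurable_cmod.
by apply/seteqP; split => p; rewrite /cdisc /= leNgt => /negP.
Qed.

Lemma ltr_cos_norm h t : 0 <= h <= pi -> `|t| <= pi -> (cos h < cos t) = (`|t| < h).
Proof.
move=> hh tt; have -> : cos t = cos `|t| by case: (ger0P t) => // _; rewrite cosN.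
by rewrite ltr_cos // in_itv //= normr_ge0.
Qed.

(** Since h <= 1 < pi, an argument of absolute value at most pi is below h exactly when its cosine
    exceeds cos h. Multiplied by |z|, this becomes a strict inequality between continuous functions,
    which gives measurability and a usable bound on the window. The origin is excluded by 1 - h <
    |z|. *)
Lemma window_eq xi h : cmod xi = 1 -> 0 < h <= 1 ->
  window xi h = cdisc `&` ([set p | 1 - h < cmod (toC p)] `&`
    [set p | 0 < complex.Re (toC p * conjc xi) - cos h * cmod (toC p)]).
Proof.
move=> x1 /andP[h0 h1]; have pi1 : 1 < pi :> R by have := pihalf_ge1 R; lra.
apply/seteqP; split => p.
- case=> /andP[a b] [t [/andP[t1 t2] E]]; split => //; split => //.
  rewrite /= E !cE mul0r subr0 (mulrC (cos h)) -mulrBr mulr_gt0 ?subr_gt0 //; first by lra.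
  have th : `|t| < h by rewrite ltr_norml t1 t2.
  by rewrite ltr_cos_norm //; [apply/andP; split|]; lra.
- move=> [a [/= b c]]; split; first by rewrite b.
  have [t /andP[t1 t2] E] := polar (toC p * conjc xi).
  have cM : cmod (toC p * conjc xi) = cmod (toC p) by rewrite cmodM cmod_conj x1 mulr1.
  rewrite cM in E; exists t => //; move: c; rewrite E !cE mul0r subr0.
  have p0 : 0 < cmod (toC p) by lra.
  rewrite (mulrC (cos h)) -mulrBr pmulr_rgt0 // subr_gt0.
  have tt : `|t| <= pi by rewrite ler_norml t1 t2.
  have hh : 0 <= h <= pi by apply/andP; split; lra.
  by rewrite ltr_cos_norm // ltr_norml.
Qed.

Lemma measurable_window xi h : cmod xi = 1 -> 0 < h <= 1 -> measurable (window xi h).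
Proof.
move=> x1 h1; rewrite window_eq //; apply: measurableI; first exact: measurable_cdisc.
apply: measurableI; apply: measurable_gt; first exact: measurable_cmod.
apply: pcont_measurable => //.
apply: (@rcont_pcont _ (fun z => complex.Re (z * conjc xi) - cos h * cmod z)) => p _ e e0.
have c1 : 0 < `|cos h| + 1 by have := normr_ge0 (cos h); lra.
have c2 : 0 < `|cos h| + 1 + 1 by lra.
exists (e / (`|cos h| + 1 + 1)); first by rewrite divr_gt0.
move=> w; rewrite ltr_pdivlMr // => H.
have -> : complex.Re (w * conjc xi) - cos h * cmod w -
  (complex.Re (toC p * conjc xi) - cos h * cmod (toC p)) =
  complex.Re ((w - toC p) * conjc xi) - cos h * (cmod w - cmod (toC p)).
  by rewrite mulrBl !cE; ring.
apply: le_lt_trans H; apply: le_trans (ler_normB _ _) _.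
have A : `|complex.Re ((w - toC p) * conjc xi)| <= cmod (w - toC p).
  by apply: le_trans (Re_le_cmod _) _; rewrite cmodM cmod_conj x1 mulr1.
have B : `|cmod w - cmod (toC p)| <= cmod (w - toC p).
  by rewrite ler_norml cmod_lerB andbT lerNl opprB cmodBC cmod_lerB.
rewrite normrM; have C := ler_wpM2l (normr_ge0 (cos h)) B.
have := cmod_ge0 (w - toC p); rewrite !mulrDr mulr1; rewrite (mulrC _ `|cos h|); lra.
Qed.

End Plane.

(** * The weak-type estimate *)

Section PoissonBounds.
Variable R : realType.
Implicit Types (z w l : R[i]) (e d r t x a h s : R) (f g : R[i] -> R[i]).

Lemma sin_ge_mul_cos x : 0 <= x <= pi -> x * cos x <= sin x.
Proof.
move=> /andP[x0 xp].
have [c /andP[c0 cx] E] : exists2 c, 0 <= c <= x & sin x = cos c * x.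
  have cs : {within `[0, x], continuous (@sin R)}.
    by apply: continuous_subspaceT => y; exact: continuous_sin.
  have [c cx E] := @MVT_segment R (@sin R) (@cos R) 0 x x0 (fun y _ => is_derive_sin y) cs.
  exists c; first by move: cx; rewrite in_itv.
  by move: E; rewrite sin0 !subr0.
have cI : c \in `[0, pi] by rewrite in_itv /=; apply/andP; split; lra.
have xI : x \in `[0, pi] by rewrite in_itv /= x0 xp.
by rewrite E mulrC ler_wpM2r // leNgt ltr_cos // -leNgt.
Qed.

(** With x = t/4 one has 1 - cos t = 8 sin^2 x cos^2 x. The quarter angle keeps 2x within pi/2,
    hence cos^2 x >= 1/2, and sin x >= x cos x does the rest. *)
Lemma one_sub_cos_ge t : `|t| <= pi -> t ^+ 2 / 8 <= 1 - cos t.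
Proof.
wlog t0 : t / 0 <= t => [H|].
  have [/H//|t0] := leP 0 t.
  by rewrite -normrN -sqrrN -cosN; apply: H; lra.
rewrite ger0_norm // => tp; pose x := t / 4.
have xp : 0 <= x <= pi by rewrite /x; apply/andP; split; lra.
have S := sin_ge_mul_cos xp.
have C2 : 2^-1 <= cos x ^+ 2.
  have : 0 <= cos (x + x).
    by apply: cos_ge0_pihalf; rewrite /x; apply/andP; split; have := pi_ge0 R; lra.
  rewrite cosD; have := cos2Dsin2 x; rewrite !expr2; lra.
have E : 1 - cos t = 8 * (sin x ^+ 2 * cos x ^+ 2).
  have -> : t = (x + x) + (x + x) by rewrite /x; field.
  rewrite [cos (_ + _ + _)]cosD cosD sinD.
  have := cos2Dsin2 x; set c := cos x; set d := sin x => H.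
  transitivity ((c ^+ 2 + d ^+ 2) ^+ 2 - ((c * c - d * d) * (c * c - d * d) -
    (d * c + c * d) * (d * c + c * d))); [by rewrite H expr1n|ring].
have c0 : 0 <= cos x by apply: cos_ge0_pihalf; rewrite /x; apply/andP; split; have := pi_ge0 R; lra.
have x0 : 0 <= x by case/andP: xp.
have S2 : (x * cos x) ^+ 2 <= sin x ^+ 2.
  by rewrite lerXn2r ?nnegrE ?mulr_ge0 // (le_trans _ S) // mulr_ge0.
rewrite E; apply: (@le_trans _ _ (8 * ((x * cos x) ^+ 2 * cos x ^+ 2))); last first.
  by rewrite ler_pM2l // ler_wpM2r ?sqr_ge0.
have -> : t ^+ 2 / 8 = 8 * (x ^+ 2 * 2^-1 * 2^-1) by rewrite /x; field.
have A := ler_wpM2l (sqr_ge0 x) C2.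
rewrite ler_pM2l //; clearbody x.
by rewrite exprMn ler_pM // ?invr_ge0 // mulr_ge0 ?sqr_ge0 // invr_ge0.
Qed.

Lemma pker_le r t : 0 <= r < 1 -> pker r t <= 2 / (1 - r).
Proof.
move=> h; have D := pker_den_gt0 t h; case/andP: h => r0 r1.
rewrite ler_pdivrMr // mulrAC ler_pdivlMr; last by lra.
have : 0 <= r * (1 - cos t) by rewrite mulr_ge0 // subr_ge0 cos_le1.
by nra.
Qed.

(** The denominator (1 - r)^2 + 2r(1 - cos t) is at least t^2/64: for r >= 1/2 by the bound on 1 -
    cos t, for r < 1/2 because (1 - r)^2 >= 1/4 and t^2 <= 16. The numerator is at most 2(1 - r),
    and 128 = 2 * 64. *)
Lemma pker_le_sqr r t : 0 <= r < 1 -> `|t| <= pi -> t != 0 ->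
  pker r t <= 128 * (1 - r) / t ^+ 2.
Proof.
move=> h tp t0; have D := pker_den_gt0 t h; case/andP: h => r0 r1.
have t2 : 0 < t ^+ 2 by rewrite lt_def sqr_ge0 sqrf_eq0 t0.
have p4 : t ^+ 2 <= 16.
  have -> : (16 : R) = 4 ^+ 2 by ring.
  rewrite -[t ^+ 2]real_normK ?num_real // lerXn2r ?nnegrE //.
  by have := pihalf_lt2 R; lra.
have C := one_sub_cos_ge tp.
have L : t ^+ 2 / 64 <= 1 - 2 * r * cos t + r ^+ 2.
  have -> : 1 - 2 * r * cos t + r ^+ 2 = (1 - r) ^+ 2 + 2 * r * (1 - cos t) by ring.
  have [rh|rh] := leP (2^-1) r; last by nra.
  have : 0 <= (1 - r) ^+ 2 by exact: sqr_ge0.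
  by nra.
rewrite ler_pdivrMr // mulrAC ler_pdivlMr //.
apply: (@le_trans _ _ (128 * (1 - r) * (t ^+ 2 / 64))); last first.
  by rewrite ler_wpM2l // mulr_ge0; lra.
by have : 0 <= (1 - r) * t ^+ 2 by [rewrite mulr_ge0; lra]; nra.
Qed.

Definition circ_sqrt f t := Num.sqrt (cmod (f (expi t))).

(** The cut is at half the level: what lies below s/2 accounts for at most half of a Poisson mean
    exceeding s. *)
Definition circ_excess f s t := Num.max (circ_sqrt f t - s / 2) 0.

Variable f : R[i] -> R[i].
Hypothesis df : forall z, cmod z <= 1 -> cdiff f z.

Lemma circ_sqrt_continuous t : {for t, continuous (circ_sqrt f)}.
Proof.
have -> : circ_sqrt f = fun x => Num.sqrt (cmod (f (1 * expi x))).
  by apply/funext => x; rewrite mul1r.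
apply: (@continuous_comp _ _ _ (fun x => cmod (f (1 * expi x))) Num.sqrt).
  apply: (@rcont_circle _ (fun w => cmod (f w))); apply: ccont_cmod.
  by apply/cdiff_cont/df; rewrite mul1r cmod_expi.
exact: sqrt_continuous.
Qed.

Lemma circ_excess_continuous s t : {for t, continuous (circ_excess f s)}.
Proof.
apply: (@continuous_max _ _ (fun t => circ_sqrt f t - s / 2) (fun=> 0)).
  apply: cvgB; [exact: circ_sqrt_continuous|exact: cvg_cst].
exact: cvg_cst.
Qed.

Lemma circ_excess_ge0 s t : 0 <= circ_excess f s t.
Proof. by rewrite /circ_excess le_max lexx orbT. Qed.

Lemma circ_excess_period s t : circ_excess f s (t + 2 * pi) = circ_excess f s t.
Proof. by rewrite /circ_excess /circ_sqrt expi_2pi. Qed.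


Lemma circ_excess_shift_continuous s a t : {for t, continuous (fun x => circ_excess f s (a + x))}.
Proof.
apply: (@continuous_comp _ _ _ (fun x => a + x) (circ_excess f s)).
  by apply: cvgD; [exact: cvg_cst|exact: cvg_id].
exact: circ_excess_continuous.
Qed.

Lemma pker_excess_continuous r s a t : 0 <= r < 1 ->
  {for t, continuous (fun x => pker r x * circ_excess f s (a + x))}.
Proof. by move=> h; apply: cvgM; [exact: pker_continuous|exact: circ_excess_shift_continuous]. Qed.

(** From [circ_sqrt] <= excess + s/2 and the total mass 2 pi of the kernel: of the mean value 2 pi
    s, the constant s/2 uses up pi s. *)
Lemma excess_mean_gt r a s : 0 <= r < 1 -> s < Num.sqrt (cmod (f (r%:C%C * expi a))) ->
  pi * s < sint (- pi) pi (fun t => pker r t * circ_excess f s (a + t)).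
Proof.
move=> h hs; have p0 := pi_gt0 R.
have pp : pi = - pi + 2 * pi :> R by ring.
have cu t : {for t, continuous (fun x => circ_sqrt f (a + x))}.
  apply: (@continuous_comp _ _ _ (fun x => a + x) (circ_sqrt f)).
    by apply: cvgD; [exact: cvg_cst|exact: cvg_id].
  exact: circ_sqrt_continuous.
rewrite [X in sint _ X]pp sint_period; last 3 first.
- by lra.
- by move=> t; exact: pker_excess_continuous.
- move=> t; rewrite addrA circ_excess_period /pker.
  by rewrite (mulr_natl pi) (@cosD2pi R t).
have A : 2 * pi * s < sint 0 (2 * pi) (fun t => pker r t * circ_sqrt f (a + t)).
  apply: lt_le_trans (sub_mean a df h).
  by rewrite ltr_pM2l ?mulr_gt0.
have B : sint 0 (2 * pi) (fun t => pker r t * circ_sqrt f (a + t)) <=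
   sint 0 (2 * pi) (fun t => pker r t * circ_excess f s (a + t) + s / 2 * pker r t).
  apply: le_sint => [t _|t _|t _].
  - by apply: cvgM; [exact: pker_continuous|exact: cu].
  - apply: cvgD; first exact: pker_excess_continuous.
    by apply: cvgM; [exact: cvg_cst|exact: pker_continuous].
  - rewrite (mulrC (s / 2)) -mulrDr ler_pM2l ?pker_gt0 //.
    by rewrite -lerBlDr /circ_excess le_max lexx.
rewrite sint_add in B; last 2 first.
- by move=> t _; exact: pker_excess_continuous.
- by move=> t _; apply: cvgM; [exact: cvg_cst|exact: pker_continuous].
rewrite sint_scale in B; last by move=> t _; exact: pker_continuous.
rewrite sint_pker // in B; lra.
Qed.

End PoissonBounds.

(** * Stopping arcs for the Poisson integral of the excess *)

Section StoppingInterval.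
Variable R : realType.
Implicit Types (z w : R[i]) (e d r t x a h s l : R) (f g : R[i] -> R[i]).
Variable f : R[i] -> R[i].
Hypothesis df : forall z, cmod z <= 1 -> cdiff f z.
Let cg s a t := @circ_excess_shift_continuous _ _ df s a t.
Let cPg r s a t := @pker_excess_continuous _ _ df r s a t.

Variable K : R.
(* 512 = 4 * 128: the bound pker_le_sqr on the annulus A_ n / 2 <= |t| <= A_ n. *)
Hypothesis K512 : 512 <= K.
Let K0 : 0 < K. Proof. by have := K512; lra. Qed.

Let A_ n : R := pi / 2 ^+ n.

Let A_gt0 n : 0 < A_ n.
Proof. by rewrite divr_gt0 ?exprn_gt0 ?pi_gt0. Qed.

Let A_S n : A_ n = A_ n.+1 + A_ n.+1.
Proof.
have n0 : (2 : R) ^+ n != 0 by rewrite expf_neq0 // pnatr_eq0.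
by rewrite /A_ exprS; field.
Qed.

Let A_le n : A_ n <= pi.
Proof.
rewrite ler_pdivrMr ?exprn_gt0 // ler_peMr ?pi_ge0 //.
by rewrite exprn_ege1 // ler1n.
Qed.

Let annulus r a s n : 0 <= r < 1 ->
  sint (- A_ n) (A_ n) (fun t => pker r t * circ_excess f s (a + t)) <=
  sint (- A_ n.+1) (A_ n.+1) (fun t => pker r t * circ_excess f s (a + t)) +
  K * (1 - r) / A_ n ^+ 2 * sint (- A_ n) (A_ n) (fun t => circ_excess f s (a + t)).
Proof.
move=> h; set u := fun t => pker r t * _; set v := fun t => circ_excess f s (a + t).
have [A0 A1 AS] := And3 (A_gt0 n) (A_gt0 n.+1) (A_S n).
have cu x y : cont_seg x y u by move=> t _; exact: cPg.
have cv x y : cont_seg x y v by move=> t _; exact: cg.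
pose C := K * (1 - r) / A_ n ^+ 2.
have C0 : 0 <= C.
  by apply: divr_ge0; [apply: mulr_ge0; [exact: ltW|case/andP: h; lra]|exact: sqr_ge0].
have side x y : (forall t, x <= t <= y -> A_ n.+1 <= `|t| <= A_ n) ->
    sint x y u <= C * sint x y v.
  move=> hxy; rewrite -sint_scale //; apply: le_sint => // [|t /hxy/andP[t1 t2]].
    by move=> t _; apply: cvgM; [exact: cvg_cst|exact: cg].
  rewrite /u ler_wpM2r ?circ_excess_ge0 //.
  have tn0 : t != 0 by rewrite -normr_gt0; lra.
  apply: le_trans (pker_le_sqr h _ tn0) _; first exact: le_trans t2 (A_le n).
  have q : A_ n.+1 ^+ 2 <= t ^+ 2.
    by rewrite -[t ^+ 2]real_normK ?num_real // lerXn2r ?nnegrE // ltW.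
  have Q : A_ n ^+ 2 = 4 * A_ n.+1 ^+ 2 by rewrite AS; ring.
  have K4 : 128 <= K / 4 by have := K512; lra.
  apply: (@le_trans _ _ (K / 4 * (1 - r) / A_ n.+1 ^+ 2)); last first.
    have aux (P : R) : P != 0 -> K / 4 * (1 - r) / P = K * (1 - r) / (4 * P).
      by move=> P0; field.
    by rewrite /C Q aux // gt_eqF // exprn_gt0.
  apply: (@le_trans _ _ (128 * (1 - r) / A_ n.+1 ^+ 2)); last first.
    rewrite ler_wpM2r ?invr_ge0 ?sqr_ge0 // ler_wpM2r //; case/andP: h; lra.
  apply: ler_wpM2l; first by apply: mulr_ge0; [lra|case/andP: h; lra].
  have t20 : 0 < t ^+ 2 by rewrite lt_def sqr_ge0 sqrf_eq0 tn0.
  by rewrite lef_pV2 ?posrE // exprn_gt0.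
rewrite -/C.
rewrite (@sint_split _ _ _ (- A_ n.+1) u _ (cu _ _)); last by apply/andP; split; lra.
rewrite (@sint_split _ (- A_ n.+1) _ (A_ n.+1) u _ (cu _ _)); last by apply/andP; split; lra.
rewrite (@sint_split _ (- A_ n) _ (- A_ n.+1) v _ (cv _ _)); last by apply/andP; split; lra.
rewrite (@sint_split _ (- A_ n.+1) _ (A_ n.+1) v _ (cv _ _)); last by apply/andP; split; lra.
have L : sint (- A_ n) (- A_ n.+1) u <= C * sint (- A_ n) (- A_ n.+1) v.
  by apply: side => t /andP[? ?]; rewrite ltr0_norm; [apply/andP; split|]; lra.
have M : sint (A_ n.+1) (A_ n) u <= C * sint (A_ n.+1) (A_ n) v.
  by apply: side => t /andP[? ?]; rewrite gtr0_norm; [apply/andP; split|]; lra.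
have N : 0 <= C * sint (- A_ n.+1) (A_ n.+1) v.
  by rewrite mulr_ge0 // sint_ge0 // => t _; exact: circ_excess_ge0.
rewrite !mulrDr; lra.
Qed.

(** By the assumption on averages, the annulus between [A_ n.+1] and [A_ n] costs at most (1 - r) s
    / (2 A_n) = (1 - r) s 2^n / (2 pi); the geometric sum of these costs is the factor 2^n - 1. *)
Let annuli r a s n : 0 <= r < 1 -> 0 < s -> 1 - r <= A_ n ->
  (forall l, 1 - r <= l <= pi -> 2 * K * sint (- l) l (fun t => circ_excess f s (a + t)) <= s * l) ->
  sint (- pi) pi (fun t => pker r t * circ_excess f s (a + t)) <=
  sint (- A_ n) (A_ n) (fun t => pker r t * circ_excess f s (a + t)) +
  (1 - r) * s / (2 * pi) * (2 ^+ n - 1).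
Proof.
move=> h s0 + H; elim: n => [|n IH] hn.
  by rewrite /A_ expr0 divr1 subrr mulr0 addr0.
have p0 := pi_gt0 R.
have hn' : 1 - r <= A_ n by rewrite A_S; have := A_gt0 n.+1; lra.
have r1 : 0 < 1 - r by case/andP: h; lra.
have P2 : (0 : R) < 2 ^+ n by rewrite exprn_gt0.
have Hn := H (A_ n); rewrite hn' A_le in Hn; have {}Hn := Hn isT.
have := annulus a s n h; have := IH hn'.
set I0 := sint (- pi) pi _; set I1 := sint (- A_ n) _ _; set I2 := sint (- A_ n.+1) _ _.
set J := sint (- A_ n) _ _ in Hn *.
have E : K * (1 - r) / A_ n ^+ 2 * J <= (1 - r) * s / (2 * pi) * 2 ^+ n.
  have -> : (1 - r) * s / (2 * pi) * 2 ^+ n = K * (1 - r) / A_ n ^+ 2 * (s * A_ n / (2 * K)).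
    have aux (P Q : R) : P != 0 -> Q != 0 ->
        (1 - r) * s / (2 * P) * Q = K * (1 - r) / (P / Q) ^+ 2 * (s * (P / Q) / (2 * K)).
      by move=> P0 Q0; field; rewrite P0 Q0 gt_eqF.
    by apply: aux; rewrite gt_eqF.
  apply: ler_wpM2l; last by rewrite ler_pdivlMr ?mulr_gt0 // mulrC.
  by apply: divr_ge0; [apply: mulr_ge0; exact: ltW|exact: sqr_ge0].
move=> B1 B2.
have -> : (1 - r) * s / (2 * pi) * (2 ^+ n.+1 - 1) =
   (1 - r) * s / (2 * pi) * (2 ^+ n - 1) + (1 - r) * s / (2 * pi) * 2 ^+ n.
  by rewrite exprS; ring.
by move: B1 B2 E; set X := _ * (2 ^+ n - 1); set Y := _ * 2 ^+ n; set Z := _ * J; lra.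
Qed.

(* If all averages of the excess at scales >= 1 - |z| were small, the decay of the Poisson
   kernel would make its Poisson integral small as well. *)
Lemma stopping_interval r a s : 0 <= r < 1 -> 0 < s ->
  s < Num.sqrt (cmod (f (r%:C%C * expi a))) ->
  exists2 l, 1 - r <= l <= pi & s * l < 2 * K * sint (a - l) (a + l) (circ_excess f s).
Proof.
move=> h s0 hs; have p0 := pi_gt0 R; case/andP: (h) => r0 r1.
have M := excess_mean_gt df h hs.
apply: contrapT => /forall2NP NH.
have H l : 1 - r <= l <= pi -> 2 * K * sint (- l) l (fun t => circ_excess f s (a + t)) <= s * l.
  move=> hl; have [//|/negP] := NH l; rewrite -leNgt.
  have -> : sint (a - l) (a + l) (circ_excess f s) =
            sint (- l) l (fun t => circ_excess f s (a + t)).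
    rewrite addrC (addrC a l) sint_shift; first by apply: eq_sint => t _; rewrite addrC.
      by case/andP: hl; lra.
    exact: circ_excess_continuous.
  by [].
have pi1 : 1 < pi :> R by have := pihalf_ge1 R; lra.
(* The last dyadic scale not below 1 - r; in particular [A_ n] < 2 (1 - r). *)
have [n hn1 hn2] : exists2 n, 1 - r <= A_ n & A_ n.+1 < 1 - r.
  have ex : exists n, A_ n < 1 - r.
    exists (Num.truncn (pi / (1 - r))).+1; rewrite /A_ ltr_pdivrMr ?exprn_gt0 //.
    rewrite mulrC -ltr_pdivrMr; last by lra.
    apply: lt_trans (truncnS_gt _) _.
    by rewrite -natrX ltr_nat ltn_expl.
  case: (ex_minnP ex) => -[|n]; first by rewrite /A_ expr0 divr1; lra.
  move=> hn min; exists n => //; rewrite leNgt; apply/negP => /min; by rewrite ltnn.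
have W := annuli h s0 hn1 H.
have r1' : 0 < 1 - r by lra.
have P2 : (0 : R) < 2 ^+ n by rewrite exprn_gt0.
(* The annuli cost at most s/2, since (1 - r) 2^n <= pi. The central arc costs at most s/256, from
   pker <= 2/(1 - r), [A_ n] < 2 (1 - r) and K >= 512. The total is below s <= pi s, against [M]. *)
have X : (1 - r) * s / (2 * pi) * (2 ^+ n - 1) <= s / 2.
  apply: (@le_trans _ _ (s / (2 * pi) * ((1 - r) * 2 ^+ n))).
    have -> : (1 - r) * s / (2 * pi) * (2 ^+ n - 1) =
      s / (2 * pi) * ((1 - r) * 2 ^+ n) - (1 - r) * s / (2 * pi) by ring.
    by rewrite gerBl divr_ge0 ?mulr_ge0 // ltW.
  have aux (P : R) : P != 0 -> s / 2 = s / (2 * P) * P by move=> P0; field.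
  rewrite (aux pi) ?gt_eqF //.
  apply: ler_wpM2l; last by rewrite -ler_pdivlMr.
  by rewrite divr_ge0 ?mulr_ge0 // ltW.
have Y : sint (- A_ n) (A_ n) (fun t => pker r t * circ_excess f s (a + t)) <= s / 256.
  apply: (@le_trans _ _ (2 / (1 - r) * sint (- A_ n) (A_ n) (fun t => circ_excess f s (a + t)))).
    rewrite -sint_scale; last by move=> t _; exact: cg.
    apply: le_sint => [t _|t _|t _]; first exact: cPg.
      by apply: cvgM; [exact: cvg_cst|exact: cg].
    by rewrite ler_wpM2r ?circ_excess_ge0 // pker_le.
  have Hn := H (A_ n); rewrite hn1 A_le in Hn; have {}Hn := Hn isT.
  rewrite mulrAC ler_pdivrMr //.
  have Q : s * A_ n <= s * (2 * (1 - r)) by rewrite ler_pM2l // A_S; lra.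
  move: Hn Q; set J := sint _ _ _ => Hn Q.
  have J0 : 0 <= J by apply: sint_ge0 => t _; exact: circ_excess_ge0.
  have KJ : 512 * J <= K * J by rewrite ler_wpM2r.
  by move: Hn Q KJ; rewrite -mulrA; move: (K * J) => KJ; lra.
have Z : s <= pi * s by rewrite ler_peMl ?ltW.
lra.
Qed.

End StoppingInterval.

(** * Vitali covering by stopping arcs *)

Section WeakType.
Variable R : realType.
Implicit Types (z xi : R[i]) (e d r t x a h s l : R).
Local Notation leb := (@lebesgue_measure R).

Lemma sintE a b (u : R -> R) : cont_seg a b u ->
  (sint a b u)%:E = (\int[leb]_(x in `[a, b]) (u x)%:E)%E.
Proof.
by move=> cu; rewrite /sint /Rintegral fineK //; apply: integrable_fin_num => //; exact: cont_seg_int.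
Qed.

Lemma lt_sqrtr s x : 0 <= s -> (s < Num.sqrt x) = (s ^+ 2 < x).
Proof.
move=> s0; have [x0|x0] := ltP 0 x.
  by rewrite -[X in X < _](ger0_norm s0) -sqrtr_sqr ltr_sqrt.
rewrite ler0_sqrtr // ltNge s0; apply/esym/negbTE; rewrite -leNgt.
exact: le_trans x0 (sqr_ge0 s).
Qed.

Variable f : R[i] -> R[i].
Hypothesis df : forall z, cmod z <= 1 -> cdiff f z.

Lemma pcont_cmod : pcont cdisc (fun p => cmod (f (toC p))).
Proof.
by apply: (@rcont_pcont _ cdisc (fun z => cmod (f z))) => p hp; apply/ccont_cmod/cdiff_cont/df.
Qed.

Definition superlevel s : set (R * R)%type :=
  cdisc `&` [set p | s < Num.sqrt (cmod (f (toC p)))].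

Lemma measurable_superlevel s : 0 <= s -> measurable (superlevel s).
Proof.
move=> s0; rewrite /superlevel.
have -> : cdisc `&` [set p | s < Num.sqrt (cmod (f (toC p)))] =
  cdisc `&` (fun p => cmod (f (toC p))) @^-1` `]s ^+ 2, +oo[.
  rewrite preimage_itvoy; by congr (_ `&` _); apply/seteqP; split => p /=; rewrite lt_sqrtr.
have mf := pcont_measurable (@measurable_cdisc R) pcont_cmod.
by apply: mf; [exact: measurable_cdisc|exact: measurable_itv].
Qed.

Variable K : R.
Hypothesis K512 : 512 <= K.

(** A point of the circle is replaced by a nearby point on its radius at which, by continuity, the
    square root still exceeds s; the stopping arc of a point of modulus r < 1 is available there,
    and r <= |p| keeps its half-length at least 1 - |p|. *)
Lemma superlevel_interval s p : 0 < s -> superlevel s p ->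
  exists i : R * R, [/\ 0 <= i.1 <= 2 * pi, 0 < i.2 <= pi, 1 - cmod (toC p) <= i.2,
    s * i.2 < 2 * K * sint (i.1 - i.2) (i.1 + i.2) (circ_excess f s) &
    toC p = (cmod (toC p))%:C%C * expi i.1].
Proof.
move=> s0 [p1 ps]; have [a ha E] := polar_pos (toC p).
have c1 : cmod (toC p) <= 1 by exact: p1.
have [r [r01 rp hr]] : exists r, [/\ 0 <= r < 1, r <= cmod (toC p) &
    s < Num.sqrt (cmod (f (r%:C%C * expi a)))].
  have [c2|c2] := ltP (cmod (toC p)) 1.
    by exists (cmod (toC p)); rewrite cmod_ge0 c2 -E.
  have e1 : cmod (toC p) = 1 by apply/eqP; rewrite eq_le c1 c2.
  have fs : s ^+ 2 < cmod (f (toC p)).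
    by move: ps; rewrite /= lt_sqrtr // ltW.
  have q : 0 < cmod (f (toC p)) - s ^+ 2 by rewrite subr_gt0.
  have [d d0 Hd] := ccont_cmod (cdiff_cont (df c1)) q.
  have d1 : 0 < Num.min (d / 2) (1 / 2) by rewrite lt_min; apply/andP; split; lra.
  have dm : Num.min (d / 2) (1 / 2) <= d / 2 by rewrite ge_min lexx.
  have dm2 : Num.min (d / 2) (1 / 2) <= 1 / 2 by rewrite ge_min lexx orbT.
  clear q; move: (Num.min _ _) d1 dm dm2 => q q0 q1 q2.
  exists (1 - q); split; [by apply/andP; split; lra|lra|].
  have /Hd : cmod ((1 - q)%:C%C * expi a - toC p) < d.
    rewrite E e1 -mulrBl cmodM cmod_expi mulr1 -rmorphB cmodr addrAC subrr add0r normrN.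
    by rewrite ger0_norm; lra.
  rewrite ltr_norml => /andP[A _].
  by rewrite lt_sqrtr; [lra|exact: ltW].
have [l /andP[l1 l2] hl] := stopping_interval df K512 r01 s0 hr.
case/andP: r01 => r0 r1.
by exists (a, l); split => //=; [apply/andP; split|]; lra.
Qed.

Let I := {i : R * R | 0 < i.2}.
Let B (i : I) := ball (val i).1 (val i).2.
Let J (i : I) : set R := `[(val i).1 - (val i).2, (val i).1 + (val i).2].

Let closure_B i : closure (B i) = J i.
Proof.
rewrite /B closure_ballE closed_ballE ?(valP i) //; apply/seteqP.
by split => x; rewrite /closed_ball_ /J /= in_itv /= ler_distlC.
Qed.

Let V s : set I := [set i | [/\ 0 <= (val i).1 <= 2 * pi, (val i).2 <= pi &
  s * (val i).2 < 2 * K * sint ((val i).1 - (val i).2) ((val i).1 + (val i).2) (circ_excess f s)]].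

(** Vitali gives the closed fivefold dilate, while both conditions of a window are strict: the
    factor 6 makes room for this. *)
Let W (i : I) := window (expi (val i).1) (6 * (val i).2).

(** If the arc of half-length l around a lies in the fivefold dilate of a selected arc of
    half-length m, then l <= 5 m. So 1 - |p| <= l bounds the depth of p as well, and one window
    contains the point. *)
Let vitali s : 0 < s -> exists D : set I, [/\ countable D, D `<=` V s, trivIset D J &
  superlevel s `<=` \bigcup_(i in D) W i].
Proof.
move=> s0.
have rad (i : I) : (radius (B i))%:num = (val i).2 by rewrite radius_ball_num // ltW // (valP i).
have ib (i : I) : is_ball (B i) by exact: is_ball_ball.
have r0 (i : I) : 0 < (radius (B i))%:num by rewrite rad (valP i).
have VB (i : I) : V s i -> (radius (B i))%:num <= pi by rewrite rad => -[].
have [D [cD DV tD cov]] := vitali_lemma_infinite ib r0 VB.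
exists D; split => //.
  by rewrite (_ : J = closure \o B) //; apply/funext => i /=; rewrite closure_B.
move=> p hp; have [[a l] [/= ha /andP[l0 lpi] hl hs E]] := superlevel_interval s0 hp.
pose i : I := Sub (a, l) l0.
have Vi : V s i by [].
have iE : val i = (a, l) by [].
clearbody i.
have [j [Dj _ _ hsub]] := cov i Vi; exists j => //.
have jl := valP j; rewrite /= in jl.
have bj x : a - l <= x <= a + l -> `|(val j).1 - x| <= 5 * (val j).2.
  move=> hx; have : closure (5%:R *` B j) x.
    by apply: hsub; rewrite closure_B /J iE /= in_itv.
  by rewrite /B /= (scale_ballE _ _ (ler0n _ 5)) closure_ballE closed_ballE ?mulr_gt0.
have b1 : `|(val j).1 - a| <= 5 * (val j).2 by apply: bj; apply/andP; split; lra.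
have b2 : `|(val j).1 - (a - l)| <= 5 * (val j).2 by apply: bj; apply/andP; split; lra.
have b3 : `|(val j).1 - (a + l)| <= 5 * (val j).2 by apply: bj; apply/andP; split; lra.
rewrite /W; move: {bj hsub} jl b1 b2 b3; case: (val j) => b m /= m0.
rewrite !ler_norml => /andP[? ?] /andP[? ?] /andP[? ?].
have p1 : cmod (toC p) <= 1 by case: hp.
split; first by rewrite p1 andbT; lra.
exists (a - b); first split.
  by apply/andP; split; lra.
rewrite {1}E expiD -mulrA; congr (_ * (_ * _)).
by apply: complex_ext; rewrite !cE ?cosN ?sinN.
Qed.

(** A window over a selected arc has size 6 l <= (12 K / s) times the integral of the excess over
    that arc. The smallness condition keeps this below H, so that the bound M applies; disjointness
    then lets the integrals add up. *)
Lemma weak_type (mu : {finite_measure set (R * R)%type -> \bar R}) s H M :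
  0 < s -> 0 < H <= 1 -> 0 <= M ->
  (forall xi t, cmod xi = 1 -> 0 < t <= H -> (mu (window xi t) <= (M * t)%:E)%E) ->
  24 * K * sint 0 (2 * pi) (circ_excess f s) <= s * H ->
  (mu (superlevel s) <= (M * (24 * K * sint 0 (2 * pi) (circ_excess f s) / s))%:E)%E.
Proof.
move=> s0 /andP[H0 H1] M0 HW; set G := sint _ _ _ => HG.
have K0 : 0 < K by have := K512; lra.
have p0 := pi_gt0 R.
have cg a b : cont_seg a b (circ_excess f s) by move=> t _; exact: circ_excess_continuous.
have g0 t : 0 <= circ_excess f s t by exact: circ_excess_ge0.
(* Centres in [0, 2 pi] and half-lengths up to pi place the arcs in two periods. They are disjoint
   on the line but may overlap on the circle, whence 24 = 2 * 12. *)
have G2 : sint (- pi) (3 * pi) (circ_excess f s) = 2 * G.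
  have per := circ_excess_period f s.
  have e1 := @sint_period R (- pi) (2 * pi) (circ_excess f s) (ltW (pi2_gt0 R))
    (@circ_excess_continuous R f df s) per.
  have e2 := @sint_period R pi (2 * pi) (circ_excess f s) (ltW (pi2_gt0 R))
    (@circ_excess_continuous R f df s) per.
  rewrite (@sint_split _ _ _ pi _ _ (cg _ _)); last by apply/andP; split; lra.
  have q1 : - pi + 2 * pi = pi :> R by ring.
  have q2 : pi + 2 * pi = 3 * pi :> R by ring.
  by rewrite q1 in e1; rewrite q2 in e2; rewrite e1 e2 /G; ring.
have mg : measurable_fun setT (fun x => (circ_excess f s x)%:E).
  apply/measurable_EFinP; apply: continuous_measurable_fun => x.
  exact: circ_excess_continuous.
have [D [cD DV tD cov]] := vitali s0.
have Jsub i : V s i -> J i `<=` `[- pi, 3 * pi].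
  move=> [/andP[a0 a2] lpi _] x; rewrite /J /= !in_itv /= => /andP[? ?].
  by apply/andP; split; lra.
have Jint i : V s i -> 6 * (val i).2 <= 12 * K / s * sint ((val i).1 - (val i).2) ((val i).1 + (val i).2) (circ_excess f s).
  move=> [_ _ h]; rewrite mulrAC ler_pdivlMr //; lra.
have Jle i : V s i -> sint ((val i).1 - (val i).2) ((val i).1 + (val i).2) (circ_excess f s) <= 2 * G.
  move=> Vi; rewrite -lee_fin -G2 !sintE //; apply: ge0_subset_integral => //.
  - exact: measurable_funTS.
  - by move=> x _; rewrite lee_fin.
  - exact: Jsub.
have small i : V s i -> 0 < 6 * (val i).2 <= H.
  move=> Vi; rewrite mulr_gt0 ?(valP i) //=; apply: le_trans (Jint i Vi) _.
  apply: (@le_trans _ _ (12 * K / s * (2 * G))).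
    by rewrite ler_pM2l ?Jle // divr_gt0 ?mulr_gt0.
  by rewrite mulrAC ler_pdivrMr // (mulrC H) (_ : 12 * K * (2 * G) = 24 * K * G) //; ring.
have muW i : V s i -> (mu (W i) <= (M * (12 * K / s))%:E * \int[leb]_(x in J i) (circ_excess f s x)%:E)%E.
  move=> Vi; apply: le_trans (HW _ _ (cmod_expi _) (small i Vi)) _.
  by rewrite /J -sintE // -EFinM lee_fin; apply: le_trans (ler_wpM2l M0 (Jint i Vi)) _; rewrite mulrA.
have mW i : V s i -> measurable (W i).
  move=> Vi; apply: measurable_window; first exact: cmod_expi.
  by have /andP[-> h] := small i Vi; rewrite (le_trans h).
(* The countable family is indexed by the naturals through the injection [c], with empty sets at the
   values not taken, to suit countable sums of measures and integrals. *)
have /countable_injP[c cinj] := cD.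
pose Jn n := \bigcup_(i in [set i | D i /\ c i = n]) J i.
pose Wn n := \bigcup_(i in [set i | D i /\ c i = n]) W i.
have case_n n : (exists i, [/\ V s i, Jn n = J i & Wn n = W i]) \/ (Jn n = set0 /\ Wn n = set0).
  have [[i [Di ci]]|ne] := pselect (exists i, D i /\ c i = n).
    left; exists i; have E : [set i | D i /\ c i = n] = [set i].
      apply/seteqP; split => [j [Dj cj]|j ->//].
      by apply: cinj; rewrite ?inE // cj.
    by rewrite /Jn /Wn E !bigcup_set1; split => //; exact: DV.
  right; have E : [set i | D i /\ c i = n] = set0.
    by apply/seteqP; split => // j hj; apply: ne; exists j.
  by rewrite /Jn /Wn E !bigcup_set0.
have mJn n : measurable (Jn n).
  by have [[i [_ -> _]]|[-> _]] := case_n n; [exact: measurable_itv|exact: measurable0].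
have mWn n : measurable (Wn n).
  by have [[i [Vi _ ->]]|[_ ->]] := case_n n; [exact: mW|exact: measurable0].
apply: (@le_trans _ _ (\sum_(n <oo) mu (Wn n))%E).
  apply: measure_sigma_subadditive => //; first by apply: measurable_superlevel; exact: ltW.
  move=> p /cov[i Di Wi]; exists (c i) => //; exists i => //.
apply: (@le_trans _ _ (\sum_(n <oo) ((M * (12 * K / s))%:E * \int[leb]_(x in Jn n) (circ_excess f s x)%:E))%E).
  apply: lee_nneseries => [n _ _|n _]; first exact: measure_ge0.
  by have [[i [Vi -> ->]]|[-> ->]] := case_n n; [exact: muW|rewrite measure0 integral_set0 mule0].
rewrite nneseriesZl; last by move=> n _; apply: integral_ge0 => x _; rewrite lee_fin.
rewrite -ge0_integral_bigcup //; last 3 first.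
- exact: measurable_funTS.
- by move=> x _; rewrite lee_fin.
- apply/trivIsetP => m n _ _ mn; apply/seteqP; split => // x [[i [Di ci] Ji] [j [Dj cj] Jj]].
  have ij : i = j by apply: tD => //; exists x.
  by move: mn; rewrite -ci -cj ij eqxx.
apply: (@le_trans _ _ ((M * (12 * K / s))%:E * (2 * G)%:E)%E).
  apply: lee_wpmul2l; first by rewrite lee_fin mulr_ge0 // ltW // divr_gt0 // mulr_gt0.
  rewrite -G2 sintE //; apply: ge0_subset_integral => //.
  - exact: bigcupT_measurable.
  - exact: measurable_funTS.
  - by move=> x _; rewrite lee_fin.
  - by move=> x [n _ [i [Di _]]]; apply: Jsub; exact: DV.
rewrite -EFinM lee_fin le_eqVlt; apply/orP; left; apply/eqP; field; by rewrite gt_eqF.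
Qed.

End WeakType.

(** * Orlicz functions *)

Section Orlicz.
Variables (R : realType) (Psi : R -> R).
Implicit Types (x y t : R).
Hypothesis oPsi : orlicz Psi.

Lemma orlicz_lt x y : 0 <= x -> x < y -> Psi x < Psi y.
Proof. by case: oPsi => _ _ h _ _; exact: h. Qed.

Lemma orlicz_le x y : 0 <= x -> x <= y -> Psi x <= Psi y.
Proof. by move=> x0; rewrite le_eqVlt => /predU1P[->//|/(orlicz_lt x0)/ltW]. Qed.

Lemma orlicz0 : Psi 0 = 0.
Proof. by case: oPsi. Qed.

Lemma orlicz_ge0 x : 0 <= x -> 0 <= Psi x.
Proof. by move=> x0; rewrite -orlicz0 orlicz_le. Qed.

Lemma orlicz_gt0 x : 0 < x -> 0 < Psi x.
Proof. by move=> x0; rewrite -{1}orlicz0 orlicz_lt. Qed.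

(** Convexity on the segment from 0 to x. The cases t = 0, t = 1 and x = 0 are separate because the
    convexity hypothesis is strict. *)
Lemma orlicz_scale t x : 0 <= t <= 1 -> 0 <= x -> Psi (t * x) <= t * Psi x.
Proof.
move=> /andP[]; rewrite le_eqVlt => /predU1P[<- _ _|t0]; first by rewrite !mul0r orlicz0.
rewrite le_eqVlt => /predU1P[->|t1]; first by rewrite !mul1r.
rewrite le_eqVlt => /predU1P[<-|x0]; first by rewrite mulr0 orlicz0 mulr0.
case: oPsi => _ _ _ cv _.
have := cv x 0 t (ltW x0) (lexx 0); rewrite gt_eqF // t0 t1 orlicz0 !mulr0 !addr0.
by move=> /(_ isT isT)/ltW.
Qed.

Lemma orlicz_inj x y : 0 <= x -> 0 <= y -> Psi x = Psi y -> x = y.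
Proof.
move=> x0 y0 E; apply/eqP; case: (ltgtP x y) => //.
- by move=> /(orlicz_lt x0); rewrite E ltxx.
- by move=> /(orlicz_lt y0); rewrite E ltxx.
Qed.

Lemma orlicz_cont x : 0 <= x -> forall e, 0 < e -> exists2 d, 0 < d &
  forall y, 0 <= y -> `|y - x| < d -> `|Psi y - Psi x| < e.
Proof.
move=> x0 e e0; case: oPsi => _ /subspace_continuousP cP _ _ _.
have := cP x; rewrite /= in_itv /= x0 => /(_ isT) /cvgrPdist_lt /(_ e e0).
rewrite /within /= => -[d /= d0 Hd]; exists d => // y y0 hy.
by rewrite distrC; apply: Hd; rewrite /= ?in_itv /= ?y0 // distrC.
Qed.

(** Superlinear growth gives some b >= 1 with Psi b >= (y + 1) b >= y; the intermediate value
    theorem applies on [0, b]. *)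
Lemma orlicz_surj y : 0 <= y -> exists2 x, 0 <= x & Psi x = y.
Proof.
move=> y0; case: (oPsi) => _ cP _ _ /cvgryPge /(_ (y + 1)) [M [_ HM]].
pose b := Num.max M 0 + 1.
have b0 : 1 <= b by rewrite /b lerDr le_max lexx orbT.
have bM : M < b.
  by rewrite /b; apply: le_lt_trans (_ : Num.max M 0 < _); rewrite ?le_max ?lexx // ltrDl.
have yb : y <= Psi b.
  have := HM b bM; rewrite ler_pdivlMr; last by lra.
  by nra.
have b00 : 0 <= b by lra.
have h1 : {within `[0, b], continuous Psi}.
  by apply: continuous_subspaceW cP => z /=; rewrite !in_itv /= => /andP[-> _].
have h2 : Num.min (Psi 0) (Psi b) <= y <= Num.max (Psi 0) (Psi b).
  by rewrite orlicz0 ge_min y0 le_max yb orbT.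
by have [c + <-] := IVT b00 h1 h2; rewrite in_itv /= => /andP[c0 _]; exists c.
Qed.

Lemma orlicz_invK y : 0 <= y -> 0 <= orlicz_inv Psi y /\ Psi (orlicz_inv Psi y) = y.
Proof.
move=> y0; rewrite /orlicz_inv; case: pselect => [P|[]].
  by have [] := projT2 (cid P).
by have [x x0 E] := orlicz_surj y0; exists x.
Qed.

Lemma orlicz_invP x : 0 <= x -> orlicz_inv Psi (Psi x) = x.
Proof.
move=> x0; have [i0 E] := orlicz_invK (orlicz_ge0 x0).
exact: orlicz_inj.
Qed.

Lemma orlicz_inv_gt0 y : 0 < y -> 0 < orlicz_inv Psi y.
Proof.
move=> y0; have [i0 E] := orlicz_invK (ltW y0).
by rewrite lt_def i0 andbT; apply/eqP => e0; move: E; rewrite e0 orlicz0; lra.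
Qed.

Lemma orlicz_comp_cont (u : R -> R) t : (forall s, 0 <= u s) -> {for t, continuous u} ->
  {for t, continuous (fun s => Psi (u s))}.
Proof.
move=> u0 cu; apply: continuous_eps => e e0.
have [d d0 Hd] := orlicz_cont (u0 t) e0.
move: cu => /cvgrPdist_lt /(_ d d0)[d' /= d'0 Hd']; exists d' => // s hs.
by apply: Hd => //; rewrite distrC; apply: Hd'; rewrite /= distrC.
Qed.

(** [Psi] is controlled on the half-line only; composed with the truncation it is monotone on the
    whole line, hence Borel. *)
Lemma orlicz_measurable : measurable_fun setT (fun x => Psi (Num.max x 0)).
Proof.
apply: nondecreasing_measurable => // x y xy; apply: orlicz_le.
  by rewrite le_max lexx orbT.
by rewrite ge_max le_max xy /= le_max lexx orbT.
Qed.

Lemma orlicz_comp_measurable d (T : measurableType d) (D : set T) (u : T -> R) :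
  (forall p, 0 <= u p) -> measurable_fun D u -> measurable_fun D (fun p => Psi (u p)).
Proof.
move=> u0 mu; rewrite (_ : (fun p => _) = (fun x => Psi (Num.max x 0)) \o u).
  exact: measurableT_comp orlicz_measurable mu.
by apply/funext => x /=; rewrite max_l.
Qed.

End Orlicz.

(** * Finite sums of integrals and dyadic sums *)

Section SintSum.
Variable R : realType.

Lemma cont_seg_sum (a b : R) n (F : nat -> R -> R) : (forall j, cont_seg a b (F j)) ->
  cont_seg a b (fun t => \sum_(j < n) F j t).
Proof.
move=> cF; elim: n => [|n IH].
  rewrite (_ : (fun t => _) = fun=> 0); first exact: cont_seg_cst.
  by apply/funext => t; rewrite big_ord0.
rewrite (_ : (fun t => _) = fun t => \sum_(j < n) F j t + F n t).
  exact: cont_seg_add.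
by apply/funext => t; rewrite big_ord_recr.
Qed.

Lemma sint_sum (a b : R) n (F : nat -> R -> R) : a <= b -> (forall j, cont_seg a b (F j)) ->
  sint a b (fun t => \sum_(j < n) F j t) = \sum_(j < n) sint a b (F j).
Proof.
move=> ab cF; elim: n => [|n IH].
  rewrite big_ord0 (@eq_sint _ _ _ _ (fun=> 0)) ?sint_cst ?mul0r // => t _.
  by rewrite big_ord0.
rewrite big_ord_recr /= -IH -sint_add //; last exact: cont_seg_sum.
by apply: eq_sint => t _; rewrite big_ord_recr.
Qed.

(** The powers before a term add up to at most that term, so the sum is at most twice its last
    nonzero term. *)
Lemma sum_pow2_lt (s0 y : R) n : 0 < s0 -> 0 <= y ->
  \sum_(j < n) (if s0 * 2 ^+ j < y then s0 * 2 ^+ j else 0) <= 2 * y.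
Proof.
move=> s00 y0.
have geo m : \sum_(j < m) s0 * 2 ^+ j <= s0 * 2 ^+ m.
  elim: m => [|m IH]; first by rewrite big_ord0 expr0 mulr1 ltW.
  by rewrite big_ord_recr /= exprS; lra.
elim: n => [|n IH]; first by rewrite big_ord0 mulr_ge0.
rewrite big_ord_recr /=; case: ifPn => [h|_]; last by rewrite addr0.
apply: (@le_trans _ _ (s0 * 2 ^+ n + s0 * 2 ^+ n)); last by lra.
rewrite lerD2r; apply: le_trans (geo n); apply: ler_sum => j _.
by case: ifP => // _; rewrite mulr_ge0 ?exprn_ge0 // ltW.
Qed.

End SintSum.

(** * The embedding for functions analytic across the circle *)

Section ExcessBounds.
Variable R : realType.
Implicit Types (z xi : R[i]) (e d r t x a h s l : R) (Psi : R -> R) (f : R[i] -> R[i]).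

Lemma K_mu_window (mu : {finite_measure set (R * R)%type -> \bar R}) H M :
  (K_mu mu H <= M%:E)%E ->
  forall xi t, cmod xi = 1 -> 0 < t <= H -> (mu (window xi t) <= (M * t)%:E)%E.
Proof.
move=> HK xi t x1 tH; have t0 : 0 < t by case/andP: tH.
apply: (@le_trans _ _ (rho_mu mu t)); first by apply: ereal_sup_ubound; exists xi.
rewrite EFinM -lee_pdivrMr //; apply: le_trans HK.
by apply: ereal_sup_ubound; exists t.
Qed.

(** The maximum over the circle passes to the disc through the Poisson integral. The bound leaves
    finitely many dyadic levels in the layer-cake sum. *)
Lemma sqrt_cmod_bounded f : (forall z, cmod z <= 1 -> cdiff f z) ->
  exists M, forall z, cmod z <= 1 -> Num.sqrt (cmod (f z)) <= M.
Proof.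
move=> df; have p0 := pi2_gt0 R.
have [c _ Hc] : exists2 c, c \in `[0, 2 * pi]%R &
    forall t, t \in `[0, 2 * pi]%R -> circ_sqrt f t <= circ_sqrt f c.
  apply: EVT_max; first exact: ltW.
  by apply: continuous_subspaceT => t; exact: circ_sqrt_continuous.
exists (circ_sqrt f c) => z z1.
have bnd t : circ_sqrt f t <= circ_sqrt f c.
  have [s sI E] := polar_pos (expi t); rewrite cmod_expi mul1r in E.
  by rewrite /circ_sqrt E; apply: (Hc s); rewrite in_itv.
have [a _ E] := polar_pos z.
have [c1|c1] := ltP (cmod z) 1; last first.
  have e1 : cmod z = 1 by apply/eqP; rewrite eq_le z1 c1.
  by rewrite E e1 mul1r; exact: bnd.
have h : 0 <= cmod z < 1 by rewrite cmod_ge0 c1.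
have := sub_mean a df h; rewrite -E => S.
rewrite -(ler_pM2l p0); apply: le_trans S _.
have cu t : {for t, continuous (fun x => circ_sqrt f (a + x))}.
  apply: (@continuous_comp _ _ _ (fun x => a + x) (circ_sqrt f)).
    by apply: cvgD; [exact: cvg_cst|exact: cvg_id].
  exact: circ_sqrt_continuous.
have -> : 2 * pi * circ_sqrt f c = sint 0 (2 * pi) (fun t => circ_sqrt f c * pker (cmod z) t).
  by rewrite sint_scale ?sint_pker 1?mulrC // => t _; exact: pker_continuous.
apply: le_sint => [t _|t _|t _].
- by apply: cvgM; [exact: pker_continuous|exact: cu].
- by apply: cvgM; [exact: cvg_cst|exact: pker_continuous].
- by rewrite mulrC ler_wpM2r ?bnd // ltW // pker_gt0.
Qed.

(** Chebyshev through convexity: where u > s/2, Psi (s^2/4) <= (s^2 / (4 u^2)) Psi (u^2), hence u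
    Psi (s^2/4) <= (s/2) Psi (u^2). It makes the integral of the excess small. *)
Lemma excess_le_orlicz Psi f s t : orlicz Psi -> 0 < s ->
  circ_excess f s t <= s / 2 / Psi (s ^+ 2 / 4) * Psi (cmod (f (expi t))).
Proof.
move=> oP s0; set v := cmod _.
have u0 : 0 <= circ_sqrt f t by exact: sqrtr_ge0.
have uv : circ_sqrt f t ^+ 2 = v by rewrite sqr_sqrtr ?cmod_ge0.
set u := circ_sqrt f t in u0 uv.
have s40 : 0 < s ^+ 2 / 4 by rewrite divr_gt0 ?exprn_gt0.
have P0 := orlicz_gt0 oP s40.
have Pv : 0 <= Psi v by apply: (orlicz_ge0 oP); exact: cmod_ge0.
rewrite /circ_excess -/u ge_max; apply/andP; split; last first.
  by rewrite mulr_ge0 // divr_ge0 // ?ltW // divr_gt0.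
have [us|us] := leP u (s / 2).
  apply: (@le_trans _ _ 0); first by lra.
  by rewrite mulr_ge0 // divr_ge0 // ?ltW // divr_gt0.
apply: (@le_trans _ _ u); first by lra.
have u1 : 0 < u by lra.
have v0 : 0 < v by rewrite -uv exprn_gt0.
have sv : s ^+ 2 / 4 <= v by rewrite -uv !expr2; nra.
have t01 : 0 <= s ^+ 2 / 4 / v <= 1.
  by apply/andP; split; [rewrite divr_ge0 // ltW|rewrite ler_pdivrMr // mul1r].
have := orlicz_scale oP t01 (ltW v0); rewrite divfK ?gt_eqF // => S.
rewrite mulrAC ler_pdivlMr //.
apply: (@le_trans _ _ (u * (s ^+ 2 / 4 / v * Psi v))); first by rewrite ler_pM2l.
have -> : u * (s ^+ 2 / 4 / v * Psi v) = s / 2 * Psi v * (s / 2 / u).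
  by rewrite -uv; field; rewrite gt_eqF.
by rewrite ler_piMr ?mulr_ge0 // ?divr_ge0 ?ltW // ltr_pdivrMr // mul1r.
Qed.

(** Convexity between 0 and v = u^2 bounds the left side by s Psi v / (4 C u). This is linear in s,
    and the excess vanishes for s >= 2u, so that the sum over dyadic s is geometric. *)
Lemma orlicz_excess_le Psi f s t C : orlicz Psi -> 0 < s -> 1 <= C ->
  Psi (s ^+ 2 / (4 * C)) / s * circ_excess f s t <=
  (if s < 2 * circ_sqrt f t then s else 0) *
  (Psi (cmod (f (expi t))) / (4 * circ_sqrt f t)).
Proof.
move=> oP s0 C1; set v := cmod _.
have u0 : 0 <= circ_sqrt f t by exact: sqrtr_ge0.
have uv : circ_sqrt f t ^+ 2 = v by rewrite sqr_sqrtr ?cmod_ge0.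
rewrite /circ_excess; set u := circ_sqrt f t in u0 uv *.
case: ifPn => [su|]; last first.
  by rewrite -leNgt => su; rewrite max_r ?mul0r ?mulr0 //; lra.
have u1 : 0 < u by lra.
have v0 : 0 < v by rewrite -uv exprn_gt0.
have s20 : 0 < s ^+ 2 by rewrite exprn_gt0.
have C0 : 0 < C by lra.
have Pv : 0 <= Psi v by apply: (orlicz_ge0 oP); exact: ltW.
have sv : s ^+ 2 <= 4 * v by rewrite -uv !expr2; nra.
have t01 : 0 <= s ^+ 2 / (4 * C) / v <= 1.
  apply/andP; split; first by rewrite !divr_ge0 ?mulr_ge0 // ltW.
  by rewrite ler_pdivrMr // mul1r ler_pdivrMr ?mulr_gt0 //; nra.
have := orlicz_scale oP t01 (ltW v0); rewrite divfK ?gt_eqF // => S.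
have P0 : 0 <= Psi (s ^+ 2 / (4 * C)).
  by apply: (orlicz_ge0 oP); rewrite divr_ge0 ?mulr_ge0 // ltW.
apply: (@le_trans _ _ (Psi (s ^+ 2 / (4 * C)) / s * u)).
  apply: ler_wpM2l; first by rewrite divr_ge0 // ltW.
  by rewrite ge_max u0 andbT; lra.
apply: (@le_trans _ _ (s ^+ 2 / (4 * C) / v * Psi v / s * u)).
  by rewrite ler_wpM2r // ler_wpM2r ?invr_ge0 // ltW.
have -> : s ^+ 2 / (4 * C) / v * Psi v / s * u = s * (Psi v / (4 * u)) / C.
  by rewrite -uv; field; rewrite !gt_eqF.
by rewrite ler_pdivrMr // ler_peMr // mulr_ge0 ?divr_ge0 ?mulr_ge0 // ltW.
Qed.

End ExcessBounds.

(** * Summation over dyadic levels *)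

Section LayerCake.
Variable R : realType.
Implicit Types (z xi : R[i]) (e d r t x a h s l : R) (f : R[i] -> R[i]).
Variables (mu : {finite_measure set (R * R)%type -> \bar R}) (Psi1 Psi2 : R -> R) (A : R).
Hypotheses (o1 : orlicz Psi1) (o2 : orlicz Psi2) (A0 : 0 < A).
Hypothesis HK : forall h, 0 < h <= 1 ->
  (K_mu mu h <= (h^-1 / Psi2 (A * orlicz_inv Psi1 h^-1))%:E)%E.
Variables (K C : R).
(** 96 = 24 * 4, where 24 K is the constant of [weak_type] and 4 bounds pi: the smallness condition
    there amounts to 24 K pi <= C. *)
Hypotheses (K512 : 512 <= K) (CK : 96 * K <= C).

Let K0 : 0 < K. Proof. by have := K512; lra. Qed.
Let C1 : 1 <= C. Proof. by have := CK; have := K512; lra. Qed.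
Let C0 : 0 < C. Proof. by have := C1; lra. Qed.

Section FixedFunction.
Variable f : R[i] -> R[i].
Hypothesis df : forall z, cmod z <= 1 -> cdiff f z.
Hypothesis fle : sint 0 (2 * pi) (fun t => Psi1 (cmod (f (expi t)))) <= 2 * pi.

Let cP t : {for t, continuous (fun t => Psi1 (cmod (f (expi t))))}.
Proof.
apply: (orlicz_comp_cont o1); first by move=> s; exact: cmod_ge0.
rewrite (_ : (fun s => _) = fun s => cmod (f (1 * expi s))).
  apply: (@rcont_circle _ (fun w => cmod (f w))); apply/ccont_cmod/cdiff_cont/df.
  by rewrite mul1r cmod_expi.
by apply/funext => s; rewrite mul1r.
Qed.

Let cg s t : {for t, continuous (circ_excess f s)}.
Proof. exact: circ_excess_continuous. Qed.

(** [weak_type] is applied with H = 1 / Psi1 x for x = s^2/(4C); then Psi1^-1(1/H) = x, and [HK] at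
    H reads K_mu(H) <= Psi1 x / Psi2 (A x). The condition 1 <= Psi1 x is H <= 1. *)
Lemma superlevel_measure s : 0 < s -> 1 <= Psi1 (s ^+ 2 / (4 * C)) ->
  (mu (superlevel f s) <= (Psi1 (s ^+ 2 / (4 * C)) / Psi2 (A * (s ^+ 2 / (4 * C))) *
    (24 * K * sint 0 (2 * pi) (circ_excess f s) / s))%:E)%E.
Proof.
move=> s0; set x := s ^+ 2 / (4 * C) => x1.
have x0 : 0 <= x by rewrite divr_ge0 ?sqr_ge0 // mulr_ge0 // ltW.
have P0 : 0 < Psi1 x by lra.
have xx : 0 < x.
  by rewrite lt_def x0 andbT; apply/eqP => xe; move: x1; rewrite xe (orlicz0 o1); lra.
have H01 : 0 < (Psi1 x)^-1 <= 1 by rewrite invr_gt0 P0 invf_le1.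
have := HK H01; rewrite invrK (orlicz_invP o1) // => HM.
have Q0 : 0 < Psi2 (A * x) by apply: (orlicz_gt0 o2); rewrite mulr_gt0.
apply: (weak_type df K512 s0 H01); first by rewrite divr_ge0 // ltW.
  exact: K_mu_window.
have pi4 : pi <= 4 :> R by have := pihalf_lt2 R; lra.
have p0 := pi_gt0 R.
set G := sint _ _ _.
have s40 : 0 < s ^+ 2 / 4 by rewrite divr_gt0 ?exprn_gt0.
have P4 := orlicz_gt0 o1 s40.
have G1 : G <= s / 2 / Psi1 (s ^+ 2 / 4) * (2 * pi).
  apply: (@le_trans _ _ (sint 0 (2 * pi)
    (fun t => s / 2 / Psi1 (s ^+ 2 / 4) * Psi1 (cmod (f (expi t)))))).
    apply: le_sint => [t _|t _|t _]; first exact: cg.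
      by apply: cvgM; [exact: cvg_cst|exact: cP].
    exact: excess_le_orlicz.
  rewrite sint_scale; last by move=> t _; exact: cP.
  by rewrite ler_pM2l // !divr_gt0.
have S : Psi1 x <= C^-1 * Psi1 (s ^+ 2 / 4).
  have -> : x = C^-1 * (s ^+ 2 / 4) by rewrite /x; field; rewrite gt_eqF.
  apply: (orlicz_scale o1); last exact: ltW.
  by rewrite invr_ge0 ltW //= invf_le1.
apply: (@le_trans _ _ (24 * K * (s / 2 / Psi1 (s ^+ 2 / 4) * (2 * pi)))).
  by rewrite ler_pM2l // mulr_gt0.
rewrite ler_pdivlMr //.
apply: (@le_trans _ _ (24 * K * (s / 2 / Psi1 (s ^+ 2 / 4) * (2 * pi)) * (C^-1 * Psi1 (s ^+ 2 / 4)))).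
  apply: ler_wpM2l => //; apply: mulr_ge0; first by rewrite mulr_ge0 // ltW.
  apply: mulr_ge0; last by rewrite mulr_ge0 // ltW.
  by apply: divr_ge0; [apply: divr_ge0 => //|]; exact: ltW.
have aux (P y : R) : P != 0 -> 24 * K * (s / 2 / P * (2 * y)) * (C^-1 * P) = s * (24 * K * y / C).
  by move=> Pn; field; rewrite Pn gt_eqF.
rewrite aux ?gt_eqF // ger_pMr // ler_pdivrMr // mul1r.
apply: le_trans CK; have -> : 96 * K = 24 * K * 4 by ring.
by rewrite ler_pM2l // mulr_gt0.
Qed.

(** Sum and integral are exchanged. At each t the sum of the levels below 2u is at most 4u, which
    cancels the 4u in the denominator of [orlicz_excess_le] and leaves Psi1 (|f|). *)
Lemma level_sum s0 n : 0 < s0 ->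
  \sum_(j < n) Psi1 ((s0 * 2 ^+ j) ^+ 2 / (4 * C)) / (s0 * 2 ^+ j) *
     sint 0 (2 * pi) (circ_excess f (s0 * 2 ^+ j)) <= 2 * pi.
Proof.
move=> s00; have sj j : 0 < s0 * 2 ^+ j by rewrite mulr_gt0 ?exprn_gt0.
have p0 := pi2_gt0 R.
apply: le_trans fle.
have cF j : cont_seg 0 (2 * pi) (fun t => Psi1 ((s0 * 2 ^+ j) ^+ 2 / (4 * C)) / (s0 * 2 ^+ j) *
   circ_excess f (s0 * 2 ^+ j) t).
  by move=> t _; apply: cvgM; [exact: cvg_cst|exact: cg].
pose F j t := Psi1 ((s0 * 2 ^+ j) ^+ 2 / (4 * C)) / (s0 * 2 ^+ j) *
   circ_excess f (s0 * 2 ^+ j) t.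
rewrite (eq_bigr (fun j : 'I_n => sint 0 (2 * pi) (F j))); last first.
  by move=> j _; rewrite /F sint_scale // => t _; exact: cg.
rewrite -(sint_sum _ (ltW p0) cF).
apply: le_sint => [||t _]; first exact: (@cont_seg_sum R 0 (2 * pi) n F cF).
  by move=> t _; exact: cP.
apply: (@le_trans _ _ (\sum_(j < n) (if s0 * 2 ^+ j < 2 * circ_sqrt f t then s0 * 2 ^+ j else 0) *
    (Psi1 (cmod (f (expi t))) / (4 * circ_sqrt f t)))).
  by apply: ler_sum => j _; exact: orlicz_excess_le.
rewrite -mulr_suml.
have u0 : 0 <= circ_sqrt f t by exact: sqrtr_ge0.
have v0 : 0 <= Psi1 (cmod (f (expi t))) by apply: (orlicz_ge0 o1); exact: cmod_ge0.
have := sum_pow2_lt n s00 (mulr_ge0 (ler0n R 2) u0) => L.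
apply: le_trans (ler_wpM2r _ L) _; first by rewrite divr_ge0 ?mulr_ge0.
move: u0; rewrite le_eqVlt => /predU1P[<-|u1]; first by rewrite !mulr0 mul0r.
rewrite le_eqVlt; apply/orP; left; apply/eqP; field; by rewrite gt_eqF.
Qed.

(** Only the highest level s below sqrt x matters: there x <= (2 s)^2, and the single term Psi2 (4
    s^2 / B) dominates. *)
Lemma layer_cake B s0 n x : 0 < B -> 0 < s0 -> 0 <= x -> x <= (s0 * 2 ^+ n) ^+ 2 ->
  Psi2 (x / B) <= Psi2 (s0 ^+ 2 / B) +
    \sum_(j < n) Psi2 (4 * (s0 * 2 ^+ j) ^+ 2 / B) * ((s0 * 2 ^+ j < Num.sqrt x)%R)%:R.
Proof.
move=> B0 s00 x0; elim: n => [|n IH] hx.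
  rewrite big_ord0 addr0; apply: (orlicz_le o2); first by rewrite divr_ge0 // ltW.
  by rewrite ler_pM2r ?invr_gt0 //; move: hx; rewrite expr0 mulr1.
have sj j : 0 < s0 * 2 ^+ j by rewrite mulr_gt0 ?exprn_gt0.
have P0 j : 0 <= Psi2 (4 * (s0 * 2 ^+ j) ^+ 2 / B).
  by apply: (orlicz_ge0 o2); rewrite divr_ge0 ?mulr_ge0 ?sqr_ge0 // ltW.
rewrite big_ord_recr /= lt_sqrtr; last exact: ltW.
have [xl|xl] := leP x ((s0 * 2 ^+ n) ^+ 2).
  by rewrite mulr0 addr0; exact: IH.
rewrite mulr1; apply: (@le_trans _ _ (Psi2 (4 * (s0 * 2 ^+ n) ^+ 2 / B))).
  apply: (orlicz_le o2); first by rewrite divr_ge0 // ltW.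
  rewrite ler_pM2r ?invr_gt0 //; apply: le_trans hx _.
  by rewrite [2 ^+ n.+1]exprS le_eqVlt; apply/orP; left; apply/eqP; ring.
rewrite addrA lerDr addr_ge0 ?sumr_ge0 //.
  by apply: (orlicz_ge0 o2); rewrite divr_ge0 ?sqr_ge0 // ltW.
by move=> j _; rewrite mulr_ge0.
Qed.

(** The part with |f| <= s0^2 gives the term with [mu cdisc]. From s0 on, Psi1 (s^2/(4C)) >= 1, so
    [superlevel_measure] holds at every level, and [level_sum] bounds the total by 2 pi. *)
Lemma integral_le B s0 : 0 < B -> 0 < s0 -> 4 * (4 * C) <= A * B ->
  1 <= Psi1 (s0 ^+ 2 / (4 * C)) ->
  (\int[mu]_(p in cdisc) (Psi2 (cmod (f (toC p)) / B))%:E <=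
    (Psi2 (s0 ^+ 2 / B))%:E * mu cdisc + (4 * (4 * C) / (A * B) * (24 * K) * (2 * pi))%:E)%E.
Proof.
move=> B0 s00 hB hs.
have [M HM] := sqrt_cmod_bounded df.
have [n Hn] : exists n : nat, M <= s0 * 2 ^+ n.
  exists (Num.truncn (M / s0)).+1; rewrite mulrC -ler_pdivrMr //.
  apply/ltW/(lt_trans (truncnS_gt _)).
  by rewrite -natrX ltr_nat ltn_expl.
pose s j := s0 * 2 ^+ j; have sj j : 0 < s j by rewrite mulr_gt0 ?exprn_gt0.
pose b j := Psi2 (4 * s j ^+ 2 / B).
have b0 j : 0 <= b j.
  by apply: (orlicz_ge0 o2); rewrite divr_ge0 ?mulr_ge0 ?sqr_ge0 // ltW.
have d0 : 0 <= Psi2 (s0 ^+ 2 / B).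
  by apply: (orlicz_ge0 o2); rewrite divr_ge0 ?sqr_ge0 // ltW.
have mE j : measurable (superlevel f (s j)) by apply: measurable_superlevel => //; exact: ltW.
have mD := @measurable_cdisc R.
have mf : measurable_fun cdisc (fun p => Psi2 (cmod (f (toC p)) / B)).
  apply: (orlicz_comp_measurable o2); first by move=> p; rewrite divr_ge0 ?cmod_ge0 // ltW.
  apply: measurable_funM; last exact: measurable_cst.
  by apply: (pcont_measurable mD); exact: pcont_cmod.
apply: (@le_trans _ _ (\int[mu]_(p in cdisc) ((Psi2 (s0 ^+ 2 / B))%:E +
    \sum_(j < n) ((b j)%:E * (\1_(superlevel f (s j)) p)%:E)))%E).
  apply: ge0_le_integral => //.
  - by move=> p _; rewrite lee_fin; apply: (orlicz_ge0 o2); rewrite divr_ge0 ?cmod_ge0 // ltW.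
  - exact/measurable_EFinP.
  - apply: emeasurable_funD; first exact: measurable_cst.
    apply: emeasurable_sum => j; apply: emeasurable_funM; first exact: measurable_cst.
    by apply/measurable_EFinP; exact: measurable_indic.
  - move=> p hp.
    under eq_bigr do rewrite -EFinM.
    rewrite sumEFin -EFinD lee_fin.
    have hx : cmod (f (toC p)) <= (s0 * 2 ^+ n) ^+ 2.
      have h := le_trans (HM _ hp) Hn.
      rewrite -[leLHS]sqr_sqrtr ?cmod_ge0 // lerXn2r ?nnegrE ?sqrtr_ge0 //.
      exact: (ltW (sj n)).
    apply: le_trans (layer_cake B0 s00 (cmod_ge0 _) hx) _.
    rewrite lerD2l; apply: ler_sum => j _; apply: (ler_wpM2l (b0 j)).
    rewrite indicE; case hh : (s0 * 2 ^+ j < _); last by rewrite ler0n.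
    by rewrite (_ : p \in superlevel f (s j)) // inE; split.
rewrite ge0_integralD //; last 2 first.
- by move=> p _; apply: sume_ge0 => j _; rewrite mule_ge0 // lee_fin.
- apply: emeasurable_sum => j; apply: emeasurable_funM; first exact: measurable_cst.
  by apply/measurable_EFinP; exact: measurable_indic.
rewrite integral_cst // leeD2l //.
rewrite ge0_integral_sum //; last 2 first.
- move=> j; apply: emeasurable_funM; first exact: measurable_cst.
  by apply/measurable_EFinP; exact: measurable_indic.
- by move=> j p _; rewrite mule_ge0 // lee_fin.
apply: (@le_trans _ _ (\sum_(j < n) ((4 * (4 * C) / (A * B) * (24 * K)) *
   (Psi1 (s j ^+ 2 / (4 * C)) / s j * sint 0 (2 * pi) (circ_excess f (s j))))%:E)%E); last first.
  rewrite sumEFin lee_fin -mulr_sumr; apply: ler_wpM2l; last exact: level_sum.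
  apply: mulr_ge0; last by rewrite mulr_ge0 // ltW.
  by apply: divr_ge0; [apply: mulr_ge0 => //; rewrite mulr_ge0 // ltW|exact/ltW/mulr_gt0].
apply: lee_sum => j _.
have m1 : measurable_fun cdisc (fun p => (\1_(superlevel f (s j)) p)%:E : \bar R).
  by apply/measurable_EFinP; exact: measurable_indic.
have bj0 : (0 <= (b j)%:E)%E by rewrite lee_fin.
rewrite (ge0_integralZl mu mD m1 _ bj0) //.
rewrite integral_indic // (_ : _ `&` cdisc = superlevel f (s j)); last first.
  by apply/seteqP; split => p [] // [].
set x := s j ^+ 2 / (4 * C).
have x1 : 1 <= Psi1 x.
  apply: le_trans hs _; apply: (orlicz_le o1).
    by rewrite divr_ge0 ?sqr_ge0 // mulr_ge0 // ltW.
  have ss : s0 <= s j by rewrite /s ler_peMr ?(ltW s00) // exprn_ege1 // ler1n.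
  rewrite ler_pM2r ?invr_gt0 ?mulr_gt0 // lerXn2r ?nnegrE ?(ltW s00) //.
  exact: ltW.
have P0 : 0 < Psi1 x by lra.
have x0 : 0 < x by rewrite divr_gt0 ?exprn_gt0 // mulr_gt0.
have Q0 : 0 < Psi2 (A * x) by apply: (orlicz_gt0 o2); rewrite mulr_gt0.
apply: le_trans (lee_wpmul2l bj0 (superlevel_measure (sj j) x1)) _.
rewrite -EFinM lee_fin -/x.
(* Convexity, with 4 s^2 / B written as the multiple 16 C / (A B) <= 1 of A x: the factor Psi2 (A x)
   then cancels the denominator in the measure of the superlevel set. *)
have bj : b j <= 4 * (4 * C) / (A * B) * Psi2 (A * x).
  have -> : b j = Psi2 (4 * (4 * C) / (A * B) * (A * x)).
    by rewrite /b /x; congr Psi2; field; rewrite !gt_eqF.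
  apply: (orlicz_scale o2); last exact/ltW/mulr_gt0.
  apply/andP; split; last by rewrite ler_pdivrMr ?mulr_gt0 // mul1r.
  by apply: divr_ge0; [apply: mulr_ge0 => //; rewrite mulr_ge0 // ltW|exact/ltW/mulr_gt0].
set G := sint _ _ _.
have G0 : 0 <= G by apply: sint_ge0 => t _; exact: circ_excess_ge0.
have W0 : 0 <= Psi1 x / Psi2 (A * x) * (24 * K * G / s j).
  apply: mulr_ge0; apply: divr_ge0; try exact: ltW.
  by apply: mulr_ge0 => //; rewrite mulr_ge0 // ltW.
apply: le_trans (ler_wpM2r W0 bj) _.
rewrite le_eqVlt; apply/orP; left; apply/eqP; field.
by rewrite !gt_eqF.
Qed.

End FixedFunction.

End LayerCake.

Section CoreEmbedding.
Variable R : realType.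
Implicit Types (z xi : R[i]) (e d r t x a h s l : R) (f : R[i] -> R[i]).

Lemma core_embedding (mu : {finite_measure set (R * R)%type -> \bar R}) Psi1 Psi2 A :
  orlicz Psi1 -> orlicz Psi2 -> 0 < A ->
  (forall h, 0 < h <= 1 ->
     (K_mu mu h <= (h^-1 / Psi2 (A * orlicz_inv Psi1 h^-1))%:E)%E) ->
  exists2 B, 0 < B & forall f, (forall z, cmod z <= 1 -> cdiff f z) ->
    sint 0 (2 * pi) (fun t => Psi1 (cmod (f (expi t)))) <= 2 * pi ->
    (\int[mu]_(p in cdisc) (Psi2 (cmod (f (toC p)) / B))%:E <= 1)%E.
Proof.
move=> o1 o2 A0 HK.
have [K K512] : exists K : R, 512 <= K by exists 512.
have K0 : 0 < K by lra.
have [C CK] : exists C : R, 96 * K <= C by exists (96 * K).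
have C0 : 0 < C by lra.
have [x0 Px0] := orlicz_invK o1 (@ler01 R).
move: (orlicz_inv Psi1 1) x0 Px0 => x x0 Px.
have xx : 0 < x by rewrite lt_def x0 andbT; apply/eqP => xe; move: Px; rewrite xe (orlicz0 o1); lra.
(* Here x = Psi1^-1(1), so that s0^2/(4C) = x and the lowest level corresponds to H = 1. *)
pose s0 := Num.sqrt (4 * C * x).
have s0x : s0 ^+ 2 = 4 * C * x by rewrite sqr_sqrtr // !mulr_ge0 // ltW.
have s00 : 0 < s0 by rewrite sqrtr_gt0 !mulr_gt0.
have P2 : 0 <= Psi2 (s0 ^+ 2) by apply: (orlicz_ge0 o2); exact: sqr_ge0.
pose m := fine (mu cdisc).
have mE : mu cdisc = m%:E by rewrite /m fineK // fin_num_measure //; exact: measurable_cdisc.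
have m0 : 0 <= m by rewrite fine_ge0.
pose T := 4 * (4 * C) * (24 * K) * (2 * pi) / A.
have p0 := pi2_gt0 R.
have T0 : 0 < T by rewrite /T divr_gt0 // !mulr_gt0 // pi_gt0.
pose S := 4 * (4 * C) / A.
have S0 : 0 < S by rewrite /S divr_gt0 // !mulr_gt0.
have Pm : 0 <= Psi2 (s0 ^+ 2) * m by rewrite mulr_ge0.
(* 1 gives B >= 1 and with it Psi2 (s0^2 / B) <= Psi2 (s0^2) / B; S gives 16 C <= A B; the other two
   terms bring the final quotient below 1. *)
pose B := 1 + Psi2 (s0 ^+ 2) * m + T + S.
have B1 : 1 <= B by rewrite /B; lra.
have B0 : 0 < B by lra.
exists B => // f df fle.
have hB : 4 * (4 * C) <= A * B.
  rewrite [leRHS]mulrC -ler_pdivrMr //; rewrite -/S /B; lra.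
have hs : 1 <= Psi1 (s0 ^+ 2 / (4 * C)).
  rewrite s0x mulrAC divff ?mul1r ?Px ?lexx // gt_eqF // mulr_gt0 //.
apply: le_trans (integral_le o1 o2 A0 HK K512 CK df fle B0 s00 hB hs) _.
rewrite mE -EFinM -EFinD lee_fin.
have L : Psi2 (s0 ^+ 2 / B) <= Psi2 (s0 ^+ 2) / B.
  rewrite [X in Psi2 X]mulrC [leRHS]mulrC; apply: (orlicz_scale o2); last exact: sqr_ge0.
  by rewrite invr_ge0 ltW //= invf_le1.
apply: (@le_trans _ _ ((Psi2 (s0 ^+ 2) * m + T) / B)).
  rewrite [leRHS]mulrDl; apply: lerD; first by rewrite [leRHS]mulrAC; apply: ler_wpM2r.
  rewrite le_eqVlt; apply/orP; left; apply/eqP; rewrite /T.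
  have aux (y : R) : 4 * (4 * C) / (A * B) * (24 * K) * y = 4 * (4 * C) * (24 * K) * y / A / B.
    by field; rewrite !gt_eqF.
  exact: aux.
by rewrite ler_pdivrMr // mul1r /B; lra.
Qed.

(** The strict inequality yields an admissible D < C in the infimum of the Luxemburg norm, and
    monotonicity passes from D to C. *)
Lemma hardy_circle Psi f C r : orlicz Psi -> analytic_disc f -> 0 < C ->
  (hardy_norm Psi f < C%:E)%E -> 0 <= r < 1 ->
  sint 0 (2 * pi) (fun t => Psi (cmod (f (r%:C%C * expi t)) / C)) <= 2 * pi.
Proof.
move=> oP fa C0 fC r01; have p0 := pi2_gt0 R.
have cc D t : 0 < D -> {for t, continuous (fun t => Psi (cmod (f (r%:C%C * expi t)) / D))}.
  move=> D0; apply: (orlicz_comp_cont oP).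
    by move=> s; rewrite divr_ge0 ?cmod_ge0 // ltW.
  apply: cvgM; last exact: cvg_cst.
  apply: (@rcont_circle _ (fun w => cmod (f w))); apply/ccont_cmod/cdiff_cont/analytic_cdiff => //.
  by rewrite cmodM cmod_expi mulr1 cmodr; case/andP: r01 => r0 r1; rewrite ger0_norm.
have : (luxemburg_circle Psi (fun t => cmod (f (r%:C%C * expi t)%R)) < C%:E)%E.
  by apply: le_lt_trans fC; apply: ereal_sup_ubound; exists r.
move=> /ereal_inf_lt[_ [D [D0 HD] <-]]; rewrite lte_fin => DC.
have {}HD : sint 0 (2 * pi) (fun t => Psi (cmod (f (r%:C%C * expi t)) / D)) <= 2 * pi.
  move: HD; rewrite (_ : (\int[_]_(t in _) _)%E =
      (sint 0 (2 * pi) (fun t => Psi (cmod (f (r%:C%C * expi t)) / D)))%:E).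
    by rewrite -EFinM lee_fin mulrC ler_pdivrMr // mul1r.
  rewrite sintE; last by move=> t _; exact: cc.
  by apply: eq_integral => t _; rewrite ger0_norm ?cmod_ge0.
apply: le_trans HD; apply: le_sint => [t _|t _|t _]; [exact: cc|exact: cc|].
apply: (orlicz_le oP); first by rewrite divr_ge0 ?cmod_ge0 // ltW.
by rewrite ler_wpM2l ?cmod_ge0 // lef_pV2 ?posrE // ltW.
Qed.

End CoreEmbedding.

(** * Radial limits and the general case *)

Section RadialLimit.
Variable R : realType.
Implicit Types (z xi : R[i]) (e d r t x a h s : R).
Variable f : R[i] -> R[i].
Hypothesis fa : analytic_disc f.

Definition rseq n : R := 1 - n.+2%:R^-1.

Lemma rseq01 n : 0 <= rseq n < 1.
Proof.
rewrite /rseq subr_ge0 invf_le1 ?ltr0n // ler1n /=.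
by rewrite ltrBlDr ltrDl invr_gt0 ltr0n.
Qed.

Lemma rseq_gt d : 0 < d -> exists N, forall n, (N <= n)%N -> 1 - d < rseq n.
Proof.
move=> d0; exists (Num.truncn d^-1).+1 => n hn; rewrite /rseq ltrD2l ltrN2.
rewrite -[d]invrK ltf_pV2 ?posrE ?invr_gt0 ?ltr0n //.
apply: lt_le_trans (truncnS_gt _) _; rewrite ler_nat; exact: leq_trans hn (leq_addl 2 n).
Qed.

(** The condition speaks of values of f inside the disc only. The final inequality is not strict, so
    that its failure is an open condition on z. *)
Definition radial_cauchy z := forall e, 0 < e -> exists2 d, 0 < d & forall r r',
  0 <= r < 1 -> 0 <= r' < 1 -> 1 - d < r -> 1 - d < r' ->
  cmod (f (r%:C%C * z) - f (r'%:C%C * z)) <= e.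

Definition seq_cvg (u : nat -> R[i]) (l : R[i]) := forall e, 0 < e ->
  exists N, forall n, (N <= n)%N -> cmod (u n - l) < e.

Lemma radial_cauchy_cvg z : radial_cauchy z ->
  exists l, seq_cvg (fun n => f ((rseq n)%:C%C * z)) l.
Proof.
move=> cz.
have cau (g : R[i] -> R) : (forall w w', `|g w - g w'| <= cmod (w - w')) ->
    exists l, forall e, 0 < e ->
      exists N, forall n, (N <= n)%N -> `|g (f ((rseq n)%:C%C * z)) - l| < e.
  move=> gl; have : cvg ((fun n => g (f ((rseq n)%:C%C * z))) @ \oo).
    apply/cauchy_cvgP; apply: cauchy_exP => e e0.
    have [d d0 Hd] := cz (e / 2) ltac:(lra); have [N HN] := rseq_gt d0.
    exists (g (f ((rseq N)%:C%C * z))); exists N => // n /= hn.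
    rewrite /ball /=; apply: le_lt_trans (gl _ _) _.
    by apply: le_lt_trans (Hd _ _ (rseq01 _) (rseq01 _) (HN _ (leqnn N)) (HN _ hn)) _; lra.
  move=> /cvg_ex[l /cvgrPdist_lt H]; exists l => e /H[N _ HN]; exists N => n hn.
  by rewrite distrC; exact: HN.
have [a Ha] := cau (@complex.Re R) ltac:(by move=> w w'; rewrite -cReN -cReD Re_le_cmod).
have [b Hb] := cau (@complex.Im R) ltac:(by move=> w w'; rewrite -cImN -cImD Im_le_cmod).
exists (a +i* b)%C => e e0.
have [N HN] := Ha (e / 2) ltac:(lra); have [M HM] := Hb (e / 2) ltac:(lra).
exists (maxn N M) => n; rewrite geq_max => /andP[/HN h1 /HM h2].
apply: le_lt_trans (cmod_le _) _; rewrite !cE /=; lra.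
Qed.

Lemma fext_disc z : cmod z < 1 -> radial_cauchy z /\
  seq_cvg (fun n => f ((rseq n)%:C%C * z)) (fext f z).
Proof.
move=> z1; rewrite /fext z1.
have key e : 0 < e -> exists2 d, 0 < d & forall r, 0 <= r < 1 -> 1 - d < r ->
    cmod (f (r%:C%C * z) - f z) < e.
  move=> e0; have [d d0 Hd] := cdiff_cont (analytic_cdiff fa z1) e0.
  exists d => // r /andP[r0 r1] dr; apply: Hd.
  rewrite -[X in cmod (_ - X)]mul1r -mulrBl cmodM -rmorphB cmodr distrC ger0_norm; last lra.
  have : (1 - r) * cmod z <= (1 - r) * 1 by rewrite ler_wpM2l ?ltW //; lra.
  lra.
split=> e e0.
- have [d d0 Hd] := key (e / 2) ltac:(lra); exists d => // r r' h h' k k'.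
  have := Hd r h k; have := Hd r' h' k'.
  have := cmodB (f (r%:C%C * z) - f z) (f (r'%:C%C * z) - f z).
  by rewrite opprB addrA subrK; lra.
- have [d d0 Hd] := key e e0; have [N HN] := rseq_gt d0.
  by exists N => n /HN; apply: Hd; exact: rseq01.
Qed.

(** The Cauchy condition over all radii is equivalent to the existence of the radial limit, so it
    decides which branch [boundary] takes; 0 is its default value. *)
Lemma fext_circle z : cmod z = 1 ->
  (radial_cauchy z -> seq_cvg (fun n => f ((rseq n)%:C%C * z)) (fext f z)) /\
  (~ radial_cauchy z -> fext f z = 0).
Proof.
move=> z1; rewrite /fext z1 ltxx /boundary.
case: pselect => [P|nP]; last first.
  split=> // cz; exfalso; apply: nP; have [l Hl] := radial_cauchy_cvg cz.
  exists l => e e0; have [d d0 Hd] := cz (e / 2) ltac:(lra).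
  exists d => // r r0 /andP[r1 r2].
  have [N HN] := Hl (e / 2) ltac:(lra); have [M HM] := rseq_gt d0.
  have h1 := HN _ (leq_maxl N M); have h2 := HM _ (leq_maxr N M).
  have := Hd r (rseq (maxn N M)) _ (rseq01 _) r1 h2; rewrite r0 r2 => /(_ isT) h3.
  have := cmodD (f (r%:C%C * z) - f ((rseq (maxn N M))%:C%C * z))
    (f ((rseq (maxn N M))%:C%C * z) - l).
  by rewrite addrA subrK; lra.
have Hl := projT2 (cid P); move: (projT1 _) Hl => l Hl.
split=> [_ e e0|nc].
  have [d d0 Hd] := Hl e e0; have [N HN] := rseq_gt d0.
  exists N => n /HN h; have /andP[r0 r1] := rseq01 n.
  by apply: Hd => //; rewrite h.
exfalso; apply: nc => e e0; have [d d0 Hd] := Hl (e / 2) ltac:(lra).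
exists d => // r r' /andP[a0 a1] /andP[b0 b1] k k'.
have := Hd r a0 _; rewrite k a1 => /(_ isT) h1.
have := Hd r' b0 _; rewrite k' b1 => /(_ isT) h2.
have := cmodB (f (r%:C%C * z) - l) (f (r'%:C%C * z) - l).
by rewrite opprB addrA subrK; lra.
Qed.

Lemma fext_cvg p : cdisc p ->
  (radial_cauchy (toC p) -> seq_cvg (fun n => f ((rseq n)%:C%C * toC p)) (fext f (toC p))) /\
  (~ radial_cauchy (toC p) -> fext f (toC p) = 0).
Proof.
rewrite /cdisc /= le_eqVlt => /predU1P[/fext_circle //|/fext_disc[h1 h2]].
by split.
Qed.

Lemma scale_in_disc r z : 0 <= r < 1 -> cmod z <= 1 -> cmod (r%:C%C * z) < 1.
Proof.
move=> /andP[r0 r1] z1; rewrite cmodM cmodr ger0_norm //.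
by apply: le_lt_trans r1; rewrite ler_piMr.
Qed.

Lemma cdiff_scale r z : 0 <= r < 1 -> cmod z <= 1 -> cdiff (fun w => f (r%:C%C * w)) z.
Proof.
move=> r01 z1; apply: (@cdiff_comp _ f (fun w => r%:C%C * w)).
  by apply: cdiff_mul; [exact: cdiff_cst|exact: cdiff_id].
by apply: analytic_cdiff => //; exact: scale_in_disc.
Qed.

Definition radial_set : set (R * R)%type := cdisc `&` [set p | radial_cauchy (toC p)].

(** The failure of the Cauchy condition for given tolerances is a union, over uncountably many pairs
    of radii, of relatively open sets. It is therefore relatively open, and only countable
    operations over the tolerances remain. *)
Lemma measurable_radial_set : measurable radial_set.
Proof.
pose bad k m : set (R * R)%type := [set p | exists r r', [/\ 0 <= r < 1, 0 <= r' < 1,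
  1 - m.+1%:R^-1 < r, 1 - m.+1%:R^-1 < r' &
  k.+1%:R^-1 < cmod (f (r%:C%C * toC p) - f (r'%:C%C * toC p))]].
have -> : radial_set = cdisc `&` \bigcap_k \bigcup_m (cdisc `\` (cdisc `&` bad k m)).
  apply/seteqP; split => p [p1 /= H]; split => //.
  - move=> k _; have [d d0 Hd] := H k.+1%:R^-1 ltac:(by rewrite invr_gt0 ltr0n).
    exists (Num.truncn d^-1) => //; split => // -[_ [r [r' [h h' q q']]]].
    have dm : (Num.truncn d^-1).+1%:R^-1 < d.
      by rewrite -[X in _ < X]invrK ltf_pV2 ?posrE ?invr_gt0 ?ltr0n // truncnS_gt.
    have dm1 : 1 - d < 1 - (Num.truncn d^-1).+1%:R^-1 by rewrite ltrD2l ltrN2.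
    by rewrite ltNge Hd // (lt_trans dm1).
  - move=> e e0; have [m _ [_ Hm]] := H (Num.truncn e^-1) I.
    exists m.+1%:R^-1; first by rewrite invr_gt0 ltr0n.
    move=> r r' h h' q q'; rewrite leNgt; apply/negP => L; apply: Hm; split => //.
    exists r, r'; split => //; apply: lt_trans L.
    by rewrite -[X in _ < X]invrK ltf_pV2 ?posrE ?invr_gt0 ?ltr0n // truncnS_gt.
apply: measurableI; first exact: measurable_cdisc.
apply: bigcapT_measurable => k; apply: bigcupT_measurable => m.
apply: measurableD; first exact: measurable_cdisc.
pose U : set (R * R)%type := [set p | exists2 d, 0 < d & forall p' : R * R,
    `|p'.1 - p.1| < d -> `|p'.2 - p.2| < d -> bad k m p'].
rewrite (_ : cdisc `&` _ = cdisc `&` U).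
  apply: measurableI; first exact: measurable_cdisc.
  apply: open_plane_measurable => p [d d0 Hd].
  exists (d / 2); first by lra.
  move=> p' h1 h2; exists (d / 2); first by lra.
  move=> q h3 h4; apply: Hd.
    by have := ler_normD (q.1 - p'.1) (p'.1 - p.1); rewrite addrA subrK; lra.
  by have := ler_normD (q.2 - p'.2) (p'.2 - p.2); rewrite addrA subrK; lra.
apply/seteqP; split => p [Dp]; rewrite /U /= => H; split => //.
- have [r [r' [h h' q q' L]]] := H.
  have cg : pcont cdisc (fun p => cmod (f (r%:C%C * toC p) - f (r'%:C%C * toC p))).
    apply: (@rcont_pcont _ cdisc (fun z => cmod (f (r%:C%C * z) - f (r'%:C%C * z)))) => p0 hp0.
    apply: (@ccont_cmod _ (fun z => f (r%:C%C * z) - f (r'%:C%C * z))); apply: cdiff_cont.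
    have -> : (fun z => f (r%:C%C * z) - f (r'%:C%C * z)) =
      fun z => f (r%:C%C * z) + (-1) * f (r'%:C%C * z).
      by apply/funext => z; rewrite mulN1r.
    apply: cdiff_add; first exact: cdiff_scale.
    by apply: cdiff_mul; [exact: cdiff_cst|exact: cdiff_scale].
  have [d d0 Hd] := cg p Dp (cmod (f (r%:C%C * toC p) - f (r'%:C%C * toC p)) - k.+1%:R^-1) ltac:(by rewrite subr_gt0).
  exists d => // p' k1 k2; exists r, r'; split => //.
  by have := Hd p' k1 k2; rewrite ltr_norml opprB ltrD2r => /andP[].
- by case: H => d d0; apply; rewrite subrr normr0.
Qed.

End RadialLimit.

(** * Passage to the limit along dilations *)

Section Embedding.
Variable R : realType.
Implicit Types (z xi : R[i]) (e d r t x a h s : R).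

Section Approx.
Variable f : R[i] -> R[i].
Hypothesis fa : analytic_disc f.
Variable g : R[i] -> R.
Hypothesis g0 : g 0 = 0.
Hypothesis gl : forall w w', `|g w - g w'| <= cmod (w - w').

(** [g] stands for the real part, the imaginary part or the modulus. The indicator matches the
    default value 0 of [fext], which makes the convergence hold at every point of the closed
    disc. *)
Definition approx n (p : R * R) : R :=
  g (f ((rseq R n)%:C%C * toC p)) * \1_(radial_set f) p.

Lemma approx_cvg p : cdisc p -> approx ^~ p @ \oo --> g (fext f (toC p)).
Proof.
move=> hp; have [h1 h2] := fext_cvg fa hp; rewrite /approx.
have [c|nc] := pselect (radial_cauchy f (toC p)).
  apply/cvgrPdist_lt => e e0; have [N HN] := h1 c e e0; exists N => // n /= hn.
  rewrite indicE (_ : p \in _) ?mulr1; last by rewrite inE; split.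
  by apply: le_lt_trans (gl _ _) _; rewrite cmodBC; exact: HN.
rewrite h2 // g0; apply: cvg_near_cst; apply: nearW => n.
rewrite indicE (_ : p \in _ = false) ?mulr0 //.
by apply/negP; rewrite inE => -[].
Qed.

Lemma measurable_approx n : measurable_fun cdisc (approx n).
Proof.
apply: measurable_funM; last by apply: measurable_indic; exact: measurable_radial_set.
apply: (pcont_measurable (@measurable_cdisc R)).
apply: (@rcont_pcont _ cdisc (fun z => g (f ((rseq R n)%:C%C * z)))) => p hp e e0.
have [d d0 Hd] := cdiff_cont (cdiff_scale fa (rseq01 R n) hp) e0.
by exists d => // w hw; apply: le_lt_trans (gl _ _) _; exact: Hd.
Qed.

Lemma measurable_fext : measurable_fun cdisc (fun p => g (fext f (toC p))).
Proof. exact: measurable_fun_cvg measurable_approx approx_cvg. Qed.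

End Approx.

Lemma cmod_lip (w w' : R[i]) : `|cmod w - cmod w'| <= cmod (w - w').
Proof. by rewrite ler_norml cmod_lerB andbT lerNl opprB cmodBC cmod_lerB. Qed.

(** Fatou's lemma for the approximants; their indicator can only lower the integrand, so the bound
    for the dilations carries over. *)
Lemma fext_integral_le (mu : {finite_measure set (R * R)%type -> \bar R}) Psi f D :
  orlicz Psi -> analytic_disc f -> 0 < D ->
  (forall n, (\int[mu]_(p in cdisc) (Psi (cmod (f ((rseq R n)%:C%C * toC p)) / D))%:E <= 1)%E) ->
  (\int[mu]_(p in cdisc) (Psi (cmod (fext f (toC p)) / D))%:E <= 1)%E.
Proof.
move=> oP fa D0 H; have mD := @measurable_cdisc R.
pose ap := approx f (@cmod R).
have ap0 n p : 0 <= ap n p by rewrite mulr_ge0 ?cmod_ge0 // indicE ler0n.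
have apD n p : 0 <= ap n p / D by rewrite divr_ge0 // ltW.
pose F n p := (Psi (ap n p / D))%:E.
have mF n : measurable_fun cdisc (F n).
  apply/measurable_EFinP; apply: (orlicz_comp_measurable oP); first exact: apD.
  apply: measurable_funM; last exact: measurable_cst.
  exact: measurable_approx (@cmod_lip) n.
have F0 n p : cdisc p -> (0 <= F n p)%E by move=> _; rewrite lee_fin (orlicz_ge0 oP).
have lim p : cdisc p -> limn_einf (F ^~ p) = (Psi (cmod (fext f (toC p)) / D))%:E.
  move=> hp; apply: (cvg_limn_einf_sup _).1; apply: cvg_EFin; first exact: nearW.
  have ca := @approx_cvg f fa (@cmod R) (@cmod0 R) (@cmod_lip) p hp.
  apply/cvgrPdist_lt => e e0.
  have l0 : 0 <= cmod (fext f (toC p)) / D by rewrite divr_ge0 ?cmod_ge0 // ltW.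
  have [d d0 Hd] := orlicz_cont oP l0 e0.
  have dD : 0 < d * D by rewrite mulr_gt0.
  move: ca => /cvgrPdist_lt /(_ _ dD)[N _ HN]; exists N => // n /= /HN hn.
  rewrite distrC; apply: Hd => //.
  by rewrite -mulrBl normrM normfV (gtr0_norm D0) ltr_pdivrMr // distrC.
have -> : (\int[mu]_(p in cdisc) (Psi (cmod (fext f (toC p)) / D))%:E =
  \int[mu]_(p in cdisc) limn_einf (F ^~ p))%E.
  by apply: eq_integral => p /set_mem hp; rewrite lim.
apply: le_trans (fatou mu mD mF F0) _.
rewrite limn_einf_lim; apply: lime_le; first exact: is_cvg_einfs.
apply: nearW => n; apply: (@le_trans _ _ (\int[mu]_(p in cdisc) F n p)%E).
  by apply: ereal_inf_lbound; exists n => /=.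
apply: le_trans (H n); apply: ge0_le_integral => //.
- by move=> p hp; exact: F0.
- apply/measurable_EFinP; apply: (orlicz_comp_measurable oP).
    by move=> p; rewrite divr_ge0 ?cmod_ge0 // ltW.
  apply: measurable_funM; last exact: measurable_cst.
  apply: (pcont_measurable mD).
  apply: (@pcont_cmod _ (fun z => f ((rseq R n)%:C%C * z))) => z z1.
  exact: cdiff_scale (rseq01 R n) z1.
- move=> p hp; rewrite lee_fin; apply: (orlicz_le oP) => //.
  rewrite ler_pM2r ?invr_gt0 // /ap /approx ler_piMr ?cmod_ge0 // indicE.
Qed.

Lemma sufficiency (mu : {finite_measure set (R * R)%type -> \bar R}) Psi1 Psi2 A :
  orlicz Psi1 -> orlicz Psi2 -> 0 < A ->
  (forall h, 0 < h <= 1 ->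
     (K_mu mu h <= (h^-1 / Psi2 (A * orlicz_inv Psi1 h^-1))%:E)%E) ->
  hardy_embeds mu Psi1 Psi2.
Proof.
move=> o1 o2 A0 HK; have [B B0 HB] := core_embedding o1 o2 A0 HK.
exists B; first exact: ltW.
move=> f [fa fN]; split.
- apply: (@measurable_fext f fa (@complex.Re R)) => // w w'.
  by rewrite -cReN -cReD Re_le_cmod.
- apply: (@measurable_fext f fa (@complex.Im R)) => // w w'.
  by rewrite -cImN -cImD Im_le_cmod.
(* For D above the Hardy norm, the dilations of f / D satisfy the normalization of [core_embedding],
   and B depends neither on f nor on the radius. *)
have key D : 0 < D -> (hardy_norm Psi1 f < D%:E)%E ->
    (luxemburg mu cdisc Psi2 (fun p => cmod (fext f (toC p))) <= (D * B)%:E)%E.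
  move=> D0 fD; apply: ereal_inf_lbound; exists (D * B) => //; split; first exact: mulr_gt0.
  rewrite (eq_integral (fun p => (Psi2 (cmod (fext f (toC p)) / (D * B)))%:E)); last first.
    by move=> p _; rewrite ger0_norm ?cmod_ge0.
  apply: (fext_integral_le o2 fa); first exact: mulr_gt0.
  move=> n; pose F z := f ((rseq R n)%:C%C * z) * (D^-1)%:C%C.
  have cF z : cmod (F z) = cmod (f ((rseq R n)%:C%C * z)) / D.
    by rewrite /F cmodM cmodr ger0_norm // invr_ge0 ltW.
  have dF z : cmod z <= 1 -> cdiff F z.
    move=> z1; apply: cdiff_mul; last exact: cdiff_cst.
    exact: cdiff_scale (rseq01 R n) z1.
  have := HB F dF; have := hardy_circle o1 fa D0 fD (rseq01 R n) => L.
  have -> : sint 0 (2 * pi) (fun t => Psi1 (cmod (F (expi t)))) =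
    sint 0 (2 * pi) (fun t => Psi1 (cmod (f ((rseq R n)%:C%C * expi t)) / D)).
    by apply: eq_sint => t _; rewrite cF.
  move=> /(_ L); apply: le_trans; rewrite le_eqVlt; apply/orP; left; apply/eqP.
  by apply: eq_integral => p _; rewrite cF invfM mulrA.
have N0 : (0 <= hardy_norm Psi1 f)%E.
  apply: (@le_trans _ _ (luxemburg_circle Psi1 (fun t => cmod (f (0%:C%C * expi t)%R)))).
    by apply: le_ereal_inf_tmp => _ [D [D0 _] <-]; rewrite lee_fin ltW.
  by apply: ereal_sup_ubound; exists 0 => //=; rewrite lexx ltr01.
have [N NE] : exists N, hardy_norm Psi1 f = N%:E.
  by exists (fine (hardy_norm Psi1 f)); rewrite fineK // ge0_fin_numE.
rewrite NE lee_fin in N0; rewrite NE -EFinM; apply/lee_addgt0Pr => e e0.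
have eB : 0 < e / B by rewrite divr_gt0.
(* The norm may vanish or fail to be admissible itself, so D = N + e/B is used; after multiplication
   by B the error is e. *)
apply: le_trans (key (N + e / B) _ _) _; first by lra.
  by rewrite NE lte_fin ltrDl.
by rewrite -EFinD lee_fin mulrDl divfK ?gt_eqF // mulrC.
Qed.

End Embedding.

(** * Test functions *)

Section Necessity.
Variable R : realType.
Implicit Types (z w xi : R[i]) (e d r t x a b h s : R) (f : R[i] -> R[i]).

Lemma cdiff_analytic f : (forall z, cmod z <= 1 -> cdiff f z) -> analytic_disc f.
Proof.
move=> df z /ltW /df [l Hl]; exists l => e e0.
have [d d0 Hd] := Hl (e / 2) ltac:(lra); exists d => // w _ /andP[w0 wd].
have wz : w - z != 0 by rewrite -cmod_gt0.
have -> : (f w - f z) / (w - z) - l = (f w - f z - l * (w - z)) / (w - z).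
  by rewrite [RHS]mulrBl mulfK.
rewrite cmodM cmodV ltr_pdivrMr //; apply: le_lt_trans (Hd w wd) _.
by rewrite ltr_pM2r //; lra.
Qed.

(** [boundary] returns some radial limit. Continuity makes f z one of them, and two radial limits
    agree by comparison at a radius close to 1. *)
Lemma fext_eq f z : cmod z <= 1 -> ccont f z -> fext f z = f z.
Proof.
rewrite le_eqVlt => /predU1P[z1|z1 _]; last by rewrite /fext z1.
move=> cf; rewrite /fext z1 ltxx /boundary.
have near d : 0 < d -> exists2 d', 0 < d' & forall r, 1 - d' < r < 1 ->
    cmod (r%:C%C * z - z) < d.
  move=> d0; exists d => // r /andP[r1 r2].
  rewrite -[X in cmod (_ - X)]mul1r -mulrBl cmodM -rmorphB cmodr z1 mulr1 distrC.
  by rewrite ger0_norm; lra.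
have Rl : radial_limit f z (f z).
  move=> e e0; have [d d0 Hd] := cf e e0; have [d' d'0 Hd'] := near d d0.
  by exists d' => // r _ /Hd'; exact: Hd.
case: pselect => [P|[]]; last by exists (f z).
have := projT2 (cid P); move: (projT1 _) => l Hl.
apply/eqP; rewrite -subr_eq0 -cmod_eq0 eq_le cmod_ge0 andbT leNgt; apply/negP => L.
pose e := cmod (l - f z) / 2; have e0 : 0 < e by rewrite /e; lra.
have [d d0 Hd] := Hl e e0; have [d' d'0 Hd'] := Rl e e0.
pose m := Num.min 1 (Num.min d d').
have m0 : 0 < m by rewrite !lt_min ltr01 d0.
have [m1 m2 m3] : [/\ m <= 1, m <= d & m <= d'].
  by rewrite !ge_min !lexx ?orbT.
have h1 := Hd (1 - m / 2) ltac:(lra) ltac:(by apply/andP; split; lra).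
have h2 := Hd' (1 - m / 2) ltac:(lra) ltac:(by apply/andP; split; lra).
have := cmodB (f ((1 - m / 2)%:C%C * z) - f z) (f ((1 - m / 2)%:C%C * z) - l).
by rewrite opprB addrC addrA subrK; rewrite /e in h1 h2; lra.
Qed.

Lemma one_sub_cos_le h : 0 <= h -> 1 - cos h <= h ^+ 2.
Proof.
move=> h0.
have cs (g g' : R -> R) : (forall y : R, is_derive y 1 g (g' y)) -> forall x : R, 0 <= x ->
    exists2 c, 0 <= c <= x & g x - g 0 = g' c * x.
  move=> dg x x0.
  have [|c] := @MVT_segment R g g' 0 x x0 (fun y _ => dg y).
    apply: continuous_subspaceT => y; apply: differentiable_continuous.
    by apply/derivable1_diffP; case: (dg y).
  by rewrite in_itv subr0; exists c.
have [c /andP[c0 ch]] := cs _ _ (@is_derive_cos R) h h0.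
have [d _] := cs _ _ (@is_derive_sin R) c c0.
rewrite cos0 sin0 subr0 => E1 E2.
have S : sin c <= h.
  by rewrite E1; apply: le_trans ch; rewrite ler_piMl // cos_le1.
have := ler_wpM2r h0 S; rewrite -expr2; lra.
Qed.

Definition test_den h xi z : R[i] := 1 - (1 - h)%:C%C * conjc xi * z.

(** With the square, the modulus h^2 / |1 - (1 - h) conj(xi) z|^2 is on each circle a multiple of a
    Poisson kernel, whose mean is known exactly. *)
Definition test_fun h xi z : R[i] := (h%:C%C / test_den h xi z) * (h%:C%C / test_den h xi z).

Section TestFunction.
Variables (h : R) (xi : R[i]).
Hypothesis h01 : 0 < h <= 1.
Hypothesis xi1 : cmod xi = 1.

Lemma test_den_ge z : cmod z <= 1 -> h <= cmod (test_den h xi z).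
Proof.
move=> z1; apply: le_trans (cmod_lerB _ _); have := h01 => /andP[h0 h1].
rewrite cmod1 !cmodM cmod_conj xi1 cmodr mulr1 ger0_norm; last lra.
have : (1 - h) * cmod z <= (1 - h) * 1 by rewrite ler_wpM2l //; lra.
lra.
Qed.

Lemma cdiff_test_fun z : cmod z <= 1 -> cdiff (test_fun h xi) z.
Proof.
move=> z1; have dd : cdiff (test_den h xi) z.
  have -> : test_den h xi = fun w => 1 + (- ((1 - h)%:C%C * conjc xi)) * w.
    by apply/funext => w; rewrite /test_den mulNr.
  apply: cdiff_add; first exact: cdiff_cst.
  by apply: cdiff_mul; [exact: cdiff_cst|exact: cdiff_id].
have d0 : test_den h xi z != 0.
  by rewrite -cmod_gt0; apply: lt_le_trans (test_den_ge z1); case/andP: h01.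
have dq : cdiff (fun w => h%:C%C / test_den h xi w) z by apply: cdiff_div => //; exact: cdiff_cst.
exact: cdiff_mul.
Qed.

Lemma cmod_test_fun z : cmod (test_fun h xi z) = h ^+ 2 / cmod (test_den h xi z) ^+ 2.
Proof.
case/andP: h01 => h0 _.
by rewrite /test_fun !cmodM cmodV cmodr ger0_norm ?(ltW h0) // -expr2 expr_div_n.
Qed.

Lemma cmod_test_fun_le1 z : cmod z <= 1 -> cmod (test_fun h xi z) <= 1.
Proof.
move=> /test_den_ge dh; case/andP: h01 => h0 _.
rewrite cmod_test_fun ler_pdivrMr ?mul1r ?exprn_gt0 ?(lt_le_trans h0 dh) //.
by rewrite lerXn2r // nnegrE ?cmod_ge0 // ltW.
Qed.

(** With q = |z| and y = Re(z conj(xi)), the squared denominator is (1 - (1 - h) q)^2 + 2 (1 - h)(q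
    - y). The first term is at most (2h)^2 as q > 1 - h, the second at most 2 h^2 as y > q cos h and
    1 - cos h <= h^2; 16 h^2 is ample. *)
Lemma test_fun_window p : window xi h p -> 16^-1 <= cmod (test_fun h xi (toC p)).
Proof.
rewrite window_eq // => -[p1 /= [p2 p3]]; case/andP: h01 => h0 h1.
have D0 : 0 < cmod (test_den h xi (toC p)) by apply: lt_le_trans (test_den_ge p1).
rewrite /cdisc /= in p1.
have aux : (cmod (test_den h xi (toC p))) ^+ 2 <= 16 * h ^+ 2.
  have -> : (cmod (test_den h xi (toC p))) ^+ 2 =
     1 - 2 * (1 - h) * complex.Re (toC p * conjc xi) + (1 - h) ^+ 2 * cmod (toC p) ^+ 2.
    have -> : cmod (toC p) ^+ 2 = cmod (toC p * conjc xi) ^+ 2 by rewrite cmodM cmod_conj xi1 mulr1.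
    rewrite /test_den -mulrA [conjc xi * _]mulrC; move: (toC p * _) => w.
    by rewrite !sqr_cmod !cE; ring.
  have C := one_sub_cos_le (ltW h0).
  move: p1 p2 p3 C; move: (complex.Re _) (cmod _) (cos h) => y q c q1 q2 yc C.
  have s1 : (1 - h) * (y - c * q) >= 0 by rewrite mulr_ge0 //; lra.
  have q0 : 0 <= q by lra.
  have s2 : (1 - h) * q * (h ^+ 2 - (1 - c)) >= 0 by rewrite !mulr_ge0 //; lra.
  have t1 : 0 <= 1 - (1 - h) * q by nra.
  have t2 : 1 - (1 - h) * q <= 2 * h by nra.
  have s3 : (1 - (1 - h) * q) ^+ 2 <= (2 * h) ^+ 2 by rewrite lerXn2r ?nnegrE //; lra.
  have s4 : (1 - h) * q * h ^+ 2 <= 1 * h ^+ 2.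
    by rewrite ler_wpM2r ?sqr_ge0 //; nra.
  have := sqr_ge0 h; move: s1 s2 s3 s4; rewrite !expr2; lra.
by rewrite cmod_test_fun ler_pdivlMr ?exprn_gt0 // -ler_pdivlMl ?invr_gt0 // invrK.
Qed.

Lemma test_fun_circle r t b : xi = expi b -> 0 <= r < 1 ->
  cmod (test_fun h xi (r%:C%C * expi t)) =
  h ^+ 2 / (1 - ((1 - h) * r) ^+ 2) * pker ((1 - h) * r) (t - b).
Proof.
move=> xiE /andP[r0 r1]; case/andP: h01 => h0 h1.
have q0 : 0 <= (1 - h) * r by rewrite mulr_ge0 //; lra.
have q1 : (1 - h) * r < 1 by nra.
have D : 1 - ((1 - h) * r) ^+ 2 != 0 by rewrite gt_eqF // subr_gt0 expr_lt1.
rewrite cmod_test_fun /pker mulrA divfK //; congr (_ / _).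
rewrite /test_den xiE sqr_cmod !cE cosB.
have H1 := cos2Dsin2 t; have H2 := cos2Dsin2 b.
move: (cos t) (sin t) (cos b) (sin b) H1 H2 => c s c' s' H1 H2.
transitivity (1 - 2 * ((1 - h) * r) * (c * c' + s * s') +
  ((1 - h) * r) ^+ 2 * ((c ^+ 2 + s ^+ 2) * (c' ^+ 2 + s' ^+ 2))); first by ring.
by rewrite H1 H2 !mulr1.
Qed.

(** The mean is h^2 / (1 - q^2) with q = (1 - h) r, and 1 - q^2 >= h because q <= 1 - h. *)
Lemma test_fun_mean r : 0 <= r < 1 ->
  sint 0 (2 * pi) (fun t => cmod (test_fun h xi (r%:C%C * expi t))) <= 2 * pi * h.
Proof.
move=> r01; have [b _ E] := polar_pos xi; rewrite xi1 mul1r in E.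
case/andP: (h01) (r01) => h0 h1 /andP[r0 r1].
have q0 : 0 <= (1 - h) * r by rewrite mulr_ge0 //; lra.
have qh : (1 - h) * r <= 1 - h by nra.
rewrite (eq_sint (fun t _ => test_fun_circle t E r01)).
move: ((1 - h) * r) q0 qh => q q0 qh.
have q01 : 0 <= q < 1 by rewrite q0 /=; lra.
have cp (t : R) : {for t, continuous (pker q)} by exact: pker_continuous.
have cs (t : R) : {for t, continuous (fun t => pker q (t - b))}.
  apply: (@continuous_comp _ _ _ (fun x => x - b) (pker q)); last exact: cp.
  by apply: cvgB; [exact: cvg_id|exact: cvg_cst].
rewrite sint_scale; last by move=> t _; exact: cs.
have p0 := pi2_gt0 R.
have per (t : R) : pker q (t + 2 * pi) = pker q t.
  by rewrite /pker (_ : t + 2 * pi = t + pi *+ 2) ?cosD2pi // mulr_natl.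
rewrite -(sint_shift (- b) (ltW p0) cp) add0r [2 * pi - b]addrC.
rewrite (sint_period (- b) (ltW p0) cp per).
rewrite sint_pker // [leRHS]mulrC; apply: ler_wpM2r; first exact: ltW.
have q2 : h <= 1 - q ^+ 2 by nra.
by rewrite ler_pdivrMr ?(lt_le_trans h0 q2) // expr2 ler_wpM2l // ltW.
Qed.

(** As the modulus u is at most 1, convexity gives Psi (u x) <= u Psi x = u / h for x = Psi^-1(1/h),
    and the mean of u is at most h. *)
Lemma test_fun_hardy Psi : orlicz Psi ->
  (hardy_norm Psi (test_fun h xi) <= ((orlicz_inv Psi h^-1)^-1)%:E)%E.
Proof.
move=> oP; case/andP: (h01) => h0 h1.
have hV : 0 < h^-1 by rewrite invr_gt0.
have x0 := orlicz_inv_gt0 oP hV; have [_ Px] := orlicz_invK oP (ltW hV).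
move: (orlicz_inv _ _) x0 Px => x x0 Px; have p0 := pi2_gt0 R.
apply: ge_ereal_sup => _ [r r01 <-].
apply: ereal_inf_lbound; exists x^-1 => //; split; first by rewrite invr_gt0.
pose u t := cmod (test_fun h xi (r%:C%C * expi t)).
have z1 t : cmod (r%:C%C * expi t) <= 1.
  by rewrite cmodM cmod_expi mulr1 cmodr; case/andP: r01 => r0 r1; rewrite ger0_norm // ltW.
have cu (t : R) : {for t, continuous u}.
  apply: (@rcont_circle _ (fun w => cmod (test_fun h xi w))).
  exact/ccont_cmod/cdiff_cont/cdiff_test_fun.
have cP (t : R) : {for t, continuous (fun t => Psi (u t * x))}.
  apply: (orlicz_comp_cont oP); first by move=> s; rewrite mulr_ge0 ?cmod_ge0 // ltW.
  by apply: cvgM; [exact: cu|exact: cvg_cst].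
rewrite (_ : (\int[_]_(t in _) _)%E = (sint 0 (2 * pi) (fun t => Psi (u t * x)))%:E); last first.
  rewrite sintE; last by move=> t _; exact: cP.
  by apply: eq_integral => t _; rewrite invrK ger0_norm ?cmod_ge0.
rewrite -EFinM lee_fin mulrC ler_pdivrMr // mul1r.
apply: (@le_trans _ _ (sint 0 (2 * pi) (fun t => h^-1 * u t))).
  apply: le_sint => [t _|t _|t _]; first exact: cP.
    by apply: cvgM; [exact: cvg_cst|exact: cu].
  rewrite [leRHS]mulrC -Px; apply: (orlicz_scale oP); last exact: ltW.
  by rewrite cmod_ge0 cmod_test_fun_le1.
rewrite sint_scale; last by move=> t _; exact: cu.
by rewrite mulrC ler_pdivrMr // test_fun_mean.
Qed.

End TestFunction.

Lemma necessity (mu : {finite_measure set (R * R)%type -> \bar R}) Psi1 Psi2 :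
  orlicz Psi1 -> orlicz Psi2 -> hardy_embeds mu Psi1 Psi2 ->
  exists2 A : R, 0 < A & forall h, 0 < h <= 1 ->
    (rho_mu mu h <= ((Psi2 (A * orlicz_inv Psi1 h^-1))^-1)%:E)%E.
Proof.
(* 16 is the inverse of the lower bound for the test functions on the window. K + 1 in place of K
   makes the norm strictly less than (K + 1)/x, so that some admissible D lies below (K + 1)/x. *)
move=> o1 o2 [K K0 HK]; pose A := (16 * (K + 1))^-1.
have A0 : 0 < A by rewrite invr_gt0 mulr_gt0 //; lra.
exists A => // h h01; case/andP: (h01) => h0 h1.
apply: ge_ereal_sup => _ [xi xi1 <-].
have hN := test_fun_hardy h01 xi1 o1.
have hV : 0 < h^-1 by rewrite invr_gt0.
have x0 := orlicz_inv_gt0 o1 hV.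
move: (orlicz_inv _ _) x0 hN => x x0 hN.
have fa := cdiff_analytic (cdiff_test_fun h01 xi1).
have [_ _ L] := HK (test_fun h xi) (conj fa (le_lt_trans hN (ltry _))).
have : (luxemburg mu cdisc Psi2 (fun p => cmod (fext (test_fun h xi) (toC p))) <
    ((K + 1) / x)%:E)%E.
  apply: le_lt_trans L _; apply: le_lt_trans (lee_wpmul2l _ hN) _; first by rewrite lee_fin.
  by rewrite -EFinM lte_fin ltr_pM2r ?invr_gt0 //; lra.
move=> /ereal_inf_lt[_ [D [D0 HD] <-]]; rewrite lte_fin => DK.
have Ax : A * x <= 16^-1 / D.
  rewrite /A invfM -mulrA ler_pM2l ?invr_gt0 // mulrC.
  rewrite -[leLHS]invrK lef_pV2 ?posrE //; last by rewrite invr_gt0 mulr_gt0 ?invr_gt0 //; lra.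
  by rewrite invfM invrK mulrC ltW.
have mW := measurable_window xi1 h01.
have Ax0 : 0 < A * x by rewrite mulr_gt0.
have P0 := orlicz_gt0 o2 Ax0.
have WD : window xi h `<=` cdisc by rewrite window_eq // => p [].
have mg : measurable_fun cdisc
    (fun p => (Psi2 (`|cmod (fext (test_fun h xi) (toC p))| / D))%:E).
  apply/measurable_EFinP; apply: (orlicz_comp_measurable o2).
    by move=> p; rewrite divr_ge0 // ltW.
  apply: measurable_funM; last exact: measurable_cst.
  apply: measurableT_comp => //.
  exact: (@measurable_fext _ _ fa (@cmod R) (@cmod0 R) (@cmod_lip R)).
(* Chebyshev's inequality: on the window the test function divided by D is at least 1/(16 D) >= A
   x. *)
have : ((Psi2 (A * x))%:E * mu (window xi h) <= 1)%E.
  rewrite -integral_cst //; apply: le_trans HD.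
  apply: le_trans (ge0_subset_integral _ mW (@measurable_cdisc R) mg _ WD); last first.
    by move=> p _; rewrite lee_fin (orlicz_ge0 o2) // divr_ge0 // ltW.
  apply: ge0_le_integral => //.
  - by move=> p _; rewrite lee_fin ltW.
  - exact: (measurable_funS (@measurable_cdisc R) WD mg).
  - move=> p Wp; rewrite lee_fin; apply: (orlicz_le o2); first exact: ltW.
    apply: le_trans Ax _; rewrite ler_pM2r ?invr_gt0 // ger0_norm ?cmod_ge0 //.
    have p1 : cmod (toC p) <= 1 by exact: WD.
    rewrite fext_eq //; last exact/cdiff_cont/cdiff_test_fun.
    exact: test_fun_window.
have -> : mu (window xi h) = (fine (mu (window xi h)))%:E by rewrite fineK // fin_num_measure.
by rewrite -EFinM !lee_fin -ler_pdivlMl // mulr1.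
Qed.

End Necessity.

Theorem mainTheorem10 (R : realType)
    (mu : {finite_measure set (R * R)%type -> \bar R})
    (Psi1 Psi2 : R -> R) :
  mu (~` cdisc) = 0%E ->
  orlicz Psi1 -> orlicz Psi2 ->
  (hardy_embeds mu Psi1 Psi2 ->
     exists2 A : R, 0 < A & forall h : R, 0 < h <= 1 ->
       (rho_mu mu h <= ((Psi2 (A * orlicz_inv Psi1 h^-1))^-1)%:E)%E)
  /\
  ((exists2 A : R, 0 < A & forall h : R, 0 < h <= 1 ->
       (K_mu mu h <= (h^-1 / Psi2 (A * orlicz_inv Psi1 h^-1))%:E)%E) ->
     hardy_embeds mu Psi1 Psi2).
Proof.
move=> _ o1 o2; split; first exact: necessity.
by move=> [A A0 HK]; exact: sufficiency HK.
Qed.
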